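(* For every $n\ge1$ the sphere $S^{2n+1}$ carries a Riemannian metric $g$ and a vector field $T$ such that $T$ is an irregular Sasakian structure on $(S^{2n+1},g)$ and $(S^{2n+1},g)$ has cohomogeneity one, i.e. the generic orbits of its isometry group have codimension one.
   Context: A Sasakian structure on a Riemannian manifold $(M,g)$ is a Killing vector field $\xi$ of unit length such that $(\nabla_X(\nabla\xi))(Y)=g(\xi,Y)X-g(X,Y)\xi$ for all tangent vectors $X,Y$, where $\nabla$ is the Levi-Civita connection. It is called irregular if the flow of $\xi$ has a non-closed orbit. *)

(* Defs.v *)
From HB Require Import structures.
From mathcomp Require Import all_boot all_order all_algebra.
From mathcomp Require Import all_classical all_reals all_analysis.

Set Implicit Arguments.
Unset Strict Implicit.
Unset Printing Implicit Defensive.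

Import Order.TTheory GRing.Theory Num.Theory.
Import numFieldNormedType.Exports.

Local Open Scope classical_set_scope.
Local Open Scope ring_scope.

(* The sphere S^m is treated as a submanifold of R^(m+1). Functions, vector
   fields and metrics on S^m are represented by total functions on R^(m+1) of
   which only the values on S^m are ever constrained or used. *)

(* The norm `|x| of the library on 'rV_m is the sup norm. *)
Definition dot (R : realType) (m : nat) (x y : 'rV[R]_m) : R :=
  \sum_i x 0 i * y 0 i.

Definition sphere (R : realType) (m : nat) : set 'rV[R]_m.+1 :=
  [set x | dot x x = 1].
Arguments sphere : clear implicits.

Definition tangent (R : realType) (m : nat) (x : 'rV[R]_m.+1) :
  set 'rV[R]_m.+1 := [set v | dot x v = 0].

(* [U] is meant to be open *)
Fixpoint Ck (R : realType) (V W : normedModType R) (k : nat) (U : set V)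
    (f : V -> W) : Prop :=
  match k with
  | 0%N => forall x, U x -> {for x, continuous f}
  | k'.+1 => (forall x, U x -> differentiable f x) /\
             (forall v : V, Ck k' U (fun x => 'D_v f x))
  end.

Definition smooth_on (R : realType) (V W : normedModType R) (A : set V)
    (f : V -> W) : Prop :=
  forall x, A x -> exists (U : set V) (F : V -> W),
    [/\ open U, U x, forall k, Ck k U F & forall y, A y -> U y -> f y = F y].

(* The differential at [x] in S^m, applied to the tangent vector [v], of a
   function [f] on S^m: since y |-> y / |y| is the identity on S^m, this is
   the derivative along [v] of an extension of [f] which depends only on the
   values of [f] on S^m. *)
Definition dS (R : realType) (m : nat) (W : normedModType R)
    (f : 'rV[R]_m.+1 -> W) (x v : 'rV[R]_m.+1) : W :=
  'D_v (fun y => f ((Num.sqrt (dot y y))^-1 *: y)) x.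

Definition smooth_fun (R : realType) (m : nat) (f : 'rV[R]_m.+1 -> R) : Prop :=
  smooth_on (sphere R m) f.

Definition vector_field (R : realType) (m : nat)
    (X : 'rV[R]_m.+1 -> 'rV[R]_m.+1) : Prop :=
  smooth_on (sphere R m) X /\ forall x, sphere R m x -> tangent x (X x).

Definition lie_bracket (R : realType) (m : nat)
    (X Y : 'rV[R]_m.+1 -> 'rV[R]_m.+1) (x : 'rV[R]_m.+1) : 'rV[R]_m.+1 :=
  dS Y x (X x) - dS X x (Y x).

(* [g x u v] is the value at [x] of the metric on the tangent vectors
   [u] and [v]. *)
Record riemannian_metric (R : realType) (m : nat)
    (g : 'rV[R]_m.+1 -> 'rV[R]_m.+1 -> 'rV[R]_m.+1 -> R) : Prop := {
  metric_linear : forall x a u v w, sphere R m x ->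
    tangent x u -> tangent x v -> tangent x w ->
    g x (a *: u + v) w = a * g x u w + g x v w;
  metric_sym : forall x u v, sphere R m x -> tangent x u -> tangent x v ->
    g x u v = g x v u;
  metric_pos : forall x u, sphere R m x -> tangent x u -> u != 0 ->
    0 < g x u u;
  metric_smooth : forall X Y, vector_field X -> vector_field Y ->
    smooth_fun (fun x => g x (X x) (Y x)) }.

(* [D X Y] is the covariant derivative of [Y] along [X]. *)
Record levi_civita (R : realType) (m : nat)
    (g : 'rV[R]_m.+1 -> 'rV[R]_m.+1 -> 'rV[R]_m.+1 -> R)
    (D : ('rV[R]_m.+1 -> 'rV[R]_m.+1) -> ('rV[R]_m.+1 -> 'rV[R]_m.+1) ->
         'rV[R]_m.+1 -> 'rV[R]_m.+1) : Prop := {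
  lc_field : forall X Y, vector_field X -> vector_field Y ->
    vector_field (D X Y);
  lc_addl : forall X Y Z x, vector_field X -> vector_field Y ->
    vector_field Z -> sphere R m x ->
    D (fun y => X y + Y y) Z x = D X Z x + D Y Z x;
  lc_mull : forall f X Y x, smooth_fun f -> vector_field X ->
    vector_field Y -> sphere R m x ->
    D (fun y => f y *: X y) Y x = f x *: D X Y x;
  lc_addr : forall X Y Z x, vector_field X -> vector_field Y ->
    vector_field Z -> sphere R m x ->
    D X (fun y => Y y + Z y) x = D X Y x + D X Z x;
  lc_leibniz : forall f X Y x, smooth_fun f -> vector_field X ->
    vector_field Y -> sphere R m x ->
    D X (fun y => f y *: Y y) x = dS f x (X x) *: Y x + f x *: D X Y x;
  lc_torsion_free : forall X Y x, vector_field X -> vector_field Y ->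
    sphere R m x -> D X Y x - D Y X x = lie_bracket X Y x;
  lc_metric : forall X Y Z x, vector_field X -> vector_field Y ->
    vector_field Z -> sphere R m x ->
    dS (fun y => g y (Y y) (Z y)) x (X x)
      = g x (D X Y x) (Z x) + g x (Y x) (D X Z x) }.

(* The Lie derivative of [g] along [xi] vanishes. *)
Definition killing (R : realType) (m : nat)
    (g : 'rV[R]_m.+1 -> 'rV[R]_m.+1 -> 'rV[R]_m.+1 -> R)
    (xi : 'rV[R]_m.+1 -> 'rV[R]_m.+1) : Prop :=
  vector_field xi /\
  forall X Y x, vector_field X -> vector_field Y -> sphere R m x ->
    dS (fun y => g y (X y) (Y y)) x (xi x)
      = g x (lie_bracket xi X x) (Y x) + g x (X x) (lie_bracket xi Y x).

(* The left-hand side of the last equation is the covariant derivative along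
   [X] of the endomorphism Y |-> D Y xi of the tangent bundle, applied to
   [Y]. Both sides are tensorial in [X] and [Y]. *)
Definition sasakian (R : realType) (m : nat)
    (g : 'rV[R]_m.+1 -> 'rV[R]_m.+1 -> 'rV[R]_m.+1 -> R)
    (xi : 'rV[R]_m.+1 -> 'rV[R]_m.+1) : Prop :=
  [/\ killing g xi,
      forall x, sphere R m x -> g x (xi x) (xi x) = 1
    & exists D, levi_civita g D /\
        forall X Y x, vector_field X -> vector_field Y -> sphere R m x ->
          D X (D Y xi) x - D (D X Y) xi x
            = g x (xi x) (Y x) *: X x - g x (X x) (Y x) *: xi x].

Definition integral_curve (R : realType) (m : nat)
    (xi : 'rV[R]_m.+1 -> 'rV[R]_m.+1) (c : R -> 'rV[R]_m.+1) : Prop :=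
  forall t : R, sphere R m (c t) /\ is_derive t 1 c (xi (c t)).

(* S^m being compact, the orbits of the flow of [xi] are exactly the ranges
   of the integral curves defined on the whole real line. *)
Definition irregular (R : realType) (m : nat)
    (xi : 'rV[R]_m.+1 -> 'rV[R]_m.+1) : Prop :=
  exists c : R -> 'rV[R]_m.+1, integral_curve xi c /\ ~ closed (range c).

Definition isometry (R : realType) (m : nat)
    (g : 'rV[R]_m.+1 -> 'rV[R]_m.+1 -> 'rV[R]_m.+1 -> R)
    (phi : 'rV[R]_m.+1 -> 'rV[R]_m.+1) : Prop :=
  [/\ smooth_on (sphere R m) phi,
      forall x, sphere R m x -> sphere R m (phi x),
      exists psi : 'rV[R]_m.+1 -> 'rV[R]_m.+1,
        smooth_on (sphere R m) psi /\
        forall x, sphere R m x ->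
          [/\ sphere R m (psi x), psi (phi x) = x & phi (psi x) = x]
    & forall x u v, sphere R m x -> tangent x u -> tangent x v ->
        g (phi x) (dS phi x u) (dS phi x v) = g x u v].

Definition isometry_orbit (R : realType) (m : nat)
    (g : 'rV[R]_m.+1 -> 'rV[R]_m.+1 -> 'rV[R]_m.+1 -> R)
    (x : 'rV[R]_m.+1) : set 'rV[R]_m.+1 :=
  [set y | exists phi, isometry g phi /\ phi x = y].

(* [A] is an embedded submanifold of S^m of codimension [k]: locally in S^m
   it is the zero set of a submersion to R^k. *)
Definition submanifold_codim (R : realType) (m k : nat)
    (A : set 'rV[R]_m.+1) : Prop :=
  A `<=` sphere R m /\
  forall p, A p -> exists (U : set 'rV[R]_m.+1) (f : 'rV[R]_m.+1 -> 'rV[R]_k),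
    [/\ open U, U p, smooth_on (sphere R m `&` U) f,
        forall q, sphere R m q -> U q ->
          forall w, exists2 v, tangent q v & dS f q v = w
      & A `&` U = [set q | [/\ sphere R m q, U q & f q = 0]]].

(* The orbits through the points of an open dense subset of S^m have
   codimension [k]. *)
Definition cohomogeneity (R : realType) (m : nat)
    (g : 'rV[R]_m.+1 -> 'rV[R]_m.+1 -> 'rV[R]_m.+1 -> R) (k : nat) : Prop :=
  exists U : set 'rV[R]_m.+1,
    [/\ open U, sphere R m `<=` closure (sphere R m `&` U)
      & forall x, sphere R m x -> U x ->
          submanifold_codim k (isometry_orbit g x)].

(* Main.v *)
From HB Require Import structures.
Require Import Defs.
From mathcomp Require Import all_boot all_order all_algebra.
From mathcomp Require Import all_classical all_reals all_analysis.
From mathcomp Require Import ring lra zify.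

(* View S^(2n+1) as the unit sphere of C x C^n, with J the multiplication by i
   and E the projection onto the first factor, and let ep = sqrt 2. The flow of
   T x = J x + ep J (E x) rotates the two factors with speeds 1 + ep and 1. With
   f = 1 / (1 + ep <E x, x>) the form eta = f <J x, .> satisfies eta T = 1, and
   the metric which makes T a unit vector orthogonal to ker eta, and which is f
   times the flat metric on ker eta, is Sasakian; its Levi-Civita connection is
   the flat derivative plus the explicit tensor chr.
   Since sqrt 2 is irrational, the orbit of a point p + q with E p = p and
   E q = 0 accumulates at - p + q without reaching it.
   The unitary maps commuting with E are isometries and act transitively on the
   levels of s = <E x, x>. Conversely c = grad f / 2 is an eigenvector of the
   Ricci tensor whose eigenvalue is an injective function of s. Isometries
   preserve the Ricci spectrum at a point, which is finite, so that an orbit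
   meets finitely many levels 0 < s < 1 and is locally a level set of s. *)

Set Implicit Arguments.
Unset Strict Implicit.
Unset Printing Implicit Defensive.

Import Order.TTheory GRing.Theory Num.Theory.
Import numFieldNormedType.Exports.

Local Open Scope classical_set_scope.
Local Open Scope ring_scope.

(** * Functions of class C^k and the calculus on the sphere *)

(** The Sasakian condition dictates the metric: [eta] is the standard contact form divided by its
    value 1 + ep <E x, x> on T, and on its kernel d eta is f times the standard d<J x, .>, so that
    the transverse Kähler metric is f times the flat one. Bounding orbits from above is the hard
    direction, since every isometry has to be controlled, not only the unitary ones. The full
    isometry group is never determined: one invariant with finitely many values on an orbit
    suffices, and for it only the curvature operators applied to c are computed. That c is an
    eigenvector comes from the complex rank one of E. The invariant says nothing where c = 0, that
    is at s = 0 and s = 1, and an isometry might a priori send a generic point there. Each of these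
    two levels lies in a single orbit, which meets finitely many levels in between; those are
    removed from the open dense set. Fields and connections are total functions constrained only on
    the sphere, so locality and tensoriality are derived before any pointwise formula is used. The
    value ep = sqrt 2 makes the approach of the orbit to its limit an instance of Pell's
    equation. *)

Section CkCalculus.
Context {R : realType} {V : normedModType R}.
Implicit Types (U : set V) (k : nat).

Lemma near_eq_differentiable {W : normedModType R} (f g : V -> W) x :
  (\near x, f x = g x) -> differentiable f x -> differentiable g x.
Proof.
move=> fg df; have fgx : f x = g x by exact: nbhs_singleton fg.
have /diff_locallyP[ct eq] := df.
suff H : g \o shift x = cst (g x) + 'd f x +o_ (0 : V) id.
  have E : 'd g x = 'd f x :> (V -> W) by exact: diff_unique.
  by apply/diff_locallyP; rewrite E.
apply/eqaddoP => e e0; move/eqaddoP: eq => /(_ e e0) eq.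
have fg' : \forall y \near (0 : V), f (y + x) = g (y + x).
  by move: fg; rewrite (near_shift 0); apply: filterS => y; rewrite /= subr0.
near=> y.
have -> : ((g \o shift x) - (cst (g x) + 'd f x)) y =
          ((f \o shift x) - (cst (f x) + 'd f x)) y.
  by rewrite !fctE /= fgx; congr (_ - _); apply/esym; near: y.
by near: y.
Unshelve. all: by end_near. Qed.

Lemma open_near U x (P : V -> Prop) : open U -> U x ->
  (forall y, U y -> P y) -> \near x, P x.
Proof. by move=> oU Ux UP; apply: filterS UP _; apply: open_nbhs_nbhs. Qed.

Lemma eq_open_derive {W : normedModType R} U (f g : V -> W) x v :
  open U -> U x -> (forall y, U y -> f y = g y) -> 'D_v f x = 'D_v g x.
Proof. by move=> oU Ux fg; apply: near_eq_derive; exact: open_near fg. Qed.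

Lemma eq_Ck {W : normedModType R} k U (f g : V -> W) : open U ->
  (forall y, U y -> f y = g y) -> Ck k U f -> Ck k U g.
Proof.
move=> oU; elim: k f g => [|k IH] f g fg /=.
  move=> cf x Ux; have fgx := fg x Ux.
  have fgn : \near x, f x = g x by exact: open_near fg.
  suff : g @ x --> g x by [].
  rewrite -fgx; apply: cvg_trans (cf x Ux).
  by apply: near_eq_cvg; apply: filterS fgn => y ->.
case=> df Df; split.
  move=> x Ux; apply: near_eq_differentiable (df x Ux); exact: open_near fg.
move=> v; apply: IH (Df v) => y Uy; exact: eq_open_derive fg.
Qed.

Lemma Ck_sub {W : normedModType R} k U U' (f : V -> W) : U' `<=` U ->
  Ck k U f -> Ck k U' f.
Proof.
move=> UU; elim: k f => [|k IH] f /=; first by move=> cf x /UU; exact: cf.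
by case=> df Df; split=> [x /UU|v]; [exact: df|exact: IH].
Qed.

Lemma CkS {W : normedModType R} k U (f : V -> W) : Ck k.+1 U f -> Ck k U f.
Proof.
elim: k f => [|k IH] f /=.
  by case=> df _ x Ux; apply: differentiable_continuous; exact: df.
by case=> df Df; split=> // v; apply: IH; exact: Df.
Qed.

Lemma Ck_cst {W : normedModType R} k U (a : W) : Ck k U (cst a : V -> W).
Proof.
elim: k a => [|k IH] a /=; first by move=> x _; exact: cst_continuous.
split=> [x _|v]; first exact: differentiable_cst.
have -> : (fun x : V => 'D_v (cst a) x) = cst 0.
  by apply/funext => x; rewrite derive_cst.
exact: IH.
Qed.

Lemma CkD {W : normedModType R} k U (f g : V -> W) : open U ->
  Ck k U f -> Ck k U g -> Ck k U (fun x => f x + g x).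
Proof.
move=> oU; elim: k f g => [|k IH] f g /=.
  by move=> cf cg x Ux; apply: continuousD; [exact: cf|exact: cg].
move=> [df Df] [dg Dg]; split.
  by move=> x Ux; apply: differentiableD; [exact: df|exact: dg].
move=> v; apply: eq_Ck (IH _ _ (Df v) (Dg v)) => // y Uy.
rewrite -[RHS]/('D_v (f + g) y) deriveD //; apply: diff_derivable;
  [exact: df|exact: dg].
Qed.

Lemma CkM k U (f g : V -> R) : open U ->
  Ck k U f -> Ck k U g -> Ck k U (fun x => f x * g x).
Proof.
move=> oU; elim: k f g => [|k IH] f g.
  by move=> cf cg x Ux; apply: continuousM; [exact: cf|exact: cg].
move=> cf cg; have [df Df] := cf; have [dg Dg] := cg; split.
  by move=> x Ux; apply: differentiableM; [exact: df|exact: dg].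
move=> v.
have H := CkD oU (IH _ _ (CkS cf) (Dg v)) (IH _ _ (CkS cg) (Df v)).
apply: eq_Ck H => // y Uy.
rewrite -[RHS]/('D_v (f * g) y) deriveM //; apply: diff_derivable;
  [exact: df|exact: dg].
Qed.

(** The derivative - f' / f^2 is a product of functions that are C^k by induction; the square root
    below is treated in the same way. *)
Lemma Ck_inv k U (f : V -> R) : open U -> (forall x, U x -> f x != 0) ->
  Ck k U f -> Ck k U (fun x => (f x)^-1).
Proof.
move=> oU f0; elim: k => [|k IH] cf.
  by move=> x Ux; apply: continuousV; [exact: f0|exact: cf].
have [df Df] := cf; split.
  by move=> x Ux; apply: differentiableV; [exact: df|exact: f0].
move=> v; have iV := IH (CkS cf).
have H := CkM oU (CkM oU (CkM oU iV iV) (Ck_cst k U (-1 : R))) (Df v).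
apply: eq_Ck H => // y Uy /=.
rewrite deriveV ?f0 //; last by apply: diff_derivable; exact: df.
by rewrite /cst /GRing.scale /=; field; exact: f0.
Qed.

Lemma Ck_sqrt k U (f : V -> R) : open U -> (forall x, U x -> 0 < f x) ->
  Ck k U f -> Ck k U (fun x => Num.sqrt (f x)).
Proof.
move=> oU f0; elim: k => [|k IH] cf.
  move=> x Ux; apply: (@continuous_comp _ _ _ f Num.sqrt); first exact: cf.
  exact: sqrt_continuous.
have [df Df] := cf.
have ds x : U x -> differentiable (@Num.sqrt R) (f x).
  by move=> Ux; apply/derivable1_diffP; have [] := is_derive1_sqrt (f0 x Ux).
split.
  by move=> x Ux; apply: differentiable_comp; [exact: df|exact: ds].
move=> v; have S := IH (CkS cf).
have nz x : U x -> 2 * Num.sqrt (f x) != 0.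
  by move=> Ux; rewrite mulf_neq0 // gt_eqF // sqrtr_gt0 f0.
have H := CkM oU (Ck_inv oU nz (CkM oU (Ck_cst k U (2 : R)) S)) (Df v).
apply: eq_Ck H => // y Uy /=.
have dfy := df y Uy; have dsy := ds y Uy.
rewrite -[RHS]/('D_v (Num.sqrt \o f) y) [RHS]deriveE; last exact: differentiable_comp.
rewrite diff_comp //= (deriveE _ dfy).
by rewrite -[in RHS](mulr1 ('d f y v)) [RHS]linearZ /= -(deriveE _ dsy)
  derive_sqrt ?f0 // mulrC.
Qed.

Lemma Ck_sum {W : normedModType R} k U (I : eqType) (r : seq I)
    (F : I -> V -> W) : open U ->
  (forall i, Ck k U (F i)) -> Ck k U (fun x => \sum_(i <- r) F i x).
Proof.
move=> oU CF; elim: r => [|i r IH].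
  by apply: eq_Ck (Ck_cst k U (0 : W)) => // y _; rewrite big_nil.
by apply: eq_Ck (CkD oU (CF i) IH) => // y _; rewrite big_cons.
Qed.

Lemma differentiable_rV p (F : V -> 'rV[R]_p) x :
  (forall j, differentiable (fun y => F y 0 j) x) -> differentiable F x.
Proof.
move=> dF; rewrite (_ : F = \sum_(j < p) (fun y => F y 0 j *: delta_mx 0 j)).
  by apply: differentiable_sum => j; exact: differentiableZl.
by apply/funext => y; rewrite fct_sumE [LHS]row_sum_delta.
Qed.

Lemma differentiable_rV_coord p (F : V -> 'rV[R]_p) x j :
  differentiable F x -> differentiable (fun y => F y 0 j) x.
Proof.
move=> dF; apply: (@differentiable_comp _ _ _ _ F (fun M => M 0 j)) => //.
exact: differentiable_coord.
Qed.

Lemma derive_rV p (F : V -> 'rV[R]_p) x v j : differentiable F x ->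
  ('D_v F x) 0 j = 'D_v (fun y => F y 0 j) x.
Proof. by move=> dF; rewrite derive_mx ?mxE //; exact: diff_derivable. Qed.

Lemma Ck_coord k U p (F : V -> 'rV[R]_p) j : open U ->
  Ck k U F -> Ck k U (fun y => F y 0 j).
Proof.
move=> oU; elim: k F => [|k IH] F /=.
  move=> cF x Ux; apply: (@continuous_comp _ _ _ F (fun M => M 0 j)).
    exact: cF.
  exact: coord_continuous.
move=> [dF DF]; split.
  by move=> x Ux; apply: differentiable_rV_coord; exact: dF.
move=> v; apply: eq_Ck (IH _ (DF v)) => // y Uy.
by rewrite derive_rV //; exact: dF.
Qed.

Lemma continuous_rV p (F : V -> 'rV[R]_p) x :
  (forall j, {for x, continuous (fun y => F y 0 j)}) -> {for x, continuous F}.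
Proof.
move=> cF; apply/cvgrPdist_le => e e0.
have H : \forall y \near x, forall j, `|F x 0 j - F y 0 j| <= e.
  apply: filter_forall => j; exact: (cvgrPdist_le _ _).1 (cF j) e e0.
apply: filterS H => y H.
rewrite /Num.Def.normr/= mx_normrE (bigmax_le _ (ltW e0))//= => -[i j] _.
by rewrite !mxE /= ord1; exact: H.
Qed.

Lemma Ck_rV k U p (F : V -> 'rV[R]_p) : open U ->
  (forall j, Ck k U (fun y => F y 0 j)) -> Ck k U F.
Proof.
move=> oU; elim: k F => [|k IH] F /= CF.
  by move=> x Ux; apply: continuous_rV => j; exact: CF.
have dF x : U x -> differentiable F x.
  by move=> Ux; apply: differentiable_rV => j; exact: (CF j).1.
split=> // v; apply: IH => j; apply: eq_Ck ((CF j).2 v) => // y Uy.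
by rewrite derive_rV //; exact: dF.
Qed.

Lemma CkZ k U p (f : V -> R) (X : V -> 'rV[R]_p) : open U ->
  Ck k U f -> Ck k U X -> Ck k U (fun x => f x *: X x).
Proof.
move=> oU cf cX; apply: Ck_rV => // j.
by apply: eq_Ck (CkM oU cf (Ck_coord j oU cX)) => // y _; rewrite mxE.
Qed.

Lemma Ck_lin k U p q (F : V -> 'rV[R]_p) (M : 'M[R]_(p, q)) : open U ->
  Ck k U F -> Ck k U (fun x => F x *m M).
Proof.
move=> oU cF; apply: Ck_rV => // j.
have H : Ck k U (fun y => \sum_i F y 0 i * M i j).
  apply: Ck_sum => // i; apply: CkM => //; first exact: Ck_coord.
  exact: Ck_cst.
by apply: eq_Ck H => // y _; rewrite mxE.
Qed.

Lemma Ck_dot k U p (X Y : V -> 'rV[R]_p) : open U ->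
  Ck k U X -> Ck k U Y -> Ck k U (fun x => dot (X x) (Y x)).
Proof.
by move=> oU cX cY; apply: Ck_sum => // i; apply: CkM => //; exact: Ck_coord.
Qed.

End CkCalculus.

Section CkComposition.
Context {R : realType}.

Lemma Ck_id k (V : normedModType R) (U : set V) : Ck k U (fun x => x).
Proof.
case: k => [|k] /=; first by move=> x _; exact: cvg_id.
split=> [x _|v]; first by have [] := is_diff_id x.
have -> : (fun x : V => 'D_v (fun x => x) x) = cst v.
  by apply/funext => x; rewrite derive_id.
exact: Ck_cst.
Qed.

Lemma diff_rV_sum p (W : normedModType R) (F : 'rV[R]_p -> W) x v :
  differentiable F x -> 'D_v F x = \sum_i v 0 i *: 'D_(delta_mx 0 i) F x.
Proof.
move=> dF; rewrite deriveE // [in LHS](row_sum_delta v) linear_sum.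
by apply: eq_bigr => i _; rewrite linearZ deriveE.
Qed.

Lemma derive_comp (V W : normedModType R) p (F : 'rV[R]_p -> W)
    (G : V -> 'rV[R]_p) x v :
  differentiable G x -> differentiable F (G x) ->
  'D_v (fun y => F (G y)) x = 'D_('D_v G x) F (G x).
Proof.
move=> dG dF; rewrite [LHS]deriveE; last exact: differentiable_comp.
by rewrite (diff_comp dG dF) /= [RHS]deriveE // deriveE.
Qed.

(** With row vectors as the middle space the chain rule is a finite sum of coordinates of ['D_v G]
    times partial derivatives of [F] at [G y], to which the induction hypothesis applies. *)
Lemma Ck_comp k p (V : normedModType R) (U : set V) (U' : set 'rV[R]_p)
    (F : 'rV[R]_p -> R) (G : V -> 'rV[R]_p) : open U -> open U' ->
  (forall x, U x -> U' (G x)) -> Ck k U' F -> Ck k U G ->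
  Ck k U (fun x => F (G x)).
Proof.
move=> oU oU' GU; elim: k F => [|k IH] F.
  move=> cF cG x Ux; apply: (@continuous_comp _ _ _ G F); first exact: cG.
  by apply: cF; exact: GU.
move=> cF cG; have [dF DF] := cF; have [dG DG] := cG; split.
  move=> x Ux; apply: (@differentiable_comp _ _ _ _ G F); first exact: dG.
  by apply: dF; exact: GU.
move=> v.
have H : Ck k U (fun y => \sum_i ('D_v G y) 0 i * 'D_(delta_mx 0 i) F (G y)).
  apply: Ck_sum => // i; apply: CkM => //; first exact: Ck_coord (DG v).
  by apply: IH (DF _) (CkS cG).
apply: eq_Ck H => // y Uy.
by rewrite (@derive_comp V R) ?[RHS]diff_rV_sum //; [exact/dF/GU|exact: dG|exact/dF/GU].
Qed.

Lemma Ck_comp_rV k p q (V : normedModType R) (U : set V) (U' : set 'rV[R]_p)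
    (F : 'rV[R]_p -> 'rV[R]_q) (G : V -> 'rV[R]_p) : open U -> open U' ->
  (forall x, U x -> U' (G x)) -> Ck k U' F -> Ck k U G ->
  Ck k U (fun x => F (G x)).
Proof.
move=> oU oU' GU cF cG; apply: Ck_rV => // j.
exact: (Ck_comp oU oU' GU (Ck_coord j oU' cF) cG).
Qed.

End CkComposition.

(** * Symmetry of second derivatives *)

Section Schwarz.
Context {R : realType} {V : normedModType R}.
Implicit Types (F : V -> R) (u v x : V).

Lemma is_derive_line F u z (s : R) : differentiable F (s *: u + z) ->
  is_derive s 1 (fun s => F (s *: u + z)) ('D_u F (s *: u + z)).
Proof.
move=> dF; have dl : is_diff s (fun s : R => s *: u + z) ( *:%R ^~ u).
  have := @is_diffD R _ _ _ _ _ _ s (is_diff_scalel s u) (is_diff_cst z s).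
  by rewrite addr0.
have dl1 : differentiable (fun s : R => s *: u + z) s by have [] := dl.
have dc : differentiable (fun s : R => F (s *: u + z)) s.
  exact: (@differentiable_comp _ _ _ _ (fun s : R => s *: u + z) F).
split; first exact: diff_derivable.
rewrite deriveE // (diff_comp dl1 dF) /= (@diff_val _ _ _ _ _ _ _ dl) scale1r.
by rewrite deriveE.
Qed.

(** Mean value theorem twice: along u for s |-> F(s u + h v + x) - F(s u + x), then along v for
    ['D_u F]. *)
Lemma second_difference F u v x (h : R) : 0 < h ->
  (forall s t, s \in `[0, h]%R -> t \in `[0, h]%R ->
     differentiable F (s *: u + t *: v + x) /\
     differentiable ('D_u F) (s *: u + t *: v + x)) ->
  exists s t, [/\ s \in `[0, h]%R, t \in `[0, h]%R &
    F (h *: u + h *: v + x) - F (h *: u + x) - (F (h *: v + x) - F x)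
      = h ^+ 2 * 'D_v ('D_u F) (s *: u + t *: v + x)].
Proof.
move=> h0 dF.
have h00 : (0 : R) \in `[0, h]%R by rewrite in_itv /= lexx ltW.
have h0h : (h : R) \in `[0, h]%R by rewrite in_itv /= lexx ltW.
pose phi s := F (s *: u + (h *: v + x)) - F (s *: u + x).
pose dphi s := 'D_u F (s *: u + (h *: v + x)) - 'D_u F (s *: u + x).
have dphiP s : s \in `[0, h]%R -> is_derive s 1 phi (dphi s).
  move=> sh; apply: is_deriveB.
    by apply: is_derive_line; rewrite addrA; exact: (dF s h _ _).1.
  have := (dF s 0 sh h00).1; rewrite scale0r addr0; exact: is_derive_line.
have sub s : s \in `]0, h[%R -> s \in `[0, h]%R.
  by rewrite !in_itv /= => /andP[a b]; rewrite !ltW.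
have H1 s : s \in `]0, h[%R -> is_derive s 1 phi (dphi s).
  by move=> /sub; exact: dphiP.
have H2 : {within `[0, h], continuous phi}.
  by apply: derivable_within_continuous => s /dphiP[].
have [s sh phiE] := MVT h0 H1 H2.
have {}sh := sub _ sh.
pose psi t := 'D_u F (t *: v + (s *: u + x)).
have psiP t : t \in `[0, h]%R ->
    is_derive t 1 psi ('D_v ('D_u F) (t *: v + (s *: u + x))).
  move=> th; apply: is_derive_line.
  by rewrite addrA (addrC (t *: v)); exact: (dF s t sh th).2.
have H3 t : t \in `]0, h[%R ->
    is_derive t 1 psi ('D_v ('D_u F) (t *: v + (s *: u + x))).
  by move=> /sub; exact: psiP.
have H4 : {within `[0, h], continuous psi}.
  by apply: derivable_within_continuous => t /psiP[].
have [t th psiE] := MVT h0 H3 H4.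
exists s, t; split => //; first exact: sub.
move: phiE psiE; rewrite /phi /dphi /psi !scale0r !add0r !subr0 !addrA.
move=> ->; rewrite (addrC (h *: v) (s *: u)) => ->.
by rewrite (addrC (t *: v)) expr2; ring.
Qed.

(** The two sample points may differ: both lie in the parallelogram of side h at x, which shrinks to
    x, and continuity makes both values converge. *)
Lemma eq_lim_box (A B : V -> R) (U : set V) u v x : open U -> U x ->
  {for x, continuous A} -> {for x, continuous B} ->
  (forall h : R, 0 < h ->
    (forall s t, s \in `[0, h]%R -> t \in `[0, h]%R -> U (s *: u + t *: v + x)) ->
    exists s t s' t' : R, [/\ s \in `[0, h]%R /\ t \in `[0, h]%R,
      s' \in `[0, h]%R /\ t' \in `[0, h]%R &
      A (s *: u + t *: v + x) = B (s' *: u + t' *: v + x)]) ->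
  A x = B x.
Proof.
move=> oU Ux cA cB H.
apply/eqP; rewrite -subr_eq0 -normr_le0; apply/ler_addgt0Pr => e e0.
rewrite add0r.
have e2 : 0 < e / 2 by rewrite divr_gt0.
have N : \forall y \near x,
    [/\ U y, `|A x - A y| <= e / 2 & `|B x - B y| <= e / 2].
  have Un : \forall y \near x, U y by apply: open_nbhs_nbhs.
  have N1 : \forall y \near x, `|A x - A y| <= e / 2.
    exact: (cvgrPdist_le _ _).1 cA _ e2.
  have N2 : \forall y \near x, `|B x - B y| <= e / 2.
    exact: (cvgrPdist_le _ _).1 cB _ e2.
  exact: (@filterS3 V (nbhs x) (nbhs_filter x) _ _ _ _
    (fun y a b c => And3 a b c) Un N1 N2).
move/nbhs_normP : N => [d /= d0 N].
(* On the parallelogram |s u + t v| is at most h M, so h = d / (2 M) keeps it inside the ball of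
   radius d. *)
pose M := `|u| + `|v| + 1.
have M0 : 0 < M by rewrite /M ltr_wpDl // addr_ge0.
pose h := d / (2 * M); have h0 : 0 < h by rewrite divr_gt0 // mulr_gt0.
have box s t : s \in `[0, h]%R -> t \in `[0, h]%R ->
    [/\ U (s *: u + t *: v + x), `|A x - A (s *: u + t *: v + x)| <= e / 2 &
    `|B x - B (s *: u + t *: v + x)| <= e / 2].
  rewrite !in_itv /= => /andP[s0 sh] /andP[t0 th]; apply: N => /=.
  rewrite distrC addrK (le_lt_trans (ler_normD _ _)) // !normrZ !ger0_norm //.
  have : s * `|u| + t * `|v| <= h * M.
    rewrite /M !mulrDr mulr1 -addrA; apply: lerD; first exact: ler_wpM2r.
    by apply: ler_wpDr; [exact: ltW|exact: ler_wpM2r].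
  move=> /le_lt_trans; apply; rewrite /h invfM mulrA divfK ?gt_eqF //.
  by rewrite ltr_pdivrMr // ltr_pMr // ltr1n.
have [s [t [s' [t' [[sh th] [sh' th'] E]]]]] : exists s t s' t' : R,
    [/\ s \in `[0, h]%R /\ t \in `[0, h]%R, s' \in `[0, h]%R /\ t' \in `[0, h]%R &
      A (s *: u + t *: v + x) = B (s' *: u + t' *: v + x)].
  by apply: H => // s t sh th; have [] := box s t sh th.
have [_ B1 _] := box _ _ sh th; have [_ _ B2] := box _ _ sh' th'.
rewrite (splitr e) -[A x](subrK (A (s *: u + t *: v + x))) -addrA.
apply: le_trans (ler_normD _ _) _; apply: lerD => //.
by rewrite E distrC.
Qed.

(** The second difference is symmetric in u and v, so both mixed derivatives are compared with the
    same number. *)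
Lemma schwarz U F u v x : open U -> U x -> Ck 2 U F ->
  'D_u ('D_v F) x = 'D_v ('D_u F) x.
Proof.
move=> oU Ux [dF DF]; have dDu := (DF u).1; have dDv := (DF v).1.
apply: (@eq_lim_box ('D_u ('D_v F)) ('D_v ('D_u F)) U u v) => //.
- exact: ((DF v).2 u x Ux).
- exact: ((DF u).2 v x Ux).
move=> h h0 Ub.
have [s t sh th|s [t [sh th E1]]] := @second_difference F u v x h h0 _.
  by split; [apply: dF|apply: dDu]; exact: Ub.
have [t' s' th' sh'|t' [s' [th' sh' E2]]] := @second_difference F v u x h h0 _.
  by rewrite (addrC (t' *: v)); split; [apply: dF|apply: dDv]; exact: Ub.
exists s', t', s, t; split => //.
have h2 : h ^+ 2 != 0 by rewrite expf_neq0 // gt_eqF.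
apply: (mulfI h2); rewrite (addrC (s' *: u)).
apply: etrans (etrans (esym E2) _) E1.
by rewrite (addrC (h *: v) (h *: u)); ring.
Qed.

End Schwarz.

Lemma Ck_local (R : realType) (V W : normedModType R) k (U : set V)
    (f : V -> W) :
  (forall x, U x -> exists U', [/\ open U', U' x & Ck k U' f]) -> Ck k U f.
Proof.
elim: k f => [|k IH] f H /=.
  by move=> x Ux; have [U' [_ U'x]] := H x Ux; exact.
split=> [x Ux|v].
  by have [U' [_ U'x [df _]]] := H x Ux; exact: df.
by apply: IH => x Ux; have [U' [oU' U'x [_ Df]]] := H x Ux; exists U';
  split => //; exact: Df.
Qed.

(** * The Euclidean scalar product *)

Section Dot.
Context {R : realType} {m : nat}.
Implicit Types (x y z : 'rV[R]_m) (a : R).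

Lemma dotC x y : dot x y = dot y x.
Proof. by apply: eq_bigr => i _; rewrite mulrC. Qed.

Lemma dotDl x y z : dot (x + y) z = dot x z + dot y z.
Proof. by rewrite /dot -big_split; apply: eq_bigr => i _; rewrite mxE mulrDl. Qed.

Lemma dotZl a x y : dot (a *: x) y = a * dot x y.
Proof. by rewrite /dot mulr_sumr; apply: eq_bigr => i _; rewrite mxE mulrA. Qed.

Lemma dotDr x y z : dot x (y + z) = dot x y + dot x z.
Proof. by rewrite !(dotC x) dotDl. Qed.

Lemma dotZr a x y : dot x (a *: y) = a * dot x y.
Proof. by rewrite !(dotC x) dotZl. Qed.

Lemma dotNl x y : dot (- x) y = - dot x y.
Proof. by rewrite -scaleN1r dotZl mulN1r. Qed.

Lemma dotNr x y : dot x (- y) = - dot x y.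
Proof. by rewrite !(dotC x) dotNl. Qed.

Lemma dotBr x y z : dot x (y - z) = dot x y - dot x z.
Proof. by rewrite dotDr dotNr. Qed.

Lemma dot0l x : dot 0 x = 0.
Proof. by rewrite -(scale0r x) dotZl mul0r. Qed.

Lemma dot0r x : dot x 0 = 0.
Proof. by rewrite dotC dot0l. Qed.

Lemma dot_ge0 x : 0 <= dot x x.
Proof. by apply: sumr_ge0 => i _; rewrite -expr2 sqr_ge0. Qed.

Lemma dot_eq0 x : dot x x = 0 -> x = 0.
Proof.
move=> /eqP; rewrite psumr_eq0; last by move=> i _; rewrite -expr2 sqr_ge0.
move=> /allP H; apply/rowP => i; rewrite mxE.
have := H i (mem_index_enum i); rewrite /= mulf_eq0 orbb; exact: eqP.
Qed.

Lemma dot_gt0 x : x != 0 -> 0 < dot x x.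
Proof.
move=> x0; rewrite lt_neqAle dot_ge0 andbT eq_sym.
by apply: contra x0 => /eqP /dot_eq0 ->.
Qed.

Lemma dot_delta x i : dot (delta_mx 0 i) x = x 0 i.
Proof.
rewrite /dot (bigD1 i) //= big1 ?addr0; last first.
  by move=> j ji; rewrite mxE (negPf ji) andbF mul0r.
by rewrite mxE !eqxx mul1r.
Qed.

End Dot.

(** * The radial retraction onto the sphere *)

Section Normalization.
Context {R : realType} {m : nat}.
Local Notation V := 'rV[R]_m.+1.
Implicit Types (x y v : V).

(** The map inside [dS], named so that a function f on the sphere is handled through its extension
    [fun y => f (nu y)], constant along rays. *)
Definition nu y : V := (Num.sqrt (dot y y))^-1 *: y.
Definition nonzero : set V := [set y | y != 0].

Lemma open_nonzero : open nonzero.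
Proof.
have -> : nonzero = ~` [set 0].
  by apply/seteqP; split=> y /=; [move/eqP|move/eqP].
apply: closed_openC; apply: accessible_closed_set1.
by apply: hausdorff_accessible; exact: norm_hausdorff.
Qed.

Lemma sphere_neq0 x : sphere R m x -> x != 0.
Proof.
by move=> Sx; apply/eqP => x0; move: Sx; rewrite /sphere /= x0 dot0l => /esym/eqP;
  rewrite oner_eq0.
Qed.

Lemma sqrt_dot_gt0 y : y != 0 -> 0 < Num.sqrt (dot y y).
Proof. by move=> y0; rewrite sqrtr_gt0 dot_gt0. Qed.

Lemma nu_sphere y : y != 0 -> sphere R m (nu y).
Proof.
move=> y0; rewrite /sphere /= /nu dotZl dotZr mulrA -expr2 exprVn sqr_sqrtr ?dot_ge0 //.
by rewrite mulVf // gt_eqF // dot_gt0.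
Qed.

Lemma nu_id x : sphere R m x -> nu x = x.
Proof. by move=> Sx; rewrite /nu Sx sqrtr1 invr1 scale1r. Qed.

Lemma nu_neq0 y : y != 0 -> nu y != 0.
Proof. by move=> /nu_sphere/sphere_neq0. Qed.

Lemma Ck_nu k : Ck k nonzero nu.
Proof.
have o := open_nonzero.
apply: CkZ => //; last exact: Ck_id.
apply: Ck_inv => //.
  by move=> y y0; rewrite gt_eqF // sqrt_dot_gt0.
apply: Ck_sqrt => //; first by move=> y y0; exact: dot_gt0.
by apply: Ck_dot => //; exact: Ck_id.
Qed.

Lemma differentiable_nu y : y != 0 -> differentiable nu y.
Proof. by move=> y0; exact: (Ck_nu 1).1. Qed.

(** At a unit vector x the factor 1 / |y| has derivative - <x, v>, so the differential is the
    orthogonal projection on the tangent space. This is why [dS] kills radial directions. *)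
Lemma derive_nu x v : sphere R m x -> 'D_v nu x = v - dot x v *: x.
Proof.
move=> Sx; have x0 := sphere_neq0 Sx.
apply/rowP => j; rewrite derive_rV; last exact: differentiable_nu.
have -> : (fun y : V => nu y 0 j) =
          (fun y : V => (Num.sqrt (dot y y))^-1) * (fun y : V => y 0 j).
  by apply/funext => y; rewrite mxE.
have did (y : V) : differentiable id y by have [] := is_diff_id y.
have dc i (y : V) : derivable (fun y : V => y 0 i) y v.
  by apply: diff_derivable; exact: differentiable_coord.
have Dc i (y : V) : 'D_v (fun y : V => y 0 i) y = v 0 i.
  by rewrite -(@derive_rV _ _ _ id) // derive_id.
have ddot : is_derive x v (fun y : V => dot y y) (2 * dot x v).
  have -> : (fun y : V => dot y y) = \sum_i (fun y : V => y 0 i * y 0 i).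
    by apply/funext => y; rewrite fct_sumE.
  have H (i : 'I_m.+1) : is_derive x v (fun y : V => y 0 i * y 0 i) (2 * (x 0 i * v 0 i)).
    have di : is_derive x v (fun y : V => y 0 i) (v 0 i).
      by rewrite -(Dc i x); exact: derivableP.
    apply: is_derive_eq (is_deriveM di di) _.
    by rewrite /GRing.scale /=; ring.
  by apply: is_derive_eq; rewrite /dot mulr_sumr.
have dsq : differentiable (fun y : V => dot y y) x.
  have [d _] : Ck 1 nonzero (fun y : V => dot y y).
    by apply: Ck_dot; [exact: open_nonzero|exact: Ck_id|exact: Ck_id].
  exact: d.
have ds : is_derive x v (fun y : V => Num.sqrt (dot y y)) (dot x v).
  have s1 : is_derive (dot x x) 1 Num.sqrt (2 * Num.sqrt (dot x x))^-1.
    by apply: is_derive1_sqrt; rewrite Sx.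
  have dfs : differentiable Num.sqrt (dot x x) by apply/derivable1_diffP; case: s1.
  have dco : differentiable (fun y : V => Num.sqrt (dot y y)) x.
    exact: (@differentiable_comp _ _ _ _ (fun y : V => dot y y) Num.sqrt).
  split; first exact: diff_derivable.
  rewrite deriveE // (diff_comp dsq dfs) /= -(deriveE _ dsq) (derive_val (f := fun y : V => dot y y)).
  have -> : 2 * dot x v = (2 * dot x v) *: (1 : R) by rewrite /GRing.scale /= mulr1.
  rewrite linearZ /= -(deriveE _ dfs) (derive_val (f := Num.sqrt)) Sx sqrtr1 mulr1.
  by rewrite /GRing.scale /= mulrAC mulfV ?mul1r // pnatr_eq0.
have sx : Num.sqrt (dot x x) = 1 by rewrite Sx sqrtr1.
have dsV : derivable (fun y : V => (Num.sqrt (dot y y))^-1) x v.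
  by apply: derivableV; [rewrite sx oner_eq0|case: ds].
have EV : 'D_v (fun y : V => (Num.sqrt (dot y y))^-1) x = - dot x v.
  have s0 : Num.sqrt (dot x x) != 0 by rewrite sx oner_eq0.
  have [ds' _] := ds; 
  rewrite (@deriveV _ _ (fun y : V => Num.sqrt (dot y y)) x v s0 ds') sx.
  rewrite (derive_val (f := fun y : V => Num.sqrt (dot y y))).
  by rewrite expr1n invr1 /GRing.scale /= mulN1r.
rewrite (deriveM dsV (dc j x)).
rewrite Dc EV sx invr1 !mxE /GRing.scale /=; ring.
Qed.

End Normalization.

(** * Smooth functions on the sphere and their differentials *)

Section SphereCalculus.
Context {R : realType} {m : nat}.
Local Notation V := 'rV[R]_m.+1.
Local Notation S := (sphere R m).
Local Notation O := (@nonzero R m).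
Implicit Types (x y v u : V).

(** One extension, constant along rays and smooth off 0, replaces the local extensions of
    [smooth_on]; closure properties are then inherited from [Ck] on a single open set. *)
Definition smS (W : normedModType R) (f : V -> W) :=
  forall k, Ck k O (fun y => f (nu y)).

Let oO := @open_nonzero R m.

Lemma nu_cont y : y != 0 -> {for y, continuous (@nu R m)}.
Proof. by move=> y0; exact: (Ck_nu 0). Qed.

(** The chain rule enters as a hypothesis so that one argument serves both scalar and row-vector
    values. *)
Lemma smooth_on_local (W : normedModType R) (f : V -> W) :
  (forall k (U U' : set V) (F : V -> W), open U -> open U' ->
    (forall y, U' y -> O y /\ U (nu y)) -> Ck k U F ->
    Ck k U' (fun y => F (nu y))) ->
  smooth_on S f <-> smS f.
Proof.
move=> comp; split; last first.
  move=> sf x /sphere_neq0 x0; exists O, (fun y => f (nu y)); split => //.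
  by move=> y /nu_id ->.
move=> sf k; apply: Ck_local => y y0.
have [U [F [oU Uy CF fF]]] := sf _ (nu_sphere y0).
pose U' := [set z | O z /\ U (nu z)].
have oU' : open U'.
  rewrite openE => z [z0 Uz].
  have Oz : \forall t \near z, O t by apply: open_nbhs_nbhs.
  have UO : \forall t \near z, U (nu t).
    by apply: (nu_cont z0); apply: open_nbhs_nbhs.
  exact: (@filterI V (nbhs z) (nbhs_filter z) _ _ Oz UO).
exists U'; split => //.
have H := comp k U U' F oU oU' (fun y h => h) (CF k).
by apply: eq_Ck H => // z [z0 Uz]; rewrite fF //; exact: nu_sphere.
Qed.

Lemma smooth_onP (f : V -> R) : smooth_on S f <-> smS f.
Proof.
apply: smooth_on_local => k U U' F oU oU' UU CF.
apply: (Ck_comp oU' oU _ CF) => [y /UU[]//|].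
by apply: Ck_sub (Ck_nu k) => y /UU[].
Qed.

Lemma smooth_onP_rV p (f : V -> 'rV[R]_p) : smooth_on S f <-> smS f.
Proof.
apply: smooth_on_local => k U U' F oU oU' UU CF.
apply: (Ck_comp_rV oU' oU _ CF) => [y /UU[]//|].
by apply: Ck_sub (Ck_nu k) => y /UU[].
Qed.

Lemma smS_diff (W : normedModType R) (f : V -> W) y : smS f -> y != 0 ->
  differentiable (fun y => f (nu y)) y.
Proof. by move=> sf y0; exact: (sf 1%N).1. Qed.

Lemma smS_diffS (W : normedModType R) (f : V -> W) x : smS f -> S x ->
  differentiable (fun y => f (nu y)) x.
Proof. by move=> sf /sphere_neq0; exact: smS_diff. Qed.

Lemma eq_smS (W : normedModType R) (f g : V -> W) :
  (forall y, S y -> f y = g y) -> smS f -> smS g.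
Proof.
by move=> fg sf k; apply: eq_Ck (sf k) => // y /nu_sphere; exact: fg.
Qed.

Lemma smS_cst (W : normedModType R) (a : W) : smS (fun _ => a).
Proof. by move=> k; exact: Ck_cst. Qed.

Lemma smS_id : smS (fun y : V => y).
Proof. by move=> k; exact: Ck_nu. Qed.

Lemma smSD (W : normedModType R) (f g : V -> W) : smS f -> smS g ->
  smS (fun y => f y + g y).
Proof. by move=> sf sg k; exact: CkD. Qed.

Lemma smSM (f g : V -> R) : smS f -> smS g -> smS (fun y => f y * g y).
Proof. by move=> sf sg k; exact: CkM. Qed.

Lemma smSZ p (f : V -> R) (X : V -> 'rV[R]_p) : smS f -> smS X ->
  smS (fun y => f y *: X y).
Proof. by move=> sf sg k; exact: CkZ. Qed.

Lemma smSN (f : V -> R) : smS f -> smS (fun y => - f y).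
Proof.
move=> sf; apply: eq_smS (smSM (smS_cst (-1 : R)) sf) => y _.
by rewrite mulN1r.
Qed.

Lemma smSNv p (X : V -> 'rV[R]_p) : smS X -> smS (fun y => - X y).
Proof.
move=> sX; apply: eq_smS (smSZ (smS_cst (-1 : R)) sX) => y _.
by rewrite scaleN1r.
Qed.

Lemma smSV (f : V -> R) : (forall y, S y -> f y != 0) -> smS f ->
  smS (fun y => (f y)^-1).
Proof. by move=> f0 sf k; apply: Ck_inv => // y /nu_sphere/f0. Qed.

Lemma smS_lin p q (X : V -> 'rV[R]_p) (M : 'M[R]_(p, q)) : smS X ->
  smS (fun y => X y *m M).
Proof. by move=> sX k; exact: Ck_lin. Qed.

Lemma smS_dot p (X Y : V -> 'rV[R]_p) : smS X -> smS Y ->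
  smS (fun y => dot (X y) (Y y)).
Proof. by move=> sX sY k; exact: Ck_dot. Qed.

Lemma smS_sum (W : normedModType R) (I : eqType) (r : seq I) (F : I -> V -> W) :
  (forall i, smS (F i)) -> smS (fun y => \sum_(i <- r) F i y).
Proof. by move=> sF k; apply: Ck_sum => // i; exact: sF. Qed.

Lemma smS_coord p (X : V -> 'rV[R]_p) j : smS X -> smS (fun y => X y 0 j).
Proof. by move=> sX k; exact: (Ck_coord j oO (sX k)). Qed.

Lemma smS_rV p (X : V -> 'rV[R]_p) : (forall j, smS (fun y => X y 0 j)) -> smS X.
Proof. by move=> sX k; apply: Ck_rV => // j; exact: sX. Qed.

Lemma smS_comp (f : V -> R) (phi : V -> V) : (forall y, S y -> S (phi y)) ->
  smS phi -> smS f -> smS (fun y => f (phi y)).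
Proof.
move=> Sphi sphi sf k.
have H : Ck k O (fun y => f (nu (phi (nu y)))).
  apply: (@Ck_comp _ k m.+1 _ O O (fun z => f (nu z)) (fun y => phi (nu y))) => //.
  by move=> y /nu_sphere/Sphi/sphere_neq0.
by apply: eq_Ck H => // y /nu_sphere/Sphi/nu_id ->.
Qed.

Lemma smS_comp_rV p (f : V -> 'rV[R]_p) (phi : V -> V) :
  (forall y, S y -> S (phi y)) ->
  smS phi -> smS f -> smS (fun y => f (phi y)).
Proof.
move=> Sphi sphi sf; apply: smS_rV => j.
by apply: (@smS_comp (fun y => f y 0 j)) => //; exact: smS_coord.
Qed.

(** The derivative is taken in the ambient space and is C^k off 0; restricting it to the sphere and
    extending it along rays composes it with [nu]. *)
Lemma smS_partial (f : V -> R) v : smS f ->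
  smS (fun y => 'D_v (fun z => f (nu z)) y).
Proof.
move=> sf k.
apply: (@Ck_comp _ k m.+1 _ O O ('D_v (fun z => f (nu z))) (@nu R m)) => //.
- by move=> y /nu_neq0.
- exact: (sf k.+1).2.
- exact: Ck_nu.
Qed.

Lemma dS_sum (f : V -> R) x v : smS f -> S x ->
  dS f x v = \sum_i v 0 i * 'D_(delta_mx 0 i) (fun y => f (nu y)) x.
Proof. by move=> sf Sx; apply: diff_rV_sum; exact: smS_diffS. Qed.

Lemma smS_dS (f : V -> R) (X : V -> V) : smS f -> smS X ->
  smS (fun y => dS f y (X y)).
Proof.
move=> sf sX.
have H : smS (fun y => \sum_i X y 0 i * 'D_(delta_mx 0 i) (fun z => f (nu z)) y).
  apply: smS_sum => i; apply: smSM; first exact: smS_coord.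
  exact: smS_partial.
by apply: eq_smS H => y Sy; rewrite dS_sum.
Qed.

Lemma dS_coord p (F : V -> 'rV[R]_p) x v j : smS F -> S x ->
  (dS F x v) 0 j = dS (fun y => F y 0 j) x v.
Proof. by move=> sF Sx; apply: derive_rV; exact: smS_diffS. Qed.

Lemma smS_dS_rV p (F : V -> 'rV[R]_p) (X : V -> V) : smS F -> smS X ->
  smS (fun y => dS F y (X y)).
Proof.
move=> sF sX; apply: smS_rV => j.
apply: eq_smS (smS_dS (smS_coord j sF) sX) => y Sy.
by rewrite dS_coord.
Qed.

Lemma eq_dS (W : normedModType R) (f g : V -> W) x v : S x ->
  (forall y, S y -> f y = g y) -> dS f x v = dS g x v.
Proof.
move=> Sx fg; apply: (eq_open_derive _ oO (sphere_neq0 Sx)) => y /nu_sphere.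
exact: fg.
Qed.

Lemma dS_linear (W : normedModType R) (f : V -> W) x a u v : smS f -> S x ->
  dS f x (a *: u + v) = a *: dS f x u + dS f x v.
Proof.
move=> sf Sx; have d := smS_diffS sf Sx.
by rewrite /dS !(deriveE _ d) linearP.
Qed.

Lemma dS_cst (W : normedModType R) (a : W) x v : dS (fun _ => a) x v = 0.
Proof. exact: derive_cst. Qed.

Lemma dS_id x v : S x -> dS (fun y => y) x v = v - dot x v *: x.
Proof. exact: derive_nu. Qed.

Lemma dS_id_tangent x v : S x -> tangent x v -> dS (fun y => y) x v = v.
Proof. by move=> Sx tv; rewrite dS_id // tv scale0r subr0. Qed.

Lemma dSD (W : normedModType R) (f g : V -> W) x v : smS f -> smS g -> S x ->
  dS (fun y => f y + g y) x v = dS f x v + dS g x v.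
Proof.
move=> sf sg Sx; apply: deriveD; apply: diff_derivable; exact: smS_diffS.
Qed.

Lemma dSM (f g : V -> R) x v : smS f -> smS g -> S x ->
  dS (fun y => f y * g y) x v = dS f x v * g x + f x * dS g x v.
Proof.
move=> sf sg Sx.
have df := diff_derivable (v:=v) (smS_diffS sf Sx).
have dg := diff_derivable (v:=v) (smS_diffS sg Sx).
by rewrite /dS (deriveM df dg) nu_id // /GRing.scale /= addrC mulrC.
Qed.

Lemma dSZ p (f : V -> R) (X : V -> 'rV[R]_p) x v : smS f -> smS X -> S x ->
  dS (fun y => f y *: X y) x v = dS f x v *: X x + f x *: dS X x v.
Proof.
move=> sf sX Sx; apply/rowP => j.
rewrite dS_coord //; last exact: smSZ.
rewrite (@eq_dS _ _ (fun y => f y * X y 0 j)) //; last by move=> y _; rewrite mxE.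
by rewrite dSM ?mxE ?dS_coord //; exact: smS_coord.
Qed.

Lemma dSN (f : V -> R) x v : smS f -> S x ->
  dS (fun y => - f y) x v = - dS f x v.
Proof.
move=> sf Sx; rewrite (@eq_dS _ _ (fun y => -1 * f y)) //; last first.
  by move=> y _; rewrite mulN1r.
by rewrite dSM // ?dS_cst ?mul0r ?add0r ?mulN1r //; exact: smS_cst.
Qed.

Lemma dSNv p (X : V -> 'rV[R]_p) x v : smS X -> S x ->
  dS (fun y => - X y) x v = - dS X x v.
Proof.
move=> sf Sx; rewrite (@eq_dS _ _ (fun y => -1 *: X y)) //; last first.
  by move=> y _; rewrite scaleN1r.
by rewrite dSZ // ?dS_cst ?scale0r ?add0r ?scaleN1r //; exact: smS_cst.
Qed.

Lemma dSV (f : V -> R) x v : (forall y, S y -> f y != 0) -> smS f -> S x ->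
  dS (fun y => (f y)^-1) x v = - (dS f x v / f x ^+ 2).
Proof.
move=> f0 sf Sx; have fx0 := f0 x Sx.
have : dS (fun y => f y * (f y)^-1) x v = 0.
  rewrite (@eq_dS _ _ (fun _ => 1 : R)) ?dS_cst // => y Sy.
  by rewrite mulfV ?f0.
rewrite dSM //; last exact: smSV.
move=> /eqP; rewrite addr_eq0 => /eqP E.
apply: (mulfI fx0); rewrite -[LHS]opprK -E; field; exact: fx0.
Qed.

Lemma dS_sumr (I : eqType) (r : seq I) (W : normedModType R) (F : I -> V -> W) x v :
  (forall i, smS (F i)) -> S x ->
  dS (fun y => \sum_(i <- r) F i y) x v = \sum_(i <- r) dS (F i) x v.
Proof.
move=> sF Sx; elim: r => [|i r IH].
  rewrite big_nil (@eq_dS _ _ (fun _ => 0 : W)) ?dS_cst // => y _.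
  by rewrite big_nil.
rewrite big_cons -IH -dSD //; last exact: smS_sum.
by apply: eq_dS => // y _; rewrite big_cons.
Qed.

Lemma dS_lin p q (X : V -> 'rV[R]_p) (M : 'M[R]_(p, q)) x v : smS X -> S x ->
  dS (fun y => X y *m M) x v = dS X x v *m M.
Proof.
move=> sX Sx; apply/rowP => j; rewrite dS_coord ?mxE //; last exact: smS_lin.
rewrite (@eq_dS _ _ (fun y => \sum_i X y 0 i * M i j)) //; last first.
  by move=> y _; rewrite mxE.
rewrite dS_sumr //; last first.
  by move=> i; apply: smSM; [exact: smS_coord|exact: smS_cst].
apply: eq_bigr => i _; rewrite dSM //; last 2 first.
- exact: smS_coord.
- exact: smS_cst.
by rewrite dS_cst mulr0 addr0 dS_coord.
Qed.

Lemma dS_dot p (X Y : V -> 'rV[R]_p) x v : smS X -> smS Y -> S x ->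
  dS (fun y => dot (X y) (Y y)) x v = dot (dS X x v) (Y x) + dot (X x) (dS Y x v).
Proof.
move=> sX sY Sx; rewrite [LHS]dS_sumr //; last first.
  by move=> i; apply: smSM; exact: smS_coord.
rewrite /dot -big_split; apply: eq_bigr => i _ /=.
by rewrite dSM ?dS_coord //; exact: smS_coord.
Qed.

Lemma derive_nu_comp (f : V -> R) x v : S x -> tangent x v ->
  differentiable f x -> 'D_v (fun y => f (nu y)) x = 'D_v f x.
Proof.
move=> Sx tv df; have x0 := sphere_neq0 Sx.
rewrite (@derive_comp R V R m.+1 f (@nu R m)) ?nu_id //; last first.
  exact: differentiable_nu.
by rewrite derive_nu // tv scale0r subr0.
Qed.

Lemma dS_comp (f : V -> R) (phi : V -> V) x v :
  (forall y, S y -> S (phi y)) -> smS phi -> smS f -> S x ->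
  dS (fun y => f (phi y)) x v = dS f (phi x) (dS phi x v).
Proof.
move=> Sphi sphi sf Sx; have x0 := sphere_neq0 Sx.
rewrite (@eq_dS _ _ (fun y => f (nu (phi y)))) //; last first.
  by move=> y /Sphi/nu_id ->.
rewrite /dS (@derive_comp R V R m.+1 (fun z => f (nu z)) (fun y => phi (nu y))) //.
- by rewrite nu_id.
- exact: smS_diff.
- by rewrite nu_id //; apply: smS_diffS => //; exact: Sphi.
Qed.

Lemma dS_comp_rV p (f : V -> 'rV[R]_p) (phi : V -> V) x v :
  (forall y, S y -> S (phi y)) -> smS phi -> smS f -> S x ->
  dS (fun y => f (phi y)) x v = dS f (phi x) (dS phi x v).
Proof.
move=> Sphi sphi sf Sx; apply/rowP => j; rewrite !dS_coord //.
- by rewrite (@dS_comp (fun y => f y 0 j)) //; exact: smS_coord.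
- exact: Sphi.
- exact: smS_comp_rV.
Qed.

Lemma dS_radial_rV p (f : V -> 'rV[R]_p) x v : smS f -> S x ->
  dS f x v = dS f x (v - dot x v *: x).
Proof.
by move=> sf Sx; have := @dS_comp_rV _ f id x v (fun _ h => h) smS_id sf Sx; rewrite dS_id.
Qed.

(** The second ambient derivative of the ray-constant extension of f. What matters is its symmetry,
    by which it drops out of commutators of derivations. *)
Definition hess (f : V -> R) x u v :=
  \sum_i v 0 i * 'D_u ('D_(delta_mx 0 i) (fun y => f (nu y))) x.

Lemma dS_dS (f : V -> R) (Y : V -> V) x u : smS f -> smS Y -> S x ->
  tangent x u -> dS (fun y => dS f y (Y y)) x u
    = dS f x (dS Y x u) + hess f x u (Y x).
Proof.
move=> sf sY Sx tu.
rewrite (@eq_dS _ _ (fun y =>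
   \sum_i Y y 0 i * 'D_(delta_mx 0 i) (fun z => f (nu z)) y)) //; last first.
  by move=> y Sy; rewrite dS_sum.
rewrite dS_sumr //; last first.
  by move=> i; apply: smSM; [exact: smS_coord|exact: smS_partial].
rewrite dS_sum // /hess -big_split; apply: eq_bigr => i _ /=.
have E := @dSM _ _ x u (smS_coord i sY) (smS_partial (delta_mx 0 i) sf) Sx.
rewrite E -(dS_coord u i sY Sx); congr (_ + _ * _).
apply: (@derive_nu_comp ('D_(delta_mx 0 i) (fun z => f (nu z)))) => //.
by apply: ((sf 2%N).2 (delta_mx 0 i)).1; exact: sphere_neq0.
Qed.

Lemma hess_sym (f : V -> R) x u v : smS f -> S x -> hess f x u v = hess f x v u.
Proof.
move=> sf Sx; have x0 := sphere_neq0 Sx.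
have E u' v' : hess f x u' v' = \sum_i \sum_j v' 0 i * (u' 0 j *
    'D_(delta_mx 0 j) ('D_(delta_mx 0 i) (fun y => f (nu y))) x).
  apply: eq_bigr => i _; rewrite -mulr_sumr; congr (_ * _).
  rewrite diff_rV_sum //.
  by apply: ((sf 2%N).2 (delta_mx 0 i)).1.
rewrite !E exchange_big; apply: eq_bigr => i _; apply: eq_bigr => j _.
by rewrite mulrCA (@schwarz _ _ O) //; exact: sf.
Qed.

(** By [dS_dS] an iterated derivative is a first-order term plus [hess]; the Hessians cancel and the
    first-order terms make up the bracket. *)
Lemma lie_bracket_dS (f : V -> R) (X Y : V -> V) x : smS f -> smS X -> smS Y ->
  S x -> tangent x (X x) -> tangent x (Y x) ->
  dS f x (lie_bracket X Y x) =
    dS (fun y => dS f y (Y y)) x (X x) - dS (fun y => dS f y (X y)) x (Y x).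
Proof.
move=> sf sX sY Sx tX tY; rewrite !dS_dS // (hess_sym _ (Y x) sf Sx).
have -> : lie_bracket X Y x = (-1) *: dS X x (Y x) + dS Y x (X x).
  by rewrite /lie_bracket scaleN1r addrC.
rewrite dS_linear // scaleN1r.
move: (dS f x (dS X x (Y x))) (dS f x (dS Y x (X x))) (hess f x (Y x) (X x)).
by move=> a b c; rewrite opprD addrACA subrr addr0 addrC.
Qed.

End SphereCalculus.

(** * Connections, curvature and isometries *)

Section VectorFields.
Context {R : realType} {m : nat}.
Local Notation V := 'rV[R]_m.+1.
Local Notation S := (sphere R m).
Implicit Types (x y u v w : V) (X Y Z : V -> V).

Lemma vector_fieldP X : vector_field X <->
  smS X /\ forall x, S x -> tangent x (X x).
Proof. by split=> -[/smooth_onP_rV sX tX]; split. Qed.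

Lemma tangentD x u v : tangent x u -> tangent x v -> tangent x (u + v).
Proof. by rewrite /tangent /= dotDr => -> ->; rewrite addr0. Qed.

Lemma tangentZ x a u : tangent x u -> tangent x (a *: u).
Proof. by rewrite /tangent /= dotZr => ->; rewrite mulr0. Qed.

Lemma tangentN x u : tangent x u -> tangent x (- u).
Proof. by rewrite /tangent /= dotNr => ->; rewrite oppr0. Qed.

Lemma tangentB x u v : tangent x u -> tangent x v -> tangent x (u - v).
Proof. by move=> tu tv; apply: tangentD => //; exact: tangentN. Qed.

Lemma tangent_proj x v : S x -> tangent x (v - dot x v *: x).
Proof. by move=> Sx; rewrite /tangent /= dotBr dotZr Sx mulr1 subrr. Qed.

Lemma tangent_projE x v : tangent x v -> v - dot x v *: x = v.
Proof. by move=> ->; rewrite scale0r subr0. Qed.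

(** Extends a tangent vector at a point to a global field, so that statements about fields can be
    tested vector by vector. *)
Definition tangent_field v y : V := v - dot y v *: y.

Lemma tangent_field_vf v : vector_field (tangent_field v).
Proof.
apply/vector_fieldP; split=> [|x Sx]; last exact: tangent_proj.
apply: smSD; first exact: smS_cst.
by apply: smSNv; apply: smSZ; [apply: smS_dot => //; [exact: smS_id|exact: smS_cst]|exact: smS_id].
Qed.

Lemma tangent_fieldE x v : tangent x v -> tangent_field v x = v.
Proof. exact: tangent_projE. Qed.

(** Differentiating <y, Z y> = 0 along v gives <x, dZ(v)> = - <v, Z x>; hence the two terms of the
    bracket have equal normal components. *)
Lemma lie_bracket_vf X Y : vector_field X -> vector_field Y ->
  vector_field (lie_bracket X Y).
Proof.
move=> /vector_fieldP[sX tX] /vector_fieldP[sY tY]; apply/vector_fieldP; split.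
  by apply: smSD; [exact: smS_dS_rV|apply: smSNv; exact: smS_dS_rV].
move=> x Sx.
have E Z v : smS Z -> (forall y, S y -> tangent y (Z y)) -> tangent x v ->
    dot x (dS Z x v) = - dot v (Z x).
  move=> sZ tZ tv; apply/eqP; rewrite -addr_eq0 addrC; apply/eqP.
  rewrite -{1}(dS_id_tangent Sx tv) -(dS_dot _ (smS_id) sZ Sx).
  by rewrite (@eq_dS _ _ _ _ (fun _ => 0 : R)) ?dS_cst.
rewrite /tangent /= /lie_bracket dotBr.
by rewrite (E Y _ sY tY (tX x Sx)) (E X _ sX tX (tY x Sx)) dotC subrr.
Qed.

Lemma eq_lie_bracket X X' Y Y' x : S x -> (forall y, S y -> X y = X' y) ->
  (forall y, S y -> Y y = Y' y) -> lie_bracket X Y x = lie_bracket X' Y' x.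
Proof.
move=> Sx XX YY; rewrite /lie_bracket (eq_dS _ Sx XX) (eq_dS _ Sx YY).
by rewrite (XX x Sx) (YY x Sx).
Qed.

End VectorFields.

(** * Locality and naturality of the Levi-Civita connection *)

Section LeviCivita.
Context {R : realType} {m : nat}.
Local Notation V := 'rV[R]_m.+1.
Local Notation S := (sphere R m).
Implicit Types (x y u v w : V) (X Y Z : V -> V).
Variable g : V -> V -> V -> R.
Hypothesis gm : riemannian_metric g.

Let tvf X x : vector_field X -> S x -> tangent x (X x).
Proof. by move=> /vector_fieldP[_]; exact. Qed.

Lemma metricDl x u v w : S x -> tangent x u -> tangent x v -> tangent x w ->
  g x (u + v) w = g x u w + g x v w.
Proof.
by move=> Sx tu tv tw; have := metric_linear gm 1 Sx tu tv tw; rewrite scale1r mul1r.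
Qed.

Lemma metric0l x w : S x -> tangent x w -> g x 0 w = 0.
Proof.
move=> Sx tw; have t0 : tangent x 0 by rewrite /tangent /= dot0r.
by have /eqP := metricDl Sx t0 t0 tw; rewrite addr0 addrC -subr_eq subrr => /eqP.
Qed.

Lemma metricBl x u v w : S x -> tangent x u -> tangent x v -> tangent x w ->
  g x (u - v) w = g x u w - g x v w.
Proof.
move=> Sx tu tv tw; rewrite addrC -scaleN1r (metric_linear gm) //.
by rewrite mulN1r addrC.
Qed.

Lemma metric_inj x u v : S x -> tangent x u -> tangent x v ->
  (forall w, tangent x w -> g x u w = g x v w) -> u = v.
Proof.
move=> Sx tu tv H; apply/eqP; rewrite -subr_eq0; apply/negP => /negP uv0.
have tuv := tangentB tu tv.
have := metric_pos gm Sx tuv uv0.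
by rewrite metricBl // H // subrr ltxx.
Qed.

Section Connection.
Variable D : (V -> V) -> (V -> V) -> V -> V.
Hypothesis lc : levi_civita g D.

(** Expresses D through g and brackets alone; both its locality on the sphere and its invariance
    under isometries rest on this. *)
Lemma koszul X Y Z x : vector_field X -> vector_field Y -> vector_field Z ->
  S x -> 2 * g x (D X Y x) (Z x) =
    dS (fun y => g y (Y y) (Z y)) x (X x) + dS (fun y => g y (X y) (Z y)) x (Y x)
    - dS (fun y => g y (X y) (Y y)) x (Z x)
    + g x (lie_bracket X Y x) (Z x) - g x (lie_bracket X Z x) (Y x)
    - g x (lie_bracket Y Z x) (X x).
Proof.
move=> vX vY vZ Sx; rewrite !(lc_metric lc) //.
have tD A B : vector_field A -> vector_field B -> tangent x (D A B x).
  by move=> vA vB; apply: tvf => //; exact: (lc_field lc vA vB).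
have tv A : vector_field A -> tangent x (A x) by move=> vA; exact: tvf.
rewrite -!(lc_torsion_free lc) // !metricBl //; try by [exact: tD|exact: tv].
have sy a b : tangent x a -> tangent x b -> g x a b = g x b a.
  by move=> ta tb; exact: (Defs.metric_sym gm Sx).
rewrite (sy (Y x) _ (tv _ vY) (tD _ _ vX vZ)).
rewrite (sy (X x) _ (tv _ vX) (tD _ _ vY vZ)).
rewrite (sy (X x) _ (tv _ vX) (tD _ _ vZ vY)).
move: (g x (D X Y x) (Z x)) (g x (D X Z x) (Y x)) (g x (D Y X x) (Z x))
  (g x (D Y Z x) (X x)) (g x (D Z X x) (Y x)) (g x (D Z Y x) (X x)).
by move=> a b c d e f; ring.
Qed.

(** The axioms of [levi_civita] do not say that [D] ignores the values of fields off the sphere. The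
    Koszul formula does, because its right-hand side only sees the sphere. *)
Lemma eq_connection X X' Y Y' x : vector_field X -> vector_field X' ->
  vector_field Y -> vector_field Y' ->
  (forall y, S y -> X y = X' y) -> (forall y, S y -> Y y = Y' y) -> S x ->
  D X Y x = D X' Y' x.
Proof.
move=> vX vX' vY vY' XX YY Sx.
have tD A B : vector_field A -> vector_field B -> tangent x (D A B x).
  by move=> vA vB; apply: tvf => //; exact: (lc_field lc vA vB).
apply: (metric_inj Sx) => [||w tw]; [exact: tD|exact: tD|].
have vZ := tangent_field_vf w.
rewrite -(tangent_fieldE tw); apply: (@mulfI _ 2); first by rewrite pnatr_eq0.
rewrite (koszul vX vY vZ Sx) (koszul vX' vY' vZ Sx).
have E f1 f2 g1 g2 : (forall y, S y -> f1 y = f2 y) ->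
    (forall y, S y -> g1 y = g2 y) -> forall w,
    dS (fun y => g y (f1 y) (g1 y)) x w = dS (fun y => g y (f2 y) (g2 y)) x w.
  by move=> ff gg w'; apply: eq_dS => // y Sy; rewrite ff // gg.
have r y : S y -> tangent_field w y = tangent_field w y by [].
rewrite (E _ _ _ _ YY r) (E _ _ _ _ XX r) (E _ _ _ _ XX YY).
rewrite (eq_lie_bracket Sx XX YY) (eq_lie_bracket Sx XX r) (eq_lie_bracket Sx YY r).
by rewrite (XX x Sx) (YY x Sx).
Qed.

Definition curvature X Y Z x :=
  D X (D Y Z) x - D Y (D X Z) x - D (lie_bracket X Y) Z x.

Section Isometry.
Variables (phi psi : V -> V).
Hypothesis sphi : smS phi.
Hypothesis spsi : smS psi.
Hypothesis Sphi : forall y, S y -> S (phi y).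
Hypothesis Spsi : forall y, S y -> S (psi y).
Hypothesis phiK : forall y, S y -> psi (phi y) = y.
Hypothesis psiK : forall y, S y -> phi (psi y) = y.
Hypothesis iso : forall x u v, S x -> tangent x u -> tangent x v ->
  g (phi x) (dS phi x u) (dS phi x v) = g x u v.

Definition push X y : V := dS phi (psi y) (X (psi y)).

Lemma push_phi X x : S x -> push X (phi x) = dS phi x (X x).
Proof. by move=> Sx; rewrite /push phiK. Qed.

Lemma dS_map_tangent (f : V -> V) x v : smS f -> (forall y, S y -> S (f y)) ->
  S x -> tangent (f x) (dS f x v).
Proof.
move=> sf Sf Sx; have : dS (fun y => dot (f y) (f y)) x v = 0.
  by rewrite (@eq_dS _ _ _ _ (fun _ => 1 : R)) ?dS_cst // => y /Sf.
rewrite dS_dot // dotC => /eqP; rewrite -mulr2n mulrn_eq0 /= => /eqP.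
by [].
Qed.

Lemma push_vf X : vector_field X -> vector_field (push X).
Proof.
move=> /vector_fieldP[sX tX]; apply/vector_fieldP; split.
  apply: (@smS_comp_rV _ _ _ (fun y => dS phi y (X y)) psi) => //.
  exact: smS_dS_rV.
move=> y Sy; rewrite -{1}(psiK Sy); apply: dS_map_tangent => //; exact: Spsi.
Qed.

Lemma dS_psi_phi x v : S x -> dS psi (phi x) (dS phi x v) = v - dot x v *: x.
Proof.
move=> Sx; rewrite -dS_comp_rV // (@eq_dS _ _ _ _ (fun y => y)) ?dS_id //.
Qed.

Lemma dS_phi_psi y w : S y -> dS phi (psi y) (dS psi y w) = w - dot y w *: y.
Proof.
move=> Sy; rewrite -dS_comp_rV // (@eq_dS _ _ _ _ (fun y => y)) ?dS_id //.
Qed.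

(** Both sides act alike on test functions, by the commutator formula and the chain rule; the
    coordinate functions already separate tangent vectors. *)
Lemma push_lie_bracket X Y x : vector_field X -> vector_field Y -> S x ->
  lie_bracket (push X) (push Y) (phi x) = dS phi x (lie_bracket X Y x).
Proof.
move=> vX vY Sx; have [sX tX] := (vector_fieldP X).1 vX.
have [sY tY] := (vector_fieldP Y).1 vY.
have [sX' tX'] := (vector_fieldP _).1 (push_vf vX).
have [sY' tY'] := (vector_fieldP _).1 (push_vf vY).
have Sfx := Sphi Sx.
have key (f : V -> R) : smS f ->
    dS f (phi x) (lie_bracket (push X) (push Y) (phi x)) =
    dS f (phi x) (dS phi x (lie_bracket X Y x)).
  move=> sf.
  have -> := lie_bracket_dS sf sX' sY' Sfx (tX' _ Sfx) (tY' _ Sfx).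
  have <- := dS_comp (lie_bracket X Y x) Sphi sphi sf Sx.
  have -> := lie_bracket_dS (smS_comp Sphi sphi sf) sX sY Sx (tX x Sx) (tY x Sx).
  have E A : vector_field A -> forall y, S y ->
      dS (fun y => f (phi y)) y (A y) = dS f (phi y) (push A (phi y)).
    by move=> vA y Sy; rewrite (dS_comp _ Sphi sphi sf Sy) (push_phi _ Sy).
  rewrite (eq_dS _ Sx (E Y vY)) (eq_dS _ Sx (E X vX)).
  have C A B : smS (push B) -> dS (fun y => dS f (phi y) (push B (phi y))) x (A x) =
      dS (fun y => dS f y (push B y)) (phi x) (push A (phi x)).
    move=> sB; rewrite (push_phi _ Sx).
    exact: (dS_comp _ Sphi sphi (smS_dS sf sB) Sx).
  exact: (esym (congr2 (fun a b => a - b) (C X Y sY') (C Y X sX'))).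
have tl := (vector_fieldP _).1 (lie_bracket_vf (push_vf vX) (push_vf vY)).
have E w j : tangent (phi x) w -> dS (fun y => y 0 j) (phi x) w = w 0 j.
  by move=> tw; rewrite -(dS_coord w j smS_id Sfx) (dS_id_tangent Sfx tw).
apply/rowP => j; rewrite -(E _ j (tl.2 _ Sfx)).
by rewrite -(E _ j (dS_map_tangent _ sphi Sphi Sx)); exact: key (smS_coord j smS_id).
Qed.

Lemma push_metric X Y y : S y -> vector_field X -> vector_field Y ->
  g (phi y) (push X (phi y)) (push Y (phi y)) = g y (X y) (Y y).
Proof. by move=> Sy vX vY; rewrite !push_phi // iso //; exact: tvf. Qed.

Lemma push_metric_dS X Y Z x : S x -> vector_field X -> vector_field Y ->
  vector_field Z ->
  dS (fun y => g y (Y y) (Z y)) x (X x) =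
  dS (fun y => g y (push Y y) (push Z y)) (phi x) (push X (phi x)).
Proof.
move=> Sx vX vY vZ; rewrite push_phi //.
have sg : smS (fun y => g y (push Y y) (push Z y)).
  by apply/smooth_onP => y; exact: (metric_smooth gm (push_vf vY) (push_vf vZ)).
have <- := dS_comp (X x) Sphi sphi sg Sx.
by apply: eq_dS => // y Sy; rewrite push_metric.
Qed.

(** Every term of the Koszul formula is natural, and [dS phi x] is onto the tangent space, so that
    testing against vectors [dS phi x v] is enough. *)
Lemma push_connection X Y x : vector_field X -> vector_field Y -> S x ->
  D (push X) (push Y) (phi x) = dS phi x (D X Y x).
Proof.
move=> vX vY Sx; have Sfx := Sphi Sx.
have vX' := push_vf vX; have vY' := push_vf vY.
have vD := lc_field lc vX vY.
apply: (metric_inj Sfx) => [||w tw].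
- by apply: tvf => //; exact: (lc_field lc vX' vY').
- exact: dS_map_tangent.
have [v tv <-] : exists2 v, tangent x v & dS phi x v = w.
  exists (dS psi (phi x) w).
    by rewrite -{1}(phiK Sx); exact: dS_map_tangent.
  by rewrite -{1}(phiK Sx) dS_phi_psi // tangent_projE.
have vZ := tangent_field_vf v; have vZ' := push_vf vZ.
rewrite (iso Sx (tvf vD Sx) tv).
have <- : push (tangent_field v) (phi x) = dS phi x v.
  by rewrite (push_phi _ Sx) (tangent_fieldE tv).
rewrite -[in RHS](tangent_fieldE tv).
apply: (@mulfI _ 2); first by rewrite pnatr_eq0.
rewrite (koszul vX' vY' vZ' Sfx) (koszul vX vY vZ Sx).
rewrite (push_metric_dS Sx vX vY vZ) (push_metric_dS Sx vY vX vZ).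
rewrite (push_metric_dS Sx vZ vX vY).
have E A B C : vector_field A -> vector_field B -> vector_field C ->
    g (phi x) (lie_bracket (push A) (push B) (phi x)) (push C (phi x)) =
    g x (lie_bracket A B x) (C x).
  move=> vA vB vC; rewrite (push_lie_bracket vA vB Sx) (push_phi _ Sx).
  exact: (iso Sx (tvf (lie_bracket_vf vA vB) Sx) (tvf vC Sx)).
exact: (congr2 (fun a b => a - b) (congr2 (fun a b => a - b) (congr1 (+%R _)
  (E X Y _ vX vY vZ)) (E X _ Y vX vZ vY)) (E Y _ X vY vZ vX)).
Qed.

(** Inside iterated derivatives, [D (push X) (push Y)] equals [push (D X Y)] on the sphere only, so
    each replacement goes through [eq_connection]. *)
Lemma push_curvature X Y Z x : vector_field X -> vector_field Y ->
  vector_field Z -> S x ->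
  curvature (push X) (push Y) (push Z) (phi x) = dS phi x (curvature X Y Z x).
Proof.
move=> vX vY vZ Sx; have Sfx := Sphi Sx.
have vD A B : vector_field A -> vector_field B -> vector_field (D A B).
  by move=> vA vB; exact: (lc_field lc vA vB).
have vp := push_vf.
have pD A B : vector_field A -> vector_field B -> forall y, S y ->
    D (push A) (push B) y = push (D A B) y.
  move=> vA vB y Sy; rewrite -{1}(psiK Sy) push_connection //; exact: Spsi.
have pl A B : vector_field A -> vector_field B -> forall y, S y ->
    lie_bracket (push A) (push B) y = push (lie_bracket A B) y.
  move=> vA vB y Sy; rewrite -{1}(psiK Sy) push_lie_bracket //; exact: Spsi.
have vl := lie_bracket_vf.
have rX A : forall y, S y -> push A y = push A y by [].
rewrite /curvature.
rewrite (eq_connection (vp _ vX) (vp _ vX) (vD _ _ (vp _ vY) (vp _ vZ))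
  (vp _ (vD _ _ vY vZ)) (rX X) (pD _ _ vY vZ) Sfx).
rewrite (eq_connection (vp _ vY) (vp _ vY) (vD _ _ (vp _ vX) (vp _ vZ))
  (vp _ (vD _ _ vX vZ)) (rX Y) (pD _ _ vX vZ) Sfx).
rewrite (eq_connection (vl _ _ _ _ (vp _ vX) (vp _ vY)) (vp _ (vl _ _ _ _ vX vY))
  (vp _ vZ) (vp _ vZ) (pl _ _ vX vY) (rX Z) Sfx).
rewrite (push_connection vX (vD _ _ vY vZ) Sx) (push_connection vY (vD _ _ vX vZ) Sx).
rewrite (push_connection (vl _ _ _ _ vX vY) vZ Sx).
have B u v : dS phi x (u - v) = dS phi x u - dS phi x v.
  by rewrite addrC -scaleN1r (dS_linear _ _ _ sphi Sx) scaleN1r addrC.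
by rewrite !B.
Qed.

End Isometry.
End Connection.
End LeviCivita.

(** * Expansion of tensorial operators in a frame *)

Section FrameExpansion.
Context {R : realType} {m : nat}.
Local Notation V := 'rV[R]_m.+1.
Local Notation S := (sphere R m).
Implicit Types (x y u v w : V) (X Y Z : V -> V).

Lemma vfD X Y : vector_field X -> vector_field Y ->
  vector_field (fun y => X y + Y y).
Proof.
move=> /vector_fieldP[sX tX] /vector_fieldP[sY tY]; apply/vector_fieldP; split.
  exact: smSD.
by move=> x Sx; apply: tangentD; [exact: tX|exact: tY].
Qed.

Lemma vfZ (f : V -> R) X : smS f -> vector_field X -> vector_field (fun y => f y *: X y).
Proof.
move=> sf /vector_fieldP[sX tX]; apply/vector_fieldP; split; first exact: smSZ.
by move=> x Sx; apply: tangentZ; exact: tX.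
Qed.

Lemma vf0 : vector_field (fun _ : V => 0 : V).
Proof.
apply/vector_fieldP; split; first exact: smS_cst.
by move=> x _; rewrite /tangent /= dot0r.
Qed.

Lemma vf_smS X : vector_field X -> smS X.
Proof. by move=> /vector_fieldP[]. Qed.

Lemma vf_tangent X x : vector_field X -> S x -> tangent x (X x).
Proof. by move=> /vector_fieldP[_]; exact. Qed.

Lemma vf_sum (I : eqType) (r : seq I) (F : I -> V -> V) :
  (forall i, vector_field (F i)) -> vector_field (fun y => \sum_(i <- r) F i y).
Proof.
move=> vF; apply/vector_fieldP; split.
  by apply: smS_sum => i; exact: vf_smS.
move=> x Sx; rewrite /tangent /=; elim: r => [|i r IH].
  by rewrite big_nil dot0r.
by rewrite big_cons dotDr IH (vf_tangent (vF i) Sx) addr0.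
Qed.

(** The projected coordinate vectors: m + 1 dependent fields spanning tangent spaces of dimension m.
    The ambient coordinates of a tangent vector are smooth coefficients for it. *)
Definition frame i : V -> V := tangent_field (delta_mx 0 i).

Lemma frame_vf i : vector_field (frame i).
Proof. exact: tangent_field_vf. Qed.

Lemma frame_sum x v : tangent x v -> v = \sum_i v 0 i *: frame i x.
Proof.
move=> tv; rewrite -[LHS](tangent_fieldE tv) /tangent_field.
have -> : dot x v = \sum_i v 0 i * dot x (delta_mx 0 i).
  by apply: eq_bigr => i _; rewrite (dotC x) dot_delta mulrC.
rewrite {1}[v]row_sum_delta scaler_suml -sumrB; apply: eq_bigr => i _.
by rewrite /frame /tangent_field scalerBr scalerA.
Qed.

(** Linearity over smooth functions makes [A] depend only on the value at x. Invariance under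
    equality on the sphere is asked for because a field agrees with its frame expansion there
    only. *)
Lemma tensor_expand (A : (V -> V) -> V) x : S x ->
  (forall X Y, vector_field X -> vector_field Y ->
     A (fun y => X y + Y y) = A X + A Y) ->
  (forall (f : V -> R) X, smS f -> vector_field X -> A (fun y => f y *: X y) = f x *: A X) ->
  (forall X Y, vector_field X -> vector_field Y -> (forall y, S y -> X y = Y y) ->
     A X = A Y) ->
  forall X, vector_field X -> A X = \sum_i X x 0 i *: A (frame i).
Proof.
move=> Sx AD AZ Aeq X vX.
have vXi i : vector_field (fun y => X y 0 i *: frame i y).
  by apply: vfZ; [exact: smS_coord (vf_smS vX)|exact: frame_vf].
have H (r : seq 'I_m.+1) : A (fun y => \sum_(i <- r) X y 0 i *: frame i y) =
    \sum_(i <- r) X x 0 i *: A (frame i).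
  elim: r => [|i r IH].
    rewrite big_nil (Aeq _ (fun y => (0 : R) *: (0 : V))).
    - by rewrite (AZ (fun _ => 0) (fun _ => 0) (smS_cst _) vf0) scale0r.
    - exact: vf_sum.
    - by apply: vfZ; [exact: smS_cst|exact: vf0].
    - by move=> y _; rewrite big_nil scaler0.
  rewrite big_cons -IH -(AZ _ _ (smS_coord i (vf_smS vX)) (frame_vf i)).
  rewrite -(AD _ _ (vXi i) (vf_sum _ vXi)).
  apply: Aeq => [||y _]; last by rewrite big_cons.
  - exact: vf_sum.
  - by apply: vfD => //; exact: vf_sum.
rewrite -H; apply: Aeq => // [|y Sy]; first exact: vf_sum.
by apply: frame_sum; exact: vf_tangent.
Qed.

Lemma lie_bracketDr X Y Z x : smS X -> smS Y -> smS Z -> S x ->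
  lie_bracket X (fun y => Y y + Z y) x = lie_bracket X Y x + lie_bracket X Z x.
Proof.
move=> sX sY sZ Sx; rewrite /lie_bracket (dSD _ sY sZ Sx).
have := dS_linear 1 (Y x) (Z x) sX Sx; rewrite !scale1r => ->.
by rewrite opprD addrACA.
Qed.

Lemma lie_bracketZr (f : V -> R) X Y x : smS f -> smS X -> smS Y -> S x ->
  lie_bracket X (fun y => f y *: Y y) x =
  dS f x (X x) *: Y x + f x *: lie_bracket X Y x.
Proof.
move=> sf sX sY Sx; rewrite /lie_bracket (dSZ _ sf sY Sx).
have -> : dS X x (f x *: Y x) = f x *: dS X x (Y x).
  by rewrite -[X in dS _ _ X]addr0 (dS_linear _ _ _ sX Sx) /dS derive0 addr0.
by rewrite scalerBr addrA.
Qed.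

Lemma lie_bracketC X Y x : lie_bracket X Y x = - lie_bracket Y X x.
Proof. by rewrite /lie_bracket opprB. Qed.

End FrameExpansion.

(** * Vector identities for the three terms of a curvature operator *)

Section ThreeTerms.
Context {R : realType} {m : nat}.
Implicit Types (a b c d e z : 'rV[R]_m) (p q s t f : R).

Lemma sub3_eq a a' b b' c c' : a = a' -> b = b' -> c = c' ->
  a - b - c = a' - b' - c'.
Proof. by move=> -> -> ->. Qed.

Lemma sub3N a b c : a - b - c = - (b - a - - c).
Proof. by apply/rowP => i; rewrite !mxE; ring. Qed.

Lemma sub3D a b c a' b' c' :
  (a + a') - (b + b') - (c + c') = (a - b - c) + (a' - b' - c').
Proof. by apply/rowP => i; rewrite !mxE; ring. Qed.

Lemma sub3Zl p s a b c d :
  (p *: d + s *: a) - s *: b - (p *: d + s *: c) = s *: (a - b - c).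
Proof. by apply/rowP => i; rewrite !mxE; ring. Qed.

Lemma sub3Zr p q s t f a b c d e z :
  (s *: z + q *: a + (p *: b + f *: c)) - (t *: z + p *: b + (q *: a + f *: d))
  - ((s - t) *: z + f *: e) = f *: (c - d - e).
Proof. by apply/rowP => i; rewrite !mxE; ring. Qed.

End ThreeTerms.

(** * Tensoriality of the curvature *)

Section CurvatureTensor.
Context {R : realType} {m : nat}.
Local Notation V := 'rV[R]_m.+1.
Local Notation S := (sphere R m).
Implicit Types (x y u v w : V) (X Y Z : V -> V).
Variable g : V -> V -> V -> R.
Hypothesis gm : riemannian_metric g.
Variable D : (V -> V) -> (V -> V) -> V -> V.
Hypothesis lc : levi_civita g D.

Let vD X Y : vector_field X -> vector_field Y -> vector_field (D X Y).
Proof. by move=> vX vY; exact: (lc_field lc). Qed.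
Let rX X : forall y, S y -> X y = X y. Proof. by []. Qed.

Lemma smooth_funP (f : V -> R) : smS f -> smooth_fun f.
Proof. by move=> sf; apply/smooth_onP. Qed.

Lemma curvatureC X Y Z x : vector_field X -> vector_field Y -> vector_field Z ->
  S x -> curvature D X Y Z x = - curvature D Y X Z x.
Proof.
move=> vX vY vZ Sx; have vl := lie_bracket_vf vY vX.
have e : D (lie_bracket X Y) Z x = - D (lie_bracket Y X) Z x.
  apply: etrans (eq_connection gm lc (lie_bracket_vf vX vY)
    (vfZ (smS_cst (-1 : R)) vl) vZ vZ _ (rX Z) Sx) _.
    by move=> y _; rewrite lie_bracketC scaleN1r.
  apply: etrans (lc_mull lc (smooth_funP (smS_cst (-1 : R))) vl vZ Sx) _.
  by rewrite scaleN1r.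
apply: etrans (sub3_eq erefl erefl e) _; rewrite sub3N opprK; exact: erefl.
Qed.

Lemma curvature_Dl X Y Z W x : vector_field X -> vector_field Y ->
  vector_field Z -> vector_field W -> S x ->
  curvature D X (fun y => Y y + Z y) W x =
  curvature D X Y W x + curvature D X Z W x.
Proof.
move=> vX vY vZ vW Sx; have vYZ := vfD vY vZ.
have vl := lie_bracket_vf vX vY; have vl' := lie_bracket_vf vX vZ.
have e1 := etrans (eq_connection gm lc vX vX (vD vYZ vW)
  (vfD (vD vY vW) (vD vZ vW)) (rX X) (fun y Sy => lc_addl lc vY vZ vW Sy) Sx)
  (lc_addr lc vX (vD vY vW) (vD vZ vW) Sx).
have e2 := lc_addl lc vY vZ (vD vX vW) Sx.
have e3 := etrans (eq_connection gm lc (lie_bracket_vf vX vYZ) (vfD vl vl') vW vW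
  (fun y Sy => lie_bracketDr (vf_smS vX) (vf_smS vY) (vf_smS vZ) Sy) (rX W) Sx)
  (lc_addl lc vl vl' vW Sx).
exact: (etrans (sub3_eq e1 e2 e3) (sub3D _ _ _ _ _ _)).
Qed.

(** The Leibniz term df(X) D_Y W cancels with the one produced by [X, f Y] = df(X) Y + f [X, Y]. *)
Lemma curvature_Zl (f : V -> R) X Y W x : smS f -> vector_field X ->
  vector_field Y -> vector_field W -> S x ->
  curvature D X (fun y => f y *: Y y) W x = f x *: curvature D X Y W x.
Proof.
move=> sf vX vY vW Sx; have Sf := smooth_funP sf; have vfY := vfZ sf vY.
have vl := lie_bracket_vf vX vY.
have sd : smS (fun y => dS f y (X y)) by exact: smS_dS (vf_smS vX).
have e1 := etrans (eq_connection gm lc vX vX (vD vfY vW) (vfZ sf (vD vY vW))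
  (rX X) (fun y Sy => lc_mull lc Sf vY vW Sy) Sx)
  (lc_leibniz lc Sf vX (vD vY vW) Sx).
have e2 := lc_mull lc Sf vY (vD vX vW) Sx.
have e3 := etrans (eq_connection gm lc (lie_bracket_vf vX vfY)
  (vfD (vfZ sd vY) (vfZ sf vl)) vW vW
  (fun y Sy => lie_bracketZr sf (vf_smS vX) (vf_smS vY) Sy) (rX W) Sx)
  (lc_addl lc (vfZ sd vY) (vfZ sf vl) vW Sx).
have e4 := etrans e3 (congr2 +%R (lc_mull lc (smooth_funP sd) vY vW Sx)
  (lc_mull lc Sf vl vW Sx)).
exact: (etrans (sub3_eq e1 e2 e4) (sub3Zl _ _ _ _ _ _)).
Qed.

Lemma curvature_Dr X Y Z W x : vector_field X -> vector_field Y ->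
  vector_field Z -> vector_field W -> S x ->
  curvature D X Y (fun y => Z y + W y) x =
  curvature D X Y Z x + curvature D X Y W x.
Proof.
move=> vX vY vZ vW Sx.
have vZW := vfD vZ vW; have vl := lie_bracket_vf vX vY.
have E A B : vector_field A -> vector_field B ->
    D A (D B (fun y => Z y + W y)) x = D A (D B Z) x + D A (D B W) x.
  move=> vA vB.
  exact: (etrans (eq_connection gm lc vA vA (vD vB vZW) (vfD (vD vB vZ) (vD vB vW))
    (rX A) (fun y Sy => lc_addr lc vB vZ vW Sy) Sx)
    (lc_addr lc vA (vD vB vZ) (vD vB vW) Sx)).
exact: (etrans (sub3_eq (E X Y vX vY) (E Y X vY vX) (lc_addr lc vl vZ vW Sx))
  (sub3D _ _ _ _ _ _)).
Qed.

(** First-order terms cancel in pairs; the second-order part X(Y f) - Y(X f) cancels with the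
    derivative of f along [X, Y], by [lie_bracket_dS]. *)
Lemma curvature_Zr (f : V -> R) X Y Z x : smS f -> vector_field X ->
  vector_field Y -> vector_field Z -> S x ->
  curvature D X Y (fun y => f y *: Z y) x = f x *: curvature D X Y Z x.
Proof.
move=> sf vX vY vZ Sx.
have Sf := smooth_funP sf; have vfZ' := vfZ sf vZ.
have vl := lie_bracket_vf vX vY.
have sd A : vector_field A -> smS (fun y => dS f y (A y)).
  by move=> vA; exact: smS_dS (vf_smS vA).
have E A B : vector_field A -> vector_field B ->
    D A (D B (fun y => f y *: Z y)) x =
    (dS (fun y => dS f y (B y)) x (A x) *: Z x + dS f x (B x) *: D A Z x)
    + (dS f x (A x) *: D B Z x + f x *: D A (D B Z) x).
  move=> vA vB; have s1 := vfZ (sd B vB) vZ; have s2 := vfZ sf (vD vB vZ).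
  have e1 := etrans (eq_connection gm lc vA vA (vD vB vfZ') (vfD s1 s2)
    (rX A) (fun y Sy => lc_leibniz lc Sf vB vZ Sy) Sx) (lc_addr lc vA s1 s2 Sx).
  exact: (etrans e1 (congr2 +%R (lc_leibniz lc (smooth_funP (sd B vB)) vA vZ Sx)
    (lc_leibniz lc Sf vA (vD vB vZ) Sx))).
have e3 := lc_leibniz lc Sf vl vZ Sx.
have e4 := lie_bracket_dS sf (vf_smS vX) (vf_smS vY) Sx (vf_tangent vX Sx)
  (vf_tangent vY Sx).
have e5 := etrans e3 (congr1 (fun r => r *: Z x + f x *: D (lie_bracket X Y) Z x) e4).
exact: (etrans (sub3_eq (E X Y vX vY) (E Y X vY vX) e5)
  (sub3Zr _ _ _ _ _ _ _ _ _ _ _)).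
Qed.

Lemma eq_curvature X X' Y Y' Z Z' x : vector_field X -> vector_field X' ->
  vector_field Y -> vector_field Y' -> vector_field Z -> vector_field Z' ->
  (forall y, S y -> X y = X' y) -> (forall y, S y -> Y y = Y' y) ->
  (forall y, S y -> Z y = Z' y) -> S x ->
  curvature D X Y Z x = curvature D X' Y' Z' x.
Proof.
move=> vX vX' vY vY' vZ vZ' XX YY ZZ Sx.
have E A A' B B' : vector_field A -> vector_field A' -> vector_field B ->
    vector_field B' -> (forall y, S y -> A y = A' y) ->
    (forall y, S y -> B y = B' y) -> forall y, S y -> D A B y = D A' B' y.
  by move=> vA vA' vB vB' AA BB y Sy; exact: (eq_connection gm lc vA vA' vB vB' AA BB Sy).
exact: (sub3_eq
  (E _ _ _ _ vX vX' (vD vY vZ) (vD vY' vZ') XX (E _ _ _ _ vY vY' vZ vZ' YY ZZ) x Sx)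
  (E _ _ _ _ vY vY' (vD vX vZ) (vD vX' vZ') YY (E _ _ _ _ vX vX' vZ vZ' XX ZZ) x Sx)
  (E _ _ _ _ (lie_bracket_vf vX vY) (lie_bracket_vf vX' vY') vZ vZ'
    (fun y Sy => eq_lie_bracket Sy XX YY) ZZ x Sx)).
Qed.

(** Trilinear on the whole ambient space, by way of the frame, so that it can be traced in ambient
    coordinates. *)
Definition curvature_tensor x u v w : V :=
  \sum_i u 0 i *: \sum_j v 0 j *: \sum_k w 0 k *:
    curvature D (frame i) (frame j) (frame k) x.

Lemma curvature_tensorE X Y Z x : vector_field X -> vector_field Y ->
  vector_field Z -> S x ->
  curvature D X Y Z x = curvature_tensor x (X x) (Y x) (Z x).
Proof.
move=> vX vY vZ Sx; have vF := @frame_vf R m.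
have Zexp A B : vector_field A -> vector_field B ->
    curvature D A B Z x = \sum_k Z x 0 k *: curvature D A B (frame k) x.
  move=> vA vB.
  exact: (tensor_expand Sx (A := fun C => curvature D A B C x)
    (fun C C' vC vC' => curvature_Dr vA vB vC vC' Sx)
    (fun f C sf vC => curvature_Zr sf vA vB vC Sx)
    (fun C C' vC vC' CC =>
       eq_curvature vA vA vB vB vC vC' (rX A) (rX B) CC Sx) vZ).
have Yexp A : vector_field A ->
    curvature D A Y Z x = \sum_j Y x 0 j *: curvature D A (frame j) Z x.
  move=> vA.
  exact: (tensor_expand Sx (A := fun C => curvature D A C Z x)
    (fun C C' vC vC' => curvature_Dl vA vC vC' vZ Sx)
    (fun f C sf vC => curvature_Zl sf vA vC vZ Sx)
    (fun C C' vC vC' CC =>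
       eq_curvature vA vA vC vC' vZ vZ (rX A) CC (rX Z) Sx) vY).
have Xexp : curvature D X Y Z x = \sum_i X x 0 i *: curvature D (frame i) Y Z x.
  have XD C C' : vector_field C -> vector_field C' ->
      curvature D (fun y => C y + C' y) Y Z x = curvature D C Y Z x + curvature D C' Y Z x.
    move=> vC vC'; apply: (etrans (curvatureC (vfD vC vC') vY vZ Sx)).
    apply: (etrans (congr1 -%R (curvature_Dl vY vC vC' vZ Sx))).
    apply: (etrans (opprD _ _)).
    exact: (esym (congr2 +%R (curvatureC vC vY vZ Sx) (curvatureC vC' vY vZ Sx))).
  have XZ (f : V -> R) C : smS f -> vector_field C ->
      curvature D (fun y => f y *: C y) Y Z x = f x *: curvature D C Y Z x.
    move=> sf vC; apply: (etrans (curvatureC (vfZ sf vC) vY vZ Sx)).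
    apply: (etrans (congr1 -%R (curvature_Zl sf vY vC vZ Sx))).
    apply: (etrans (esym (scalerN _ _))).
    exact: (esym (congr1 ( *:%R (f x)) (curvatureC vC vY vZ Sx))).
  exact: (tensor_expand Sx (A := fun C => curvature D C Y Z x) XD XZ
    (fun C C' vC vC' CC =>
       eq_curvature vC vC' vY vY vZ vZ CC (rX Y) (rX Z) Sx) vX).
apply: (etrans Xexp); apply: eq_bigr => i _; congr (_ *: _).
apply: (etrans (Yexp _ (vF i))); apply: eq_bigr => j _; congr (_ *: _).
exact: (Zexp _ _ (vF i) (vF j)).
Qed.

End CurvatureTensor.

(** * The weighted Sasakian metric at a point *)

Lemma coordD (R : realType) m (y z : 'rV[R]_m) i : (y + z) 0 i = y 0 i + z 0 i.
Proof. exact: mxE. Qed.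
Lemma coordN (R : realType) m (y : 'rV[R]_m) i : (- y) 0 i = - y 0 i.
Proof. exact: mxE. Qed.
Lemma coordZ (R : realType) m (a : R) (y : 'rV[R]_m) i : (a *: y) 0 i = a * y 0 i.
Proof. exact: mxE. Qed.

Section WeightedAlgebra.
Context {R : realType} {m : nat}.
Local Notation V := 'rV[R]_m.+1.
Implicit Types (x y u v w : V).
Variables (J E : {linear V -> V}) (ep : R).
Hypothesis ep0 : 0 < ep.
Hypothesis JJ : forall x, J (J x) = - x.
Hypothesis Jdot : forall x y, dot x (J y) = - dot (J x) y.
Hypothesis EE : forall x, E (E x) = E x.
Hypothesis EJ : forall x, E (J x) = J (E x).
Hypothesis Edot : forall x y, dot x (E y) = dot (E x) y.

(* The prefix d denotes the differential at [x] in the direction [u]; [chr] is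
   the difference between the Levi-Civita connection of [wmetric] and the flat
   derivative. *)
Definition wsigma x := 1 + ep * dot (E x) x.
Definition wf x := (wsigma x)^-1.
Definition dwf x u := - (wf x ^+ 2 * (2 * ep * dot (E x) u)).
Definition reeb x : V := J x + ep *: J (E x).
Definition eta x v := wf x * dot (J x) v.
Definition deta x u v := dwf x u * dot (J x) v + wf x * dot (J u) v.
Definition hor x v : V := v - eta x v *: reeb x.
Definition dhor x u v : V := - (deta x u v *: reeb x + eta x v *: reeb u).
Definition wmetric x v w := eta x v * eta x w + wf x * dot (hor x v) (hor x w).
Definition dwmetric x u v w :=
  deta x u v * eta x w + eta x v * deta x u w +
  (dwf x u * dot (hor x v) (hor x w) +
   wf x * (dot (dhor x u v) (hor x w) + dot (hor x v) (dhor x u w))).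
Definition wc x : V := x - wf x *: (x + ep *: E x).
Definition dwc x u : V := u - (dwf x u *: (x + ep *: E x) + wf x *: (u + ep *: E u)).
(** On horizontal vectors <c, u> v + <c, v> u + <J c, u> J v + <J c, v> J u has the form of a
    c-projective change, and <u, v> (x - c) joins the second fundamental form of the sphere to the
    gradient term of a conformal change by f. The terms with [eta] turn the flat derivative of T
    into J (hor u) and make D_T T vanish. *)
Definition chr x u v : V :=
  dot (hor x u) (hor x v) *: x + dot (wc x) (hor x u) *: hor x v
  + dot (wc x) (hor x v) *: hor x u - dot (hor x u) (hor x v) *: wc x
  + dot (J (wc x)) (hor x v) *: J (hor x u) + dot (J (wc x)) (hor x u) *: J (hor x v)
  - ep *: J (E (eta x v *: hor x u + eta x u *: hor x v))
  + (eta x u * eta x v) *: (x + (2 * ep + ep ^+ 2) *: E x).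

Let JD x y : J (x + y) = J x + J y. Proof. exact: raddfD. Qed.
Let JN x : J (- x) = - J x. Proof. exact: raddfN. Qed.
Let JZ a x : J (a *: x) = a *: J x. Proof. exact: linearZ. Qed.
Let ED x y : E (x + y) = E x + E y. Proof. exact: raddfD. Qed.
Let EN x : E (- x) = - E x. Proof. exact: raddfN. Qed.
Let EZ a x : E (a *: x) = a *: E x. Proof. exact: linearZ. Qed.

Lemma Jskew x : dot (J x) x = 0.
Proof. by have := Jdot x x; rewrite dotC; lra. Qed.

Lemma JEskew x : dot (J (E x)) x = 0.
Proof. by rewrite -EE -EJ -Edot Jskew. Qed.

Lemma wsigma_gt0 x : 0 < wsigma x.
Proof.
by rewrite /wsigma ltr_pwDl // -EE -Edot mulr_ge0 ?dot_ge0 // ltW.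
Qed.

Lemma wsigma_neq0 x : wsigma x != 0.
Proof. by rewrite gt_eqF // wsigma_gt0. Qed.

Lemma dotJ_flip u v : dot (J u) v = - dot (J v) u.
Proof. by rewrite dotC Jdot. Qed.
Lemma dotE_flip u v : dot (E u) v = dot (E v) u.
Proof. by rewrite dotC Edot. Qed.
Lemma dotJE_flip u v : dot (J (E u)) v = - dot (J (E v)) u.
Proof. by rewrite dotC Jdot Edot EJ. Qed.

Ltac dsimp := rewrite ?(JD, JN, JZ, ED, EN, EZ, JJ, EJ, EE, Jdot, Edot,
  dotDl, dotDr, dotZl, dotZr, dotNl, dotNr, Jskew, JEskew, oppr0, mulr0, addr0, add0r, opprK) /=.

(* Calculus in terms of [c = wc x]: the vectors [E x] and [E c] are combinations
   of [x] and [c], and a tangent vector is split as [U + a *: T] with [U]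
   orthogonal to [x] and [J x]. The suffix h marks quantities written in terms
   of this splitting; Qh is the covariant derivative of [c]. *)
Section Horizontal.
Variables (x c : V) (f : R).
Hypotheses (f0 : f != 0) (e0 : ep != 0).
Hypotheses (xx : dot x x = 1) (cx : dot c x = 0) (Jcx : dot (J c) x = 0)
  (cc : dot c c = (1 - f) * ((1 + ep) * f - 1)).
Hypothesis Ex : E x = (ep * f)^-1 *: ((1 - f) *: x - c).
Hypothesis Ec : E c = ((ep * f)^-1 * (1 - (1 + ep) * f)) *: ((1 - f) *: x - c).

Let T : V := f^-1 *: (J x - J c).

Definition chrh (U : V) (a : R) (W : V) (b : R) : V :=
  dot U W *: x + dot c U *: W + dot c W *: U - dot U W *: c
  + dot (J c) W *: J U + dot (J c) U *: J W
  - ep *: J (E (b *: U + a *: W))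
  + (a * b) *: (x + (2 * ep + ep ^+ 2) *: E x).

Variables (U W Z : V) (a b d : R).
Hypotheses (xU : dot x U = 0) (JxU : dot (J x) U = 0).
Hypotheses (xW : dot x W = 0) (JxW : dot (J x) W = 0).
Hypotheses (xZ : dot x Z = 0) (JxZ : dot (J x) Z = 0).

(** One orientation for each scalar product and for its variants with J, E and J E, so that [field]
    meets every scalar under a single name; E x and E c are eliminated along the way. *)
Let fl := (dotC U x, dotC W x, dotC Z x, dotC x c, dotC U c, dotC W c, dotC Z c,
  dotC W U, dotC Z U, dotC Z W,
  dotJ_flip U x, dotJ_flip W x, dotJ_flip Z x, dotJ_flip x c,
  dotJ_flip U c, dotJ_flip W c, dotJ_flip Z c,
  dotJ_flip W U, dotJ_flip Z U, dotJ_flip Z W,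
  dotE_flip U x, dotE_flip W x, dotE_flip Z x,
  dotE_flip U c, dotE_flip W c, dotE_flip Z c,
  dotE_flip W U, dotE_flip Z U, dotE_flip Z W,
  dotJE_flip U x, dotJE_flip W x, dotJE_flip Z x,
  dotJE_flip U c, dotJE_flip W c, dotJE_flip Z c,
  dotJE_flip W U, dotJE_flip Z U, dotJE_flip Z W, Ex, Ec,
  xx, cx, Jcx, cc, xU, JxU, xW, JxW, xZ, JxZ).

Ltac hsimp := rewrite /T; repeat (progress (dsimp; rewrite ?fl)).

Ltac hvec := hsimp; apply/rowP => i; rewrite !mxE; field; rewrite ?f0 ?e0.

Let u := U + a *: T.
Let v := W + b *: T.
(** The flat derivative of a tangent field has normal part - <u, v>, which this compensates: the
    corrected derivative is tangent. *)
Lemma chrh_x : dot x (chrh U a W b) = dot u v.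
Proof. by rewrite /chrh /u /v; hsimp; field; rewrite f0 e0. Qed.

Definition detah (U : V) (a : R) (W : V) (b : R) :=
  f * dot (J U) W + b * dot c U + a * dot c W.
Definition etah z := f * dot (J x) z.
Definition dhorh (U : V) (a : R) (W : V) (b : R) : V :=
  - (detah U a W b *: T + b *: (J (U + a *: T) + ep *: J (E (U + a *: T)))).

(** Compatibility with the metric. On the left is the derivative of g with both vectors held fixed,
    where 2 f <c, U> is the derivative of f. *)
Lemma chrh_metric :
  detah U a W b * d + b * detah U a Z d + (2 * f * dot c U * dot W Z +
     f * (dot (dhorh U a W b) Z + dot W (dhorh U a Z d))) =
  (etah (chrh U a W b) * d + f * dot (chrh U a W b - etah (chrh U a W b) *: T) Z) +
  (b * etah (chrh U a Z d) + f * dot W (chrh U a Z d - etah (chrh U a Z d) *: T)).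
Proof.
by rewrite /etah /dhorh /detah /chrh; hsimp; field; rewrite f0 e0.
Qed.

(** As D_v T = J (hor v), the Sasakian equation prescribes the covariant derivative of the
    endomorphism J o hor, which is the left-hand side here. *)
Lemma chrh_sasakian :
  J (dhorh U a W b) + chrh U a (J W) 0
    - J (chrh U a W b - etah (chrh U a W b) *: T) =
  b *: u - (a * b + f * dot U W) *: T.
Proof.
by rewrite /etah /dhorh /detah /chrh /u; hvec.
Qed.

Definition Qh (W : V) (b : R) : V :=
  ((1 + ep) * f * (1 - f)) *: W - (ep * f) *: E W - dot c W *: x
  + (2 * dot c W) *: c + dot (J c) W *: J c + b *: J c.
(** For horizontal W, the orthogonal projection of ep f E W on the complement of x and J x. *)
Definition Eh (W : V) : V := (ep * f) *: E W + dot c W *: x + dot (J c) W *: J x.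
(** [Qh] without its component (f <J c, W>) T, since [chrh] takes the two components as separate
    arguments. *)
Definition Qhor (W : V) (b : R) : V :=
  ((1 + ep) * f * (1 - f)) *: W - Eh W + (2 * dot c W) *: c
  + (2 * dot (J c) W) *: J c + b *: J c.
Definition dch (U : V) (a : R) : V := (U + a *: T) -
  ((2 * f * dot c U) *: (x + ep *: E x)
   + f *: ((U + a *: T) + ep *: E (U + a *: T))).

Lemma Qh_chr : dch W b + chrh W b c 0 = Qh W b.
Proof.
by rewrite /dch /chrh /Qh; hvec.
Qed.

(** The derivative of [Qh] along U + a T at a fixed tangent vector: its horizontal part W and its
    coefficient b still vary with the point, by [dhorh] and [detah]. *)
Definition dQh (U : V) (a : R) (W : V) (b : R) : V :=
  let p := 2 * f * dot c U in let dh := dhorh U a W b in let dc := dch U a in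
  ((1 + ep) * p * (1 - 2 * f)) *: W + ((1 + ep) * f * (1 - f)) *: dh
  - (ep * p) *: E W - (ep * f) *: E dh
  - (dot dc W + dot c dh) *: x - dot c W *: (U + a *: T)
  + (2 * (dot dc W + dot c dh)) *: c + (2 * dot c W) *: dc
  + (dot (J dc) W + dot (J c) dh) *: J c + dot (J c) W *: J dc
  + detah U a W b *: J c + b *: J dc.

Definition Nh (W : V) : V := ((1 + ep) * (f - 1) / 2) *: W + Eh W.
Definition nuh := (3 * (1 + ep) * f - (1 + ep) - 2) / 2.

(* The curvature of g in the third slot c: a constant curvature part plus the
   polarization of the Fubini-Study curvature by the Hermitian operator Nh,
   for which c is an eigenvector with eigenvalue nuh. *)
Definition curvh (U : V) (a : R) (W : V) (b : R) : V :=
  (f * dot c W) *: (U + a *: T) - (f * dot c U) *: (W + b *: T) +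
  f *: ((nuh * dot c W) *: U - (nuh * dot c U) *: W
   + dot c W *: Nh U - dot c U *: Nh W
   - (nuh * dot (J c) W) *: J U + (nuh * dot (J c) U) *: J W
   - dot (J c) W *: J (Nh U) + dot (J c) U *: J (Nh W)
   - (2 * dot (J U) (Nh W)) *: J c - (2 * nuh * dot (J U) W) *: J c).

(** The value of <c, c>. The facts that follow evaluate scalar products with [dch], [dhorh] and
    [Qhor] in advance, so that the large expansion in [curvh_eq] starts from scalars in normal
    form. *)
Let ka := (1 - f) * ((1 + ep) * f - 1).
Let be := (1 + ep) - (1 - f) / f.

Let dchE (A : V) s : dch A s = (1 - f) *: A - (ep * f) *: E A
  - (2 * dot c A) *: x + (2 * dot c A) *: c
  + (s * (1 - f) * (f^-1 - (1 + ep))) *: J x + (s * be) *: J c.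
Proof.
by rewrite /dch /be; hsimp; apply/rowP => i; rewrite !mxE; field; rewrite ?f0 ?e0.
Qed.

Let dhorhE (A : V) s (B : V) t : dhorh A s B t =
  - (detah A s B t / f) *: J x + (detah A s B t / f) *: J c - t *: J A
  - (t * ep) *: J (E A) + (s * t / f * (1 + (1 + ep) * (1 - f))) *: x
  - (s * t / f * (2 + ep)) *: c.
Proof.
rewrite /dhorh; move: (detah A s B t) => de.
by hsimp; apply/rowP => i; rewrite !mxE; field; rewrite ?f0 ?e0.
Qed.

Let dot_dch (A : V) s (B : V) : dot x B = 0 -> dot (J x) B = 0 ->
  dot (dch A s) B = (1 - f) * dot A B - ep * f * dot (E A) B
  + 2 * dot c A * dot c B + s * be * dot (J c) B.
Proof.
by move=> xB' JxB'; rewrite dchE; dsimp; rewrite xB' JxB'; ring.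
Qed.

Let dot_Jdch (A : V) s (B : V) : dot x B = 0 -> dot (J x) B = 0 ->
  dot (J (dch A s)) B = (1 - f) * dot (J A) B - ep * f * dot (J (E A)) B
  + 2 * dot c A * dot (J c) B - s * be * dot c B.
Proof.
by move=> xB' JxB'; rewrite dchE; dsimp; rewrite xB' JxB'; ring.
Qed.

Let dot_dhorh (A : V) s (B : V) t : dot x A = 0 -> dot (J x) A = 0 ->
  dot c (dhorh A s B t) =
  t * dot (J c) A * (2 + ep - f^-1) - s * t / f * (2 + ep) * ka.
Proof.
move=> xA' JxA'; rewrite dhorhE (dotC c); dsimp.
rewrite !(dotJE_flip _ c) !(dotJ_flip _ c) (dotC x c) Ec; dsimp.
rewrite cx Jcx cc JxA' /ka; field; by rewrite ?f0 ?e0.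
Qed.

Let dot_Jdhorh (A : V) s (B : V) t : dot x A = 0 -> dot (J x) A = 0 ->
  dot (J c) (dhorh A s B t) =
  detah A s B t / f * ka - t * dot c A * (2 + ep - f^-1).
Proof.
move=> xA' JxA'; rewrite dhorhE (dotC (J c)); dsimp.
rewrite (dotC A c) (dotE_flip A c) ?(dotC x c) ?(dotJ_flip x c) Ec; dsimp.
rewrite cx Jcx cc xA' /ka; field; by rewrite ?f0 ?e0.
Qed.

Let dot_Qhor (A : V) (B : V) t : dot x A = 0 -> dot (J x) A = 0 ->
  dot A (Qhor B t) = (1 + ep) * f * (1 - f) * dot A B - ep * f * dot (E A) B
   + 2 * dot c A * dot c B + 2 * dot (J c) A * dot (J c) B + t * dot (J c) A.
Proof.
move=> xA' JxA'; rewrite dotC /Qhor /Eh; dsimp.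
rewrite xA' JxA' (dotC B A) (dotE_flip B A); ring.
Qed.

Let dot_cQhor (B : V) t : dot x B = 0 -> dot (J x) B = 0 ->
  dot c (Qhor B t) =
    dot c B * ((1 + ep) * f * (1 - f) + 1 - (1 + ep) * f + 2 * ka).
Proof.
move=> xB' JxB'; rewrite /Qhor /Eh; dsimp.
rewrite Ec; dsimp; rewrite cx Jcx cc xB' /ka; field; by rewrite ?f0 ?e0.
Qed.

Let dot_JcQhor (B : V) t : dot x B = 0 -> dot (J x) B = 0 ->
  dot (J c) (Qhor B t) =
    dot (J c) B * ((1 + ep) * f * (1 - f) + 1 - (1 + ep) * f + 2 * ka) + t * ka.
Proof.
move=> xB' JxB'; rewrite /Qhor /Eh; dsimp.
rewrite Ec; dsimp; rewrite cx Jcx cc JxB' /ka; field; by rewrite ?f0 ?e0.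
Qed.

(* E has complex rank one, so it is determined by c away from the zeros of c. *)
Hypothesis f1 : 1 - f != 0.
Let rank1 (A : V) := E A = (ep * f)^-1 *: ((dot c A / (1 - f)) *: c
   + (dot (J c) A / (1 - f)) *: J c - dot c A *: x - dot (J c) A *: J x).
Hypotheses (EU : rank1 U) (EW : rank1 W).

Let EUW : dot (E U) W =
  (ep * f)^-1 * ((dot c U * dot c W + dot (J c) U * dot (J c) W) / (1 - f)).
Proof. rewrite EU; dsimp; rewrite xW JxW; field; by rewrite ?f0 ?e0 ?f1. Qed.

Let JEUW : dot (J (E U)) W =
  (ep * f)^-1 * ((dot c U * dot (J c) W - dot (J c) U * dot c W) / (1 - f)).
Proof. rewrite EU; dsimp; rewrite xW JxW; field; by rewrite ?f0 ?e0 ?f1. Qed.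

(** The left-hand side is (D_u Q) v - (D_v Q) u for Q = D c. Once complex rank one removes E, both
    sides are combinations of x, c, U, W and their images under J, with coefficients rational in a,
    b, f, ep and six scalar products. *)
Lemma curvh_eq :
  dQh U a W b - dQh W b U a + chrh U a (Qhor W b) (f * dot (J c) W)
    - chrh W b (Qhor U a) (f * dot (J c) U) = curvh U a W b.
Proof.
rewrite /dQh /chrh.
rewrite !(dot_cQhor, dot_JcQhor) // !(dot_Qhor) //.
rewrite !(dot_dch, dot_Jdch, dot_dhorh, dot_Jdhorh) //.
rewrite !dchE !dhorhE /detah.
rewrite /curvh /Nh dotDr dotZr.
have -> : dot (J U) (Eh W) = ep * f * dot (J (E U)) W.
  by rewrite /Eh; dsimp; rewrite (dotJ_flip U x) (dotC U x) JxU xU; ring.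
rewrite /Qhor /Eh /nuh /T.
rewrite !(dotC W U) !(dotJ_flip W U) !(dotE_flip W U) !(dotJE_flip W U).
rewrite ?EUW ?JEUW.
rewrite ?(JD, JN, JZ, ED, EN, EZ, JJ, EJ, EE).
rewrite EU EW Ex Ec ?(JD, JN, JZ, JJ).
rewrite /ka /be.
move: (dot c U) (dot c W) (dot (J c) U) (dot (J c) W) (dot U W) (dot (J U) W)
  (J x) (J c) (J U) (J W) => p q p' q' r r' X C U' W'.
apply/rowP => i; rewrite !(coordD, coordN, coordZ).
move: (x 0 i) (c 0 i) (U 0 i) (W 0 i) (X 0 i) (C 0 i) (U' 0 i) (W' 0 i)
  => x0 c0 U0 W0 X0 C0 U1 W1.
by field; rewrite ?f0 ?e0 ?f1.
Qed.

End Horizontal.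
End WeightedAlgebra.

(** * Traces in ambient coordinates *)

Section LinearTrace.
Context {R : realType} {m : nat}.
Local Notation V := 'rV[R]_m.+1.
Implicit Types (F G : V -> V) (z b : V).

(** Defined on bare functions, so that a curvature expression can be split into summands without
    packing each one as a linear map. *)
Definition ltrace F : R := \sum_i (F (delta_mx 0 i)) 0 i.

Lemma eq_ltrace F G : (forall u, F u = G u) -> ltrace F = ltrace G.
Proof. by move=> FG; apply: eq_bigr => i _; rewrite FG. Qed.

Lemma ltraceD F G : ltrace (fun u => F u + G u) = ltrace F + ltrace G.
Proof. by rewrite /ltrace -big_split; apply: eq_bigr => i _; rewrite mxE. Qed.

Lemma ltraceZ (a : R) F : ltrace (fun u => a *: F u) = a * ltrace F.
Proof. by rewrite /ltrace mulr_sumr; apply: eq_bigr => i _; rewrite mxE. Qed.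

Lemma ltraceN F : ltrace (fun u => - F u) = - ltrace F.
Proof. by rewrite /ltrace -sumrN; apply: eq_bigr => i _; rewrite mxE. Qed.

Lemma ltrace_id : ltrace id = m.+1%:R.
Proof.
rewrite /ltrace (eq_bigr (fun=> 1)) ?sumr_const ?card_ord // => i _.
by rewrite mxE !eqxx.
Qed.

(** The trace of a rank-one endomorphism is the value of its functional at its image vector. *)
Lemma ltrace_dot z (F : V -> V) b : linear F ->
  ltrace (fun u => dot z (F u) *: b) = dot z (F b).
Proof.
move=> lF; pose lM := GRing.isLinear.Build _ _ _ _ _ lF.
pose Fl : {linear V -> V} := HB.pack F lM.
have E : F b = \sum_i b 0 i *: F (delta_mx 0 i).
  rewrite {1}[b]row_sum_delta -[F]/(Fl : V -> V) linear_sum.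
  by apply: eq_bigr => i _; exact: linearZ.
rewrite E /ltrace /dot; under [RHS]eq_bigr => j _ do rewrite summxE mulr_sumr.
rewrite exchange_big; apply: eq_bigr => i _ /=.
rewrite mxE mulr_suml; apply: eq_bigr => j _.
by rewrite mxE -mulrA; congr (_ * _); rewrite mulrC.
Qed.

Lemma ltrace_dot_id z b : ltrace (fun u => dot z u *: b) = dot z b.
Proof. exact: (@ltrace_dot z id b). Qed.

End LinearTrace.

(** * The trace of the curvature in the direction c *)

Section TraceCurvature.
Context {R : realType} {m : nat}.
Local Notation V := 'rV[R]_m.+1.
Variables (J E : {linear V -> V}) (ep : R).
Hypothesis JJ : forall x, J (J x) = - x.
Hypothesis Jdot : forall x y, dot x (J y) = - dot (J x) y.
Variables (x c : V) (f : R).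
Hypotheses (f0 : f != 0) (f1 : 1 - f != 0).
Hypotheses (xx : dot x x = 1) (cx : dot c x = 0) (Jcx : dot (J c) x = 0)
  (cc : dot c c = (1 - f) * ((1 + ep) * f - 1)).
Hypothesis EhE : forall A, dot x A = 0 -> dot (J x) A = 0 ->
  Eh J E ep x c f A =
  (1 - f)^-1 *: (dot c A *: c + dot (J c) A *: J c).

(** Tangent projection followed by projection along T, as (f <J x, u>) T = <J x, u> (J x - J c). The
    kernel is spanned by x and T, whence the trace m + 1 - 2. *)
Definition hproj u : V := u - dot x u *: x - dot (J x) u *: (J x - J c).

Let JD y z : J (y + z) = J y + J z. Proof. exact: raddfD. Qed.
Let JN y : J (- y) = - J y. Proof. exact: raddfN. Qed.
Let JZ a y : J (a *: y) = a *: J y. Proof. exact: linearZ. Qed.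
Let Js y : dot (J y) y = 0. Proof. by have := Jdot y y; rewrite dotC; lra. Qed.
Let JxJc : dot (J x) (J c) = 0. Proof. by rewrite Jdot JJ dotNl opprK dotC cx. Qed.
Let JxJx : dot (J x) (J x) = 1. Proof. by rewrite Jdot JJ dotNl opprK. Qed.
Let cJx : dot c (J x) = 0. Proof. by rewrite Jdot Jcx oppr0. Qed.
Let cJc : dot c (J c) = 0. Proof. by rewrite Jdot Js oppr0. Qed.
Let JcJc : dot (J c) (J c) = dot c c. Proof. by rewrite Jdot JJ dotNl opprK. Qed.
Let JcJx : dot (J c) (J x) = 0. Proof. by rewrite dotC. Qed.

Lemma hproj_linear : linear hproj.
Proof.
move=> a u v; rewrite /hproj !dotDr !dotZr.
by apply/rowP => i; rewrite !mxE; ring.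
Qed.

Lemma hproj_x u : dot x (hproj u) = 0.
Proof.
rewrite /hproj !(dotDr, dotNr, dotZr) xx (dotC x (J x)) Js (dotC x (J c)) Jcx.
ring.
Qed.

Lemma hproj_Jx u : dot (J x) (hproj u) = 0.
Proof. by rewrite /hproj !(dotDr, dotNr, dotZr) Js JxJx JxJc; ring. Qed.

Lemma hproj_id u : dot x u = 0 -> dot (J x) u = 0 -> hproj u = u.
Proof. by rewrite /hproj => -> ->; rewrite !scale0r !subr0. Qed.

Lemma dot_c_hproj u : dot c (hproj u) = dot c u.
Proof. by rewrite /hproj !(dotDr, dotNr, dotZr) cx cJx cJc; ring. Qed.

Lemma ltrace_J : ltrace J = 0.
Proof. by apply: big1 => i _; rewrite -dot_delta dotC Js. Qed.

Lemma ltrace_hproj : ltrace hproj = m.+1%:R - 2.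
Proof.
rewrite (@eq_ltrace _ _ _ (fun u => id u + - (dot x u *: x)
  + - (dot (J x) u *: (J x - J c)))) //.
rewrite !(ltraceD, ltraceN) ltrace_id !ltrace_dot_id xx dotBr JxJx JxJc; ring.
Qed.

Lemma ltrace_J_hproj : ltrace (fun u => J (hproj u)) = 0.
Proof.
rewrite (@eq_ltrace _ _ _ (fun u => J u + - (dot x u *: J x)
  + - (dot (J x) u *: (- x + c)))); last first.
  by move=> u; rewrite /hproj !(JD, JN, JZ) !JJ opprK.
rewrite !(ltraceD, ltraceN) ltrace_J !ltrace_dot_id (dotC x) Js.
by rewrite dotDr dotNr Js (dotC _ c) cJx; ring.
Qed.

Variables (W : V) (b : R).
Hypotheses (xW : dot x W = 0) (JxW : dot (J x) W = 0).

Let cW := dot c W.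
Let JcW := dot (J c) W.
Let nu0 : R := (1 + ep) * (f - 1) / 2.
Let n1 := nuh ep f.
Let e1 := (1 - f)^-1.
Let NW := nu0 *: W + e1 *: (cW *: c + JcW *: J c).
Let T := f^-1 *: (J x - J c).

(* The Ricci eigenvalue of [c]. *)
Definition curvature_slope : R := m.+1%:R - 2 + n1 * (m.+1%:R + 2)
  + nu0 * (m.+1%:R - 2) + 2 * ((1 + ep) * f - 1).

(** After [EhE] the map is a combination of the identity, [hproj], J o [hproj] and rank-one maps.
    That the traces add up to a multiple of f <c, W>, the product of c and W + b T in the weighted
    metric, is the eigenvector property of c. *)
Lemma ltrace_curvh :
  ltrace (fun u => curvh J E ep x c f (hproj u) (f * dot (J x) u) W b) =
  curvature_slope * (f * cW).
Proof.
rewrite (@eq_ltrace _ _ _ (fun u =>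
   (f * cW) *: (id u + - (dot x u *: x)) +
   (- f) *: (dot c (hproj u) *: (W + b *: T)) +
   f *: ((n1 * cW + cW * nu0) *: hproj u
     + (- n1) *: (dot c (hproj u) *: W)
     + (cW * e1) *: (dot c (hproj u) *: c + dot (J c) (hproj u) *: J c)
     + - (dot c (hproj u) *: NW)
     + (- (n1 * JcW + JcW * nu0)) *: J (hproj u)
     + n1 *: (dot (J c) (hproj u) *: J W)
     + (- (JcW * e1)) *: (dot c (hproj u) *: J c + - (dot (J c) (hproj u) *: c))
     + dot (J c) (hproj u) *: J NW
     + 2 *: (dot (J NW) (hproj u) *: J c)
     + (2 * n1) *: (dot (J W) (hproj u) *: J c)))); last first.
  move=> u; rewrite /curvh /Nh !EhE //; [|exact: hproj_x|exact: hproj_Jx].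
  rewrite -/cW -/JcW -/e1 -/nu0 -/NW -/n1.
  have -> : hproj u + (f * dot (J x) u) *: (f^-1 *: (J x - J c)) = u - dot x u *: x.
    rewrite /hproj scalerA mulrAC mulfV // mul1r.
    by apply/rowP => i; rewrite !mxE; ring.
  rewrite !(dotC (J (hproj u))) !Jdot -/T.
  move: (hproj u) => H; rewrite !(JD, JZ, JN) !JJ.
  by apply/rowP => i; rewrite !mxE; ring.
have dJc u : dot (J c) (hproj u) = dot (J c) u + dot c c * dot (J x) u.
  by rewrite /hproj !(dotDr, dotNr, dotZr) JcJc Jcx JcJx; ring.
have cT : dot c T = 0 by rewrite dotZr dotBr cJx cJc; ring.
have cNW : dot c NW = n1 * cW.
  rewrite !(dotDr, dotZr) cJc cc -/cW /n1 /nuh /nu0 /e1.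
  by field; exact: f1.
have xNW : dot x NW = 0.
  by rewrite !(dotDr, dotZr) xW (dotC x c) cx (dotC x (J c)) Jcx; ring.
have JxNW : dot (J x) NW = 0.
  by rewrite !(dotDr, dotZr) JxW JxJc (dotC _ c) cJx; ring.
have HJc : hproj (J c) = J c.
  by apply: hproj_id; rewrite // dotC Jcx.
have dJJ y z : dot (J y) (J z) = dot y z by rewrite Jdot JJ dotNl opprK.
move: hproj ltrace_hproj ltrace_J_hproj hproj_linear dot_c_hproj dJc HJc
  => H tH tJH lH cH JcH HJc.
rewrite !(ltraceD, ltraceN, ltraceZ) tH tJH ltrace_id !ltrace_dot_id.
rewrite !(ltrace_dot _ _ lH) !cH !JcH xx.
rewrite [dot c (W + _)]dotDr dotZr cT cNW cJc cc HJc JxJc !dJJ cNW xNW xW Js cc.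
rewrite (dotC (J x) c) cJx (dotC NW) cNW (dotC W) -/cW /curvature_slope /e1 /n1 /nuh.
by field; exact: f1.
Qed.

End TraceCurvature.

(** * The Ricci spectrum *)

Section Eigenvalues.

Lemma roots_finite (F : idomainType) (p : {poly F}) : p != 0 ->
  exists s : seq F, forall a, root p a -> a \in s.
Proof.
have [n] := ubnP (size p); elim: n p => // n IH p sp p0.
have [[a ra]|nr] := pselect (exists a, root p a); last first.
  by exists [::] => a ra; case: nr; exists a.
have /factor_theorem [q pE] := ra.
have q0 : q != 0 by apply: contra p0 => /eqP q0; rewrite pE q0 mul0r.
have [|s Hs] := IH q _ q0.
  by move: sp; rewrite pE size_Mmonic ?monicXsubC // size_XsubC addn2.
exists (a :: s) => b; rewrite pE rootM root_XsubC inE => /orP[/Hs ->|->//].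
by rewrite orbT.
Qed.

(** Eigenvalues relative to a metric are those of a pencil; inverting [G] turns them into roots of a
    characteristic polynomial. *)
Lemma pencil_eigenvalues_finite (F : fieldType) n (A G : 'M[F]_n) :
  G \in unitmx ->
  exists s : seq F, forall a (w : 'rV[F]_n), w != 0 ->
    w *m A = a *: (w *m G) -> a \in s.
Proof.
move=> uG; have cp : char_poly (A *m invmx G) != 0.
  by rewrite monic_neq0 // char_poly_monic.
have [s Hs] := roots_finite cp; exists s => a w w0 E; apply: Hs.
rewrite -eigenvalue_root_char; apply/eigenvalueP; exists w => //.
by rewrite mulmxA E -scalemxAl mulmxK.
Qed.

Lemma scalar_linear_sum (R : realType) m (F : 'rV[R]_m -> R) n (a : 'I_n -> R)
    (v : 'I_n -> 'rV[R]_m) :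
  (forall b u w, F (b *: u + w) = b * F u + F w) ->
  F (\sum_i a i *: v i) = \sum_i a i * F (v i).
Proof.
move=> lF; have F0 : F 0 = 0.
  by have /eqP := lF (-1) 0 0; rewrite scaler0 addr0 mulN1r addNr => /eqP.
apply: (big_ind2 (fun x y => F x = y)) => // [x1 y1 x2 y2 <- <-|i _].
  by have := lF 1 x1 x2; rewrite scale1r mul1r.
by have := lF (a i) (v i) 0; rewrite F0 !addr0.
Qed.

(** [L'] is given as a one-sided inverse; in finite dimension it is two-sided, so [F] and [G] are
    conjugate. *)
Lemma ltrace_conj (R : realType) m (F G L L' : 'rV[R]_m.+1 -> 'rV[R]_m.+1) :
  linear F -> linear G -> linear L -> linear L' ->
  (forall u, L' (L u) = u) -> (forall u, G (L u) = L (F u)) ->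
  ltrace G = ltrace F.
Proof.
have mxF (H : 'rV[R]_m.+1 -> 'rV[R]_m.+1) : linear H -> forall u, u *m lin1_mx H = H u.
  move=> lH u; pose lM := GRing.isLinear.Build _ _ _ _ _ lH.
  pose Hl : {linear 'rV[R]_m.+1 -> 'rV[R]_m.+1} := HB.pack H lM.
  exact: (mul_rV_lin1 Hl).
move=> lF lG lL lL' LK GL.
have trE (H : 'rV[R]_m.+1 -> 'rV[R]_m.+1) : ltrace H = \tr (lin1_mx H).
  by apply: eq_bigr => i _; rewrite mxE.
have e1 : lin1_mx L *m lin1_mx L' = 1%:M.
  by apply/row_matrixP => i; rewrite rowE mulmxA !mxF // LK rowE mulmx1.
have e2 : lin1_mx L *m lin1_mx G = lin1_mx F *m lin1_mx L.
  by apply/row_matrixP => i; rewrite !rowE !mulmxA !mxF.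
have e3 := mulmx1C e1.
rewrite !trE -[lin1_mx G]mul1mx -e3 -mulmxA e2 mulmxA mxtrace_mulC mulmxA.
by rewrite e1 mul1mx.
Qed.

End Eigenvalues.

(** * Ricci curvature and its invariance under isometries *)

Section Ricci.
Context {R : realType} {m : nat}.
Local Notation V := 'rV[R]_m.+1.
Local Notation S := (sphere R m).
Implicit Types (x y u v w : V) (X Y Z : V -> V).
Variable g : V -> V -> V -> R.
Hypothesis gm : riemannian_metric g.
Variable D : (V -> V) -> (V -> V) -> V -> V.
Hypothesis lc : levi_civita g D.
Local Notation K := (curvature_tensor D).

Lemma lin_comb_linear (F : 'I_m.+1 -> V) :
  linear (fun u : V => \sum_i u 0 i *: F i).
Proof.
move=> a u v; rewrite scaler_sumr -big_split; apply: eq_bigr => i _.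
by rewrite !mxE scalerDl scalerA.
Qed.

Lemma curvature_tensor_linear1 x v w : linear (fun u => K x u v w).
Proof. exact: lin_comb_linear. Qed.

Lemma curvature_tensor_linear3 x u v : linear (fun w => K x u v w).
Proof.
move=> a w w'; rewrite /curvature_tensor scaler_sumr -big_split.
apply: eq_bigr => i _ /=; rewrite scalerA (mulrC a) -scalerA -scalerDr.
congr (_ *: _); rewrite scaler_sumr -big_split.
apply: eq_bigr => j _ /=; rewrite scalerA (mulrC a) -scalerA -scalerDr.
congr (_ *: _); exact: lin_comb_linear.
Qed.

Lemma tangent_sum x (I : eqType) (r : seq I) (F : I -> V) :
  (forall i, tangent x (F i)) -> tangent x (\sum_(i <- r) F i).
Proof.
move=> tF; elim: r => [|i r IH].
  by rewrite big_nil /tangent /= dot0r.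
by rewrite big_cons; exact: tangentD.
Qed.

Lemma curvature_tensor_tangent x u v w : S x -> tangent x (K x u v w).
Proof.
move=> Sx; apply: tangent_sum => i; apply: tangentZ.
apply: tangent_sum => j; apply: tangentZ; apply: tangent_sum => k; apply: tangentZ.
have vD A B : vector_field A -> vector_field B -> vector_field (D A B).
  by move=> vA vB; exact: (lc_field lc).
have vF := @frame_vf R m.
apply: tangentB; last exact: (vf_tangent (vD _ _ (lie_bracket_vf (vF i) (vF j)) (vF k)) Sx).
by apply: tangentB; exact: (vf_tangent (vD _ _ (vF _) (vD _ _ (vF _) (vF _))) Sx).
Qed.

(** An ambient trace: x is sent to 0 and all values are tangent, so it equals the trace over the
    tangent space and no orthonormal frame has to be chosen. *)
Definition ricci x v w := ltrace (fun u => K x (tangent_field u x) v w).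

Lemma tangent_field_linear x : linear (fun u => tangent_field u x).
Proof.
move=> a u v; rewrite /tangent_field dotDr dotZr.
by apply/rowP => i; rewrite !mxE; ring.
Qed.

Lemma ricci_linear_r x v b w w' :
  ricci x v (b *: w + w') = b * ricci x v w + ricci x v w'.
Proof.
rewrite /ricci -ltraceZ -ltraceD; apply: eq_ltrace => u.
exact: curvature_tensor_linear3.
Qed.

Definition ricci_eigenvalue x (a : R) := exists w, [/\ tangent x w, w != 0 &
  forall v, tangent x v -> ricci x v w = a * g x v w].

Lemma ricci_eigenvalues_finite x : S x ->
  exists s : seq R, forall a, ricci_eigenvalue x a -> a \in s.
Proof.
move=> Sx.
have tf i : tangent x (frame i x) by exact: vf_tangent (@frame_vf R m i) Sx.
pose A := \matrix_(j < m.+1, i < m.+1) ricci x (frame i x) (frame j x).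
(* The m + 1 frame vectors are dependent and their Gram matrix is singular; the term x_i x_j
   supplies the radial direction and vanishes on tangent w. *)
pose G := \matrix_(j < m.+1, i < m.+1) (g x (frame i x) (frame j x) + x 0 i * x 0 j).
have gl b u v w : tangent x u -> tangent x v -> tangent x w ->
    g x w (b *: u + v) = b * g x w u + g x w v.
  move=> tu tv tw; have tb : tangent x (b *: u + v).
    by apply: tangentD => //; exact: tangentZ.
  rewrite (Defs.metric_sym gm Sx tw tb) (metric_linear gm b Sx tu tv tw).
  by rewrite (Defs.metric_sym gm Sx tu tw) (Defs.metric_sym gm Sx tv tw).
pose P u := tangent_field u x.
have tP u : tangent x (P u) by exact: vf_tangent (tangent_field_vf u) Sx.
have PE u : P u = \sum_i u 0 i *: frame i x.
  rewrite /P /tangent_field.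
  have -> : dot x u = \sum_i u 0 i * dot x (delta_mx 0 i).
    by apply: eq_bigr => i _; rewrite (dotC x) dot_delta mulrC.
  rewrite {1}[u]row_sum_delta scaler_suml -sumrB; apply: eq_bigr => i _.
  by rewrite /frame /tangent_field scalerBr scalerA.
have lP := tangent_field_linear x.
have gP u v : tangent x v -> g x v (P u) = \sum_i u 0 i * g x v (frame i x).
  move=> tv; rewrite [u in LHS]row_sum_delta.
  rewrite (@scalar_linear_sum R _ (fun u => g x v (P u))) //.
  by move=> b w w'; rewrite [P _]lP gl //; exact: tP.
have gPl u v : tangent x v -> g x (P u) v = \sum_i u 0 i * g x (frame i x) v.
  move=> tv; rewrite (Defs.metric_sym gm Sx (tP u) tv) (gP _ _ tv).
  by apply: eq_bigr => i _; rewrite (Defs.metric_sym gm Sx tv (tf i)).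
have GE (u v : V) : (u *m G *m v^T) 0 0 = g x (P v) (P u) + dot x u * dot x v.
  rewrite (gP _ _ (tP v)) mxE.
  under eq_bigr => j _ do rewrite !mxE.
  under eq_bigr => j _ do rewrite mulr_suml.
  rewrite exchange_big /= /dot big_distrlr /= -big_split; apply: eq_bigr => j _ /=.
  rewrite (gPl _ _ (tf j)) mulr_sumr -big_split; apply: eq_bigr => i _ /=.
  by rewrite mxE; ring.
have uG : G \in unitmx.
  rewrite -row_free_unit -kermx_eq0; apply/rowV0P => z /sub_kermxP zG.
  have := GE z z; rewrite zG mul0mx mxE => /esym/eqP.
  have [Pz|Pz] := eqVneq (P z) 0.
    rewrite Pz (metric0l gm Sx) ?add0r; last by rewrite /tangent /= dot0r.
    rewrite mulf_eq0 orbb => /eqP xz.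
    by move: Pz; rewrite /P /tangent_field xz scale0r subr0.
  have p := metric_pos gm Sx (tP z) Pz.
  by rewrite gt_eqF // ltr_pwDl // -expr2 sqr_ge0.
have [s Hs] := pencil_eigenvalues_finite A uG; exists s => a [w [tw w0 Hw]].
apply: (Hs a w w0); apply/rowP => i.
have wE : w = P w by rewrite /P (tangent_fieldE tw).
have -> : (w *m A) 0 i = ricci x (frame i x) w.
  rewrite [in RHS]wE PE (@scalar_linear_sum R _ (ricci x (frame i x))).
    by rewrite mxE; apply: eq_bigr => j _; rewrite mxE.
  exact: ricci_linear_r.
rewrite Hw // mxE mxE; congr (_ * _).
rewrite [in LHS]wE (gP _ _ (tf i)).
transitivity (\sum_j w 0 j * g x (frame i x) (frame j x) + x 0 i * dot x w).
  by rewrite tw mulr0 addr0.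
rewrite /dot mulr_sumr -big_split; apply: eq_bigr => j _ /=.
by rewrite mxE; ring.
Qed.

Section Isometry.
Variable (phi : V -> V).
Hypothesis iphi : Defs.isometry g phi.

Lemma isometry_ricci_eigenvalue x a : S x -> ricci_eigenvalue x a ->
  ricci_eigenvalue (phi x) a.
Proof.
move=> Sx [w [tw w0 Hw]].
have [/smooth_onP_rV sphi Sphi [psi [/smooth_onP_rV spsi psiP]] iso] := iphi.
have Spsi y : S y -> S (psi y) by move=> /psiP[].
have phiK y : S y -> psi (phi y) = y by move=> /psiP[].
have psiK y : S y -> phi (psi y) = y by move=> /psiP[].
have Sfx := Sphi x Sx.
have tphi u : tangent (phi x) (dS phi x u) by exact: dS_map_tangent.
have KE u v w' : tangent x u -> tangent x v -> tangent x w' ->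
    K (phi x) (dS phi x u) (dS phi x v) (dS phi x w') = dS phi x (K x u v w').
  move=> tu tv tw'.
  have vT := @tangent_field_vf R m.
  have vp u' := push_vf sphi spsi Sphi Spsi psiK (vT u').
  have E1 := curvature_tensorE gm lc (vT u) (vT v) (vT w') Sx.
  have E2 := curvature_tensorE gm lc (vp u) (vp v) (vp w') Sfx.
  have E3 := push_curvature gm lc sphi spsi Sphi Spsi phiK psiK iso (vT u) (vT v) (vT w') Sx.
  have pE u' : tangent x u' -> push phi psi (tangent_field u') (phi x) = dS phi x u'.
    by move=> tu'; rewrite (push_phi phiK _ Sx) (tangent_fieldE tu').
  move: E1 E2; rewrite (pE _ tu) (pE _ tv) (pE _ tw') (tangent_fieldE tu)
    (tangent_fieldE tv) (tangent_fieldE tw') => <- <-.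
  exact: E3.
have inj u : tangent x u -> dS psi (phi x) (dS phi x u) = u.
  by move=> tu; rewrite (dS_psi_phi sphi spsi Sphi phiK _ Sx) tangent_projE.
exists (dS phi x w); split; first exact: tphi.
  apply: contra w0 => /eqP E; rewrite -(inj w tw) E.
  by rewrite /dS derive0.
move=> v' tv'.
have [v tv <-] : exists2 v, tangent x v & dS phi x v = v'.
  exists (dS psi (phi x) v').
    by rewrite -{1}(phiK x Sx); exact: dS_map_tangent.
  by rewrite -{1}(phiK x Sx) (dS_phi_psi sphi spsi Spsi psiK _ Sfx) tangent_projE.
rewrite (iso _ _ _ Sx tv tw) -(Hw v tv).
have lphi : linear (dS phi x) by move=> b u u'; exact: dS_linear.
have lpsi : linear (dS psi (phi x)) by move=> b u u'; exact: dS_linear.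
(* [dS phi x] kills x; sending x to [phi x] as well gives an invertible ambient map that conjugates
   the two ambient traces. *)
pose L u := dS phi x u + dot x u *: phi x.
pose L' u := dS psi (phi x) u + dot (phi x) u *: x.
have ldot y z : linear (fun u : V => dot y u *: z).
  by move=> b u u'; rewrite dotDr dotZr scalerDl scalerA.
have lin_add (F F' : V -> V) : linear F -> linear F' -> linear (fun u => F u + F' u).
  by move=> lF lF' b u u'; rewrite lF lF' scalerDr addrACA.
have radial (f : V -> V) y : smS f -> S y -> dS f y y = 0.
  by move=> sf Sy; rewrite (dS_radial_rV _ sf Sy) Sy scale1r subrr /dS derive0.
have proj u : dS phi x u = dS phi x (tangent_field u x).
  by rewrite (dS_radial_rV _ sphi Sx).
apply: (@ltrace_conj R m (fun u => K x (tangent_field u x) v w)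
   (fun u => K (phi x) (tangent_field u (phi x)) (dS phi x v) (dS phi x w)) L L').
- by move=> b u u'; rewrite tangent_field_linear curvature_tensor_linear1.
- by move=> b u u'; rewrite tangent_field_linear curvature_tensor_linear1.
- exact: lin_add.
- exact: lin_add.
- move=> u; rewrite /L' /L.
  have -> : dS psi (phi x) (dS phi x u + dot x u *: phi x) =
      dS psi (phi x) (dS phi x u).
    by rewrite addrC lpsi (radial psi) // scaler0 add0r.
  rewrite (dS_psi_phi sphi spsi Sphi phiK _ Sx) dotDr dotZr Sfx (tphi u).
  by rewrite add0r mulr1 subrK.
- move=> u; rewrite /L.
  have -> : tangent_field (dS phi x u + dot x u *: phi x) (phi x) = dS phi x u.
    rewrite /tangent_field dotDr dotZr Sfx (tphi u) add0r mulr1.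
    by rewrite addrK.
  rewrite proj KE //; last exact: (vf_tangent (tangent_field_vf u) Sx).
  by rewrite (curvature_tensor_tangent _ _ _ Sx) scale0r addr0.
Qed.

End Isometry.
End Ricci.

(** * The weighted Sasakian metric on the sphere *)

Section WeightedPoint.
Context {R : realType} {m : nat}.
Local Notation V := 'rV[R]_m.+1.
Variables (J E : {linear V -> V}) (ep : R).
Hypothesis ep0 : 0 < ep.
Hypothesis JJ : forall x, J (J x) = - x.
Hypothesis Jdot : forall x y, dot x (J y) = - dot (J x) y.
Hypothesis EE : forall x, E (E x) = E x.
Hypothesis EJ : forall x, E (J x) = J (E x).
Hypothesis Edot : forall x y, dot x (E y) = dot (E x) y.
Variable x : V.
Hypothesis xx : dot x x = 1.

Local Notation f := (wf E ep x).
Local Notation c := (wc E ep x).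
Local Notation T := (reeb J E ep x).
Local Notation hr := (hor J E ep x).
Local Notation et := (eta J E ep x).

Let JD y z : J (y + z) = J y + J z. Proof. exact: raddfD. Qed.
Let JN y : J (- y) = - J y. Proof. exact: raddfN. Qed.
Let JZ a y : J (a *: y) = a *: J y. Proof. exact: linearZ. Qed.
Let ED y z : E (y + z) = E y + E z. Proof. exact: raddfD. Qed.
Let EN y : E (- y) = - E y. Proof. exact: raddfN. Qed.
Let EZ a y : E (a *: y) = a *: E y. Proof. exact: linearZ. Qed.
Let Js y : dot (J y) y = 0. Proof. exact: Jskew. Qed.
Let JEs y : dot (J (E y)) y = 0. Proof. exact: JEskew. Qed.
Let e0 : ep != 0. Proof. by rewrite gt_eqF. Qed.

Lemma wf_gt0 : 0 < f.
Proof. by rewrite invr_gt0 wsigma_gt0. Qed.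

Lemma wf_neq0 : f != 0.
Proof. by rewrite gt_eqF // wf_gt0. Qed.
Let f0 := wf_neq0.

Let kE : dot (E x) x = (f^-1 - 1) / ep.
Proof. by rewrite invrK /wsigma addrAC subrr add0r mulrAC mulfV ?mul1r. Qed.

Lemma wE_x : E x = (ep * f)^-1 *: ((1 - f) *: x - c).
Proof.
apply: (scalerI (mulf_neq0 e0 f0)); rewrite scalerA mulfV ?mulf_neq0 // scale1r /wc.
by apply/rowP => i; rewrite !mxE; ring.
Qed.

Lemma wE_wc : E c = ((ep * f)^-1 * (1 - (1 + ep) * f)) *: ((1 - f) *: x - c).
Proof.
rewrite mulrC -scalerA -wE_x /wc !(ED, EN, EZ) EE.
by apply/rowP => i; rewrite !mxE; ring.
Qed.

Lemma reeb_wc : T = f^-1 *: (J x - J c).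
Proof.
rewrite /reeb {1}wE_x !(JD, JN, JZ).
by apply/rowP => i; rewrite !mxE; field; rewrite f0 e0.
Qed.

Lemma wc_x : dot c x = 0.
Proof.
rewrite /wc !(dotDl, dotNl, dotZl) xx kE; field; by rewrite f0 e0.
Qed.

Lemma Jwc_x : dot (J c) x = 0.
Proof. by rewrite /wc !(JD, JN, JZ) !(dotDl, dotNl, dotZl) Js JEs; ring. Qed.

(** The first factor vanishes at s = 0 and the second at s = 1; these are the only zeros of c. *)
Lemma wc_wc : dot c c = (1 - f) * ((1 + ep) * f - 1).
Proof.
have cE : c = x - f *: (x + ep *: E x) by [].
rewrite [X in dot _ X]cE; have := wc_x; have := wE_wc; move: c => d dE dx.
rewrite !(dotDr, dotNr, dotZr) Edot dE !(dotDl, dotNl, dotZl) dx xx.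
by field; rewrite f0 e0.
Qed.

Let Tdec (U : V) a : U + a *: T = U + a *: (f^-1 *: (J x - J c)).
Proof. by rewrite reeb_wc. Qed.

Let JxJx : dot (J x) (J x) = 1.
Proof. by rewrite Jdot JJ dotNl opprK. Qed.
Let JxJc : dot (J x) (J c) = 0.
Proof. by rewrite Jdot JJ dotNl opprK dotC wc_x. Qed.
Let xJx : dot x (J x) = 0. Proof. by rewrite dotC Js. Qed.
Let xJc : dot x (J c) = 0. Proof. by rewrite dotC Jwc_x. Qed.

Lemma eta_dec (U : V) a : dot (J x) U = 0 -> et (U + a *: T) = a.
Proof.
move=> JU; rewrite /eta Tdec !(dotDr, dotZr, dotNr) JU JxJx JxJc.
by field; exact: f0.
Qed.

Lemma hor_dec (U : V) a : dot (J x) U = 0 -> hr (U + a *: T) = U.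
Proof. by move=> JU; rewrite /hor (eta_dec _ JU) addrK. Qed.

Lemma eta_hor0 (U : V) : dot (J x) U = 0 -> et U = 0.
Proof. by move=> JU; rewrite /eta JU mulr0. Qed.

Lemma hor_id (U : V) : dot (J x) U = 0 -> hr U = U.
Proof. by move=> JU; rewrite /hor (eta_hor0 JU) scale0r subr0. Qed.

Lemma hor_eta u : u = hr u + et u *: T.
Proof. by rewrite /hor subrK. Qed.

Lemma x_reeb : dot x T = 0.
Proof. by rewrite reeb_wc dotZr dotDr dotNr xJx xJc subr0 mulr0. Qed.

Lemma hor_x u : dot x u = 0 -> dot x (hr u) = 0.
Proof. by move=> xu; rewrite /hor dotDr dotNr dotZr xu x_reeb; ring. Qed.

Lemma hor_Jx u : dot (J x) (hr u) = 0.
Proof.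
rewrite /hor dotDr dotNr dotZr reeb_wc dotZr dotDr dotNr JxJx JxJc /eta.
by field; exact: f0.
Qed.

Lemma wc_reeb : dot c T = 0.
Proof.
rewrite reeb_wc dotZr dotDr dotNr !(Jdot c) Js Jwc_x; ring.
Qed.

Lemma Jx_wc : dot (J x) c = 0.
Proof. by rewrite dotC Jdot Jwc_x oppr0. Qed.

(** Together with [dwfE] this identifies c as half the gradient of f for the weighted metric. *)
Lemma wmetric_wc u : dot x u = 0 -> wmetric J E ep x u c = f * dot c u.
Proof.
move=> xu; rewrite /wmetric (eta_hor0 Jx_wc) (hor_id Jx_wc) mulr0 add0r.
by rewrite dotC /hor dotDr dotNr dotZr wc_reeb mulr0 oppr0 addr0.
Qed.

(** The endomorphism v |-> D_v c; [dwQ] is its derivative at a fixed vector v. *)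
Definition wQ v : V := Qh J E ep x c f (hr v) (et v).
Definition dwQ u v : V := dQh J E ep x c f (hr u) (et u) (hr v) (et v).

Lemma chrhE u v : chr J E ep x u v = chrh J E ep x c (hr u) (et u) (hr v) (et v).
Proof. by []. Qed.

Section Tangent.
Variables (u v w : V).
Hypotheses (xu : dot x u = 0) (xv : dot x v = 0) (xw : dot x w = 0).

Lemma dot_Ex : dot (E x) u = - ((ep * f)^-1 * dot c (hr u)).
Proof.
have H (U S C : V) a : dot x U = 0 -> dot x S = 0 -> dot C S = 0 ->
    dot ((ep * f)^-1 *: ((1 - f) *: x - C)) (U + a *: S) = - ((ep * f)^-1 * dot C U).
  move=> xU xS CS; rewrite !(dotZl, dotDl, dotNl, dotDr, dotZr) xU xS CS; ring.
by rewrite wE_x {1}[u]hor_eta; exact: (H _ _ _ _ (hor_x xu) x_reeb wc_reeb).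
Qed.

Lemma dwfE : dwf E ep x u = 2 * f * dot c (hr u).
Proof. by rewrite /dwf dot_Ex; field; rewrite f0 e0. Qed.

Lemma dwcE : dwc E ep x u = dch J E ep x c f (hr u) (et u).
Proof. by rewrite /dwc /dch -reeb_wc -hor_eta dwfE. Qed.

Lemma dot_Juv : f * dot (J u) v =
  f * dot (J (hr u)) (hr v) - et v * dot c (hr u) + et u * dot c (hr v).
Proof.
have H (U W S C : V) a b : dot x U = 0 -> dot x W = 0 -> J S = f^-1 *: (C - x) ->
    f * dot (J (U + a *: S)) (W + b *: S) =
    f * dot (J U) W - b * dot C U + a * dot C W.
  move=> xU xW JS; rewrite !(JD, JZ) !(dotDl, dotDr, dotZl, dotZr) Js.
  have -> : dot (J U) S = - dot U (J S) by rewrite Jdot opprK.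
  rewrite JS !(dotZl, dotZr, dotDl, dotDr, dotNl, dotNr) xW.
  by rewrite (dotC _ C) (dotC _ x) xU; field; exact: f0.
have JT : J T = f^-1 *: (c - x) by rewrite reeb_wc; move: c => C; rewrite JZ JD JN !JJ opprK addrC.
rewrite {1}[u]hor_eta {1}[v]hor_eta; exact: (H _ _ _ _ _ _ (hor_x xu) (hor_x xv) JT).
Qed.

Lemma detaE : deta J E ep x u v = detah J c f (hr u) (et u) (hr v) (et v).
Proof.
rewrite /deta /detah dwfE dot_Juv.
have -> : 2 * f * dot c (hr u) * dot (J x) v = 2 * dot c (hr u) * et v.
  by rewrite /eta; ring.
ring.
Qed.

Lemma dhorE : dhor J E ep x u v = dhorh J E ep x c f (hr u) (et u) (hr v) (et v).
Proof. by rewrite /dhor /dhorh detaE -reeb_wc -hor_eta. Qed.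

End Tangent.

Lemma chr_x u v : dot x u = 0 -> dot x v = 0 ->
  dot x (chr J E ep x u v) = dot u v.
Proof.
move=> xu xv; rewrite chrhE.
rewrite (chrh_x JJ Jdot EJ Edot f0 e0 xx wc_x wc_wc wE_x _ _ (hor_x xu) (hor_Jx u)
  (hor_x xv) (hor_Jx v)).
by rewrite -!reeb_wc -!hor_eta.
Qed.

Lemma chr_metric u v w : dot x u = 0 -> dot x v = 0 -> dot x w = 0 ->
  dwmetric J E ep x u v w =
  wmetric J E ep x (chr J E ep x u v) w + wmetric J E ep x v (chr J E ep x u w).
Proof.
move=> xu xv xw; have H := chrh_metric JJ Jdot EE EJ Edot f0 e0 Jwc_x wE_x wE_wc
  (et u) (et v) (et w) (hor_x xu) (hor_Jx u) (hor_x xv) (hor_Jx v) (hor_x xw) (hor_Jx w).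
rewrite -reeb_wc in H.
rewrite /dwmetric (detaE xu xv) (detaE xu xw) (dwfE xu) (dhorE xu xv) (dhorE xu xw).
exact: H.
Qed.

Lemma chr_sasakian u v : dot x u = 0 -> dot x v = 0 ->
  J (dhor J E ep x u v) + chr J E ep x u (J (hr v)) - J (hr (chr J E ep x u v)) =
  et v *: u - wmetric J E ep x u v *: T.
Proof.
move=> xu xv; have H := chrh_sasakian JJ Jdot EE EJ Edot f0 e0 Jwc_x wE_x wE_wc
  (et u) (et v) (hor_x xu) (hor_Jx u) (hor_x xv) (hor_Jx v).
rewrite -reeb_wc -hor_eta in H.
have JhJ : dot (J x) (J (hr v)) = 0 by rewrite Jdot JJ dotNl opprK hor_x.
rewrite (dhorE xu xv) [chr J E ep x u (J _)]chrhE (hor_id JhJ) (eta_hor0 JhJ).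
exact: H.
Qed.

(** [reeb] is linear, so [reeb u] is the flat derivative of T and the left-hand side is D_u T. *)
Lemma chr_reeb u : dot x u = 0 ->
  reeb J E ep u + chr J E ep x u T = J (hr u).
Proof.
move=> xu; have t1 : et T = 1 by have := eta_dec 1 (dot0r (J x)); rewrite add0r scale1r.
have t0 : hr T = 0 by rewrite /hor t1 scale1r subrr.
have z : 1 *: hr u + et u *: (0 : V) = hr u by rewrite scale1r scaler0 addr0.
rewrite chrhE t1 t0 /chrh z !dot0r (raddf0 J).
have H (U S : V) a : S = J x + ep *: J (E x) ->
    reeb J E ep (U + a *: S) =
    J U + ep *: J (E U) - a *: (x + (2 * ep + ep ^+ 2) *: E x).
  move=> ->; rewrite /reeb !(JD, ED, JZ, EZ, JJ, EJ, EE).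
  by apply/rowP => i; rewrite !mxE; ring.
have -> : reeb J E ep u = J (hr u) + ep *: J (E (hr u))
    - et u *: (x + (2 * ep + ep ^+ 2) *: E x).
  by rewrite [in LHS](hor_eta u); exact: H.
move: (hr u) => U.
by apply/rowP => i; rewrite !mxE; ring.
Qed.

Lemma chr_wc v : dot x v = 0 -> dwc E ep x v + chr J E ep x v c = wQ v.
Proof.
move=> xv; rewrite (dwcE xv) chrhE (hor_id Jx_wc) (eta_hor0 Jx_wc).
exact: (Qh_chr Jdot EJ f0 e0 wc_wc wE_x wE_wc).
Qed.

Lemma wQ_split v : wQ v = Qhor J E ep x c f (hr v) (et v) + (f * dot (J c) (hr v)) *: T.
Proof.
rewrite /wQ /Qh /Qhor /Eh reeb_wc.
by apply/rowP => i; rewrite !mxE; field; exact: f0.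
Qed.

Lemma Jx_Qhor v : dot x v = 0 ->
  dot (J x) (Qhor J E ep x c f (hr v) (et v)) = 0.
Proof.
move=> xv; have hx := hor_x xv; have hJ := hor_Jx v.
move: (hr v) (et v) hx hJ => U b hx hJ.
have H1 := JxJc; have H2 := Jx_wc; have H3 := wE_x; move: c H1 H2 H3 => C H1 H2 H3.
have EU : dot (J x) (E U) = - ((ep * f)^-1 * dot (J C) U).
  by rewrite Edot EJ H3 !(JD, JN, JZ) !(dotDl, dotNl, dotZl) hJ; ring.
rewrite /Qhor /Eh !(dotDr, dotNr, dotZr) EU hJ H1 H2 JxJx Js.
by field; rewrite f0 e0.
Qed.

Section Rank1.
Hypothesis rank1 : forall y, dot (E x) x *: E y =
  dot (E x) y *: E x + dot (J (E x)) y *: J (E x).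
Hypothesis f1 : 1 - f != 0.

(** The rank-one identity is divided by s = <E x, x>, nonzero because f differs from 1, and E x is
    expressed through x and c. *)
Lemma rank1_wc A : dot x A = 0 -> dot (J x) A = 0 -> E A =
  (ep * f)^-1 *: ((dot c A / (1 - f)) *: c + (dot (J c) A / (1 - f)) *: J c
    - dot c A *: x - dot (J c) A *: J x).
Proof.
move=> xA JxA; have k0 : dot (E x) x != 0.
  rewrite kE (_ : f^-1 - 1 = f^-1 * (1 - f)); last by field; exact: f0.
  exact: (mulf_neq0 (mulf_neq0 (invr_neq0 f0) f1) (invr_neq0 e0)).
apply: (scalerI k0); rewrite rank1 kE wE_x; move: c => C.
rewrite !(JZ, JD, JN) !(dotZl, dotDl, dotNl) xA JxA.
by apply/rowP => i; rewrite !mxE; field; rewrite f0 e0 f1.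
Qed.

(** Hence [Eh] has complex rank one along c, and c is an eigenvector for <c, c> / (1 - f) = (1 + ep)
    f - 1; this is the source of [nuh]. *)
Lemma Eh_wc A : dot x A = 0 -> dot (J x) A = 0 ->
  Eh J E ep x c f A = (1 - f)^-1 *: (dot c A *: c + dot (J c) A *: J c).
Proof.
move=> xA JxA; rewrite /Eh (rank1_wc xA JxA); move: c => C.
by apply/rowP => i; rewrite !mxE; field; rewrite f0 e0 f1.
Qed.

Lemma curvature_wc u v : dot x u = 0 -> dot x v = 0 ->
  dwQ u v - dwQ v u + chr J E ep x u (wQ v) - chr J E ep x v (wQ u) =
  curvh J E ep x c f (hr u) (et u) (hr v) (et v).
Proof.
move=> xu xv.
have H := curvh_eq JJ Jdot EE EJ Edot f0 e0 wc_x Jwc_x wc_wc wE_x wE_wc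
  (et u) (et v) (hor_x xu) (hor_Jx u) (hor_x xv) (hor_Jx v) f1
  (rank1_wc (hor_x xu) (hor_Jx u)) (rank1_wc (hor_x xv) (hor_Jx v)).
rewrite !chrhE (wQ_split v) (wQ_split u).
rewrite (eta_dec _ (Jx_Qhor xv)) (hor_dec _ (Jx_Qhor xv)).
rewrite (eta_dec _ (Jx_Qhor xu)) (hor_dec _ (Jx_Qhor xu)).
exact: H.
Qed.

Lemma ltrace_curvature_wc v : dot x v = 0 ->
  ltrace (fun u => curvh J E ep x c f (hr (u - dot x u *: x)) (et (u - dot x u *: x))
    (hr v) (et v)) = @curvature_slope R m ep f * wmetric J E ep x v c.
Proof.
move=> xv; rewrite (wmetric_wc xv).
have -> : dot c v = dot c (hr v).
  by rewrite {1}[v]hor_eta dotDr dotZr wc_reeb mulr0 addr0.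
rewrite -(ltrace_curvh JJ Jdot f0 f1 xx wc_x Jwc_x wc_wc Eh_wc (et v) (hor_x xv) (hor_Jx v)).
apply: eq_ltrace => u.
have E1 : et (u - dot x u *: x) = f * dot (J x) u.
  by rewrite /eta dotDr dotNr dotZr Js mulr0 subr0.
have E2 : hr (u - dot x u *: x) = hproj J x c u.
  by rewrite /hor E1 reeb_wc /hproj scalerA mulrAC mulfV // mul1r.
by rewrite E1 E2.
Qed.

End Rank1.
End WeightedPoint.

(** * Derivatives of the weighted tensors along the sphere *)

Section SphereDerivation.
Context {R : realType} {m : nat}.
Local Notation V := 'rV[R]_m.+1.
Local Notation S := (sphere R m).
Variables (x u : V).
Hypothesis Sx : S x.

(** Smoothness and the value of the derivative travel together: a long formula is differentiated by
    composing one rule per operation, and the result is compared once. *)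
Definition ddS (W : normedModType R) (F : V -> W) d := smS F /\ dS F x u = d.

Lemma ddS_eq (W : normedModType R) (F : V -> W) d d' : ddS F d -> d = d' -> ddS F d'.
Proof. by move=> [sF <-] <-; split. Qed.

Lemma ddS_self (W : normedModType R) (F : V -> W) : smS F -> ddS F (dS F x u).
Proof. by []. Qed.

Lemma ddS_cst (W : normedModType R) (a : W) : ddS (fun _ => a) 0.
Proof. by split; [exact: smS_cst|exact: dS_cst]. Qed.

Lemma ddSD (W : normedModType R) (F G : V -> W) d e : ddS F d -> ddS G e ->
  ddS (fun y => F y + G y) (d + e).
Proof. by move=> [sF <-] [sG <-]; split; [exact: smSD|exact: dSD]. Qed.

Lemma ddSM (F G : V -> R) d e : ddS F d -> ddS G e ->
  ddS (fun y => F y * G y) (d * G x + F x * e).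
Proof. by move=> [sF <-] [sG <-]; split; [exact: smSM|exact: dSM]. Qed.

Lemma ddSZ p (F : V -> R) (X : V -> 'rV[R]_p) d e : ddS F d -> ddS X e ->
  ddS (fun y => F y *: X y) (d *: X x + F x *: e).
Proof. by move=> [sF <-] [sG <-]; split; [exact: smSZ|exact: dSZ]. Qed.

Lemma ddSN (F : V -> R) d : ddS F d -> ddS (fun y => - F y) (- d).
Proof. by move=> [sF <-]; split; [exact: smSN|exact: dSN]. Qed.

Lemma ddSNv p (F : V -> 'rV[R]_p) d : ddS F d -> ddS (fun y => - F y) (- d).
Proof. by move=> [sF <-]; split; [exact: smSNv|exact: dSNv]. Qed.

Lemma ddS_dot p (X Y : V -> 'rV[R]_p) d e : ddS X d -> ddS Y e ->
  ddS (fun y => dot (X y) (Y y)) (dot d (Y x) + dot (X x) e).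
Proof. by move=> [sF <-] [sG <-]; split; [exact: smS_dot|exact: dS_dot]. Qed.

Lemma ddS_inv (F : V -> R) d : (forall y, S y -> F y != 0) -> ddS F d ->
  ddS (fun y => (F y)^-1) (- (d / F x ^+ 2)).
Proof. by move=> F0 [sF <-]; split; [exact: smSV|exact: dSV]. Qed.

Lemma ddS_lin (L : {linear V -> V}) (X : V -> V) d : ddS X d ->
  ddS (fun y => L (X y)) (L d).
Proof.
move=> [sX <-]; rewrite /ddS.
have -> : (fun y => L (X y)) = (fun y => X y *m lin1_mx L).
  by apply/funext => y; rewrite mul_rV_lin1.
by split; [exact: smS_lin|rewrite (dS_lin _ _ sX Sx) mul_rV_lin1].
Qed.

Lemma ddS_id : tangent x u -> ddS (fun y => y) u.
Proof. by move=> tu; split; [exact: smS_id|exact: dS_id_tangent]. Qed.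

End SphereDerivation.

Section WeightedSphere.
Context {R : realType} {m : nat}.
Local Notation V := 'rV[R]_m.+1.
Local Notation S := (sphere R m).
Variables (J E : {linear V -> V}) (ep : R).
Hypothesis ep0 : 0 < ep.
Hypothesis JJ : forall x, J (J x) = - x.
Hypothesis Jdot : forall x y, dot x (J y) = - dot (J x) y.
Hypothesis EE : forall x, E (E x) = E x.
Hypothesis EJ : forall x, E (J x) = J (E x).
Hypothesis Edot : forall x y, dot x (E y) = dot (E x) y.
Implicit Types (x y u v w : V) (X Y Z : V -> V).

Local Notation f := (wf E ep).
Local Notation c := (wc E ep).
Local Notation T := (reeb J E ep).
Local Notation hr := (hor J E ep).
Local Notation et := (eta J E ep).
Local Notation B := (chr J E ep).
Local Notation g := (wmetric J E ep).

Let ED y z : E (y + z) = E y + E z. Proof. exact: raddfD. Qed.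

Section Derivatives.
Variables (x u : V).
Hypotheses (Sx : S x) (tu : tangent x u).
Local Notation ddS := (@ddS R m x u).

Let did := ddS_id Sx tu.

Lemma ddS_wf : ddS f (dwf E ep x u).
Proof.
have s0 y : S y -> 1 + ep * dot (E y) y != 0.
  by move=> _; exact: (wsigma_neq0 ep0 EE Edot).
apply: ddS_eq.
  apply: (ddS_inv Sx s0); apply: ddSD => //; first exact: ddS_cst.
  apply: ddSM => //; first exact: ddS_cst.
  exact: (ddS_dot Sx (ddS_lin Sx E did) did).
rewrite /dwf /wf /wsigma (dotC (E u)) Edot mul0r !add0r.
by rewrite exprVn; ring.
Qed.

Lemma ddS_reeb : ddS T (T u).
Proof.
apply: ddSD => //; first exact: (ddS_lin Sx J did).
apply: ddS_eq.
  apply: ddSZ => //; first exact: ddS_cst.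
  by apply: (ddS_lin Sx J (X := E)); exact: (ddS_lin Sx E did).
by rewrite scale0r add0r.
Qed.

Section Fields.
Variables (Y Z : V -> V).
Hypotheses (sY : smS Y) (sZ : smS Z).
Local Notation v' := (dS Y x u).
Local Notation w' := (dS Z x u).

Lemma ddS_eta : ddS (fun y => et y (Y y)) (deta J E ep x u (Y x) + et x v').
Proof.
apply: ddS_eq.
  apply: ddSM => //; first exact: ddS_wf.
  exact: (ddS_dot Sx (ddS_lin Sx J did) (ddS_self _ _ sY)).
by rewrite /deta /eta; ring.
Qed.

Lemma ddS_hor : ddS (fun y => hr y (Y y)) (dhor J E ep x u (Y x) + hr x v').
Proof.
apply: ddS_eq.
  exact: (ddSD Sx (ddS_self _ _ sY) (ddSNv Sx (ddSZ Sx ddS_eta ddS_reeb))).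
rewrite /dhor /hor; apply/rowP => i; rewrite !mxE; ring.
Qed.

End Fields.

Lemma ddS_wmetric Y Z : smS Y -> smS Z ->
  ddS (fun y => g y (Y y) (Z y)) (dwmetric J E ep x u (Y x) (Z x)
    + (g x (dS Y x u) (Z x) + g x (Y x) (dS Z x u))).
Proof.
move=> sY sZ; have hY := ddS_hor sY; have hZ := ddS_hor sZ.
have eY := ddS_eta sY; have eZ := ddS_eta sZ.
apply: ddS_eq.
  exact: (ddSD Sx (ddSM Sx eY eZ) (ddSM Sx ddS_wf (ddS_dot Sx hY hZ))).
rewrite /dwmetric /wmetric.
move: (hr x (Y x)) (hr x (Z x)) (hr x (dS Y x u)) (hr x (dS Z x u))
  (dhor J E ep x u (Y x)) (dhor J E ep x u (Z x)) => a b a' b' p q.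
by rewrite !(dotDl, dotDr); ring.
Qed.

Lemma ddS_wc : ddS c (dwc E ep x u).
Proof.
have ec := ddS_cst x u ep.
have eE := ddS_lin Sx E did.
have H := ddSD Sx did (ddSNv Sx (ddSZ Sx ddS_wf (ddSD Sx did (ddSZ Sx ec eE)))).
apply: (ddS_eq H); rewrite /dwc.
by apply/rowP => i; rewrite !mxE; ring.
Qed.

Lemma ddS_wQ Y : smS Y -> tangent x (Y x) ->
  ddS (fun y => wQ J E ep y (Y y)) (dwQ J E ep x u (Y x) + wQ J E ep x (dS Y x u)).
Proof.
move=> sY tY; have hY := ddS_hor sY; have eY := ddS_eta sY.
have F := ddS_wf; have C := ddS_wc; have JC := ddS_lin Sx J C.
have EH := ddS_lin Sx E hY; have k a := ddS_cst x u (a : R).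
have H1 := ddSZ Sx (ddSM Sx (ddSM Sx (k (1 + ep)) F) (ddSD Sx (k 1) (ddSN Sx F))) hY.
have H2 := ddSNv Sx (ddSZ Sx (ddSM Sx (k ep) F) EH).
have H3 := ddSNv Sx (ddSZ Sx (ddS_dot Sx C hY) did).
have H4 := ddSZ Sx (ddSM Sx (k 2) (ddS_dot Sx C hY)) C.
have H5 := ddSZ Sx (ddS_dot Sx JC hY) JC.
have H6 := ddSZ Sx eY JC.
have H := ddSD Sx (ddSD Sx (ddSD Sx (ddSD Sx (ddSD Sx H1 H2) H3) H4) H5) H6.
have e1 : 2 * f x * dot (c x) (hr x u) = dwf E ep x u.
  by rewrite (dwfE ep0 Jdot EE EJ Edot tu).
have e2 := dhorE ep0 JJ Jdot EE EJ Edot tu tY.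
have e3 := dwcE ep0 Jdot EE EJ Edot tu.
have e4 := detaE ep0 JJ Jdot EE EJ Edot tu tY.
have e5 : hr x u + et x u *: ((f x)^-1 *: (J x - J (c x))) = u.
  by rewrite -(reeb_wc J ep0 EE Edot) -hor_eta.
apply: (ddS_eq H); rewrite /wQ /dwQ /Qh /dQh /=.
rewrite e1 -e2 -e3 -e4 e5.
move: (hr x (Y x)) (hr x (dS Y x u)) (dhor J E ep x u (Y x)) (dwc E ep x u) (c x)
  (deta J E ep x u (Y x)) => a b p q d e.
by rewrite !(ED, dotDr); apply/rowP => i; rewrite !mxE; ring.
Qed.

End Derivatives.

End WeightedSphere.

(** * The Levi-Civita connection of the weighted metric and the Sasakian equation *)

Section WeightedConnection.
Context {R : realType} {m : nat}.
Local Notation V := 'rV[R]_m.+1.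
Local Notation S := (sphere R m).
Variables (J E : {linear V -> V}) (ep : R).
Hypothesis ep0 : 0 < ep.
Hypothesis JJ : forall x, J (J x) = - x.
Hypothesis Jdot : forall x y, dot x (J y) = - dot (J x) y.
Hypothesis EE : forall x, E (E x) = E x.
Hypothesis EJ : forall x, E (J x) = J (E x).
Hypothesis Edot : forall x y, dot x (E y) = dot (E x) y.
Implicit Types (x y u v w : V) (X Y Z : V -> V).

Local Notation f := (wf E ep).
Local Notation c := (wc E ep).
Local Notation T := (reeb J E ep).
Local Notation hr := (hor J E ep).
Local Notation et := (eta J E ep).
Local Notation B := (chr J E ep).
Local Notation g := (wmetric J E ep).

Let JD y z : J (y + z) = J y + J z. Proof. exact: raddfD. Qed.
Let JZ a y : J (a *: y) = a *: J y. Proof. exact: linearZ. Qed.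
Let ED y z : E (y + z) = E y + E z. Proof. exact: raddfD. Qed.
Let EZ a y : E (a *: y) = a *: E y. Proof. exact: linearZ. Qed.

(** A [ddS] statement asks for a point and a tangent vector; any choice serves to extract its
    smoothness component. *)
Let Sb : S (delta_mx 0 0).
Proof. by rewrite /sphere /= dot_delta mxE !eqxx. Qed.
Let tb : tangent (delta_mx 0 0 : V) 0.
Proof. exact: dot0r. Qed.

Lemma smS_map (L : {linear V -> V}) X : smS X -> smS (fun y => L (X y)).
Proof. by move=> sX; exact: (ddS_lin Sb L (ddS_self _ 0 sX)).1. Qed.

Lemma smS_reeb : smS T. Proof. exact: (ddS_reeb J E ep Sb tb).1. Qed.
Lemma smS_eta Y : smS Y -> smS (fun y => et y (Y y)).
Proof. by move=> sY; exact: (ddS_eta J ep0 EE Edot Sb tb sY).1. Qed.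
Lemma smS_hor Y : smS Y -> smS (fun y => hr y (Y y)).
Proof. by move=> sY; exact: (ddS_hor J ep0 EE Edot Sb tb sY).1. Qed.
Lemma smS_wmetric Y Z : smS Y -> smS Z -> smS (fun y => g y (Y y) (Z y)).
Proof. by move=> sY sZ; exact: (ddS_wmetric J ep0 EE Edot Sb tb sY sZ).1. Qed.
Lemma smS_wc : smS c. Proof. exact: (ddS_wc ep0 EE Edot Sb tb).1. Qed.

Lemma smS_chr X Y : smS X -> smS Y -> smS (fun y => B y (X y) (Y y)).
Proof.
move=> sX sY; have hX := smS_hor sX; have hY := smS_hor sY.
have eX := smS_eta sX; have eY := smS_eta sY; have C := smS_wc.
have JC := smS_map J C; have I := @smS_id R m; have k (a : R) := smS_cst (m := m) a.
have hh := smS_dot hX hY.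
have H1 := smSZ hh I.
have H2 := smSZ (smS_dot C hX) hY.
have H3 := smSZ (smS_dot C hY) hX.
have H4 := smSNv (smSZ hh C).
have H5 := smSZ (smS_dot JC hY) (smS_map J hX).
have H6 := smSZ (smS_dot JC hX) (smS_map J hY).
have H7 := smSNv (smSZ (k ep) (smS_map J (smS_map E (smSD (smSZ eY hX) (smSZ eX hY))))).
have H8 := smSZ (smSM eX eY) (smSD I (smSZ (k (2 * ep + ep ^+ 2)) (smS_map E I))).
exact: (smSD (smSD (smSD (smSD (smSD (smSD (smSD H1 H2) H3) H4) H5) H6) H7) H8).
Qed.

Lemma eta_lin x a u v : et x (a *: u + v) = a * et x u + et x v.
Proof. by rewrite /eta dotDr dotZr; ring. Qed.

Lemma hor_lin x a u v : hr x (a *: u + v) = a *: hr x u + hr x v.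
Proof. by rewrite /hor eta_lin; apply/rowP => i; rewrite !mxE; ring. Qed.

(** Gives torsion-freeness of [wconn], since the flat derivatives already differ by the bracket. *)
Lemma chrC x u v : B x u v = B x v u.
Proof.
rewrite /chr (dotC (hr x v)) (addrC (et x v *: _)) (mulrC (et x v)).
by move: (J (E _)) => z; apply/rowP => i; rewrite !mxE; ring.
Qed.

Lemma chr_lin x a u v w : B x (a *: u + v) w = a *: B x u w + B x v w.
Proof.
rewrite /chr hor_lin eta_lin.
move: (hr x u) (hr x v) (hr x w) (et x u) (et x v) (et x w) (c x) => p q r b b' b'' d.
rewrite !(dotDl, dotDr, dotZl, dotZr, JD, JZ, ED, EZ).
by apply/rowP => i; rewrite !mxE; ring.
Qed.

Definition wconn X Y x := dS Y x (X x) + B x (X x) (Y x).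

Lemma wmetric_riemannian : riemannian_metric g.
Proof.
split.
- move=> x a u v w _ _ _ _; rewrite /wmetric hor_lin eta_lin.
  move: (hr x u) (hr x v) (hr x w) => p q r.
  by rewrite dotDl dotZl; ring.
- by move=> x u v _ _ _; rewrite /wmetric dotC mulrC.
- move=> x u _ _ u0; have fx : 0 < f x by exact: (wf_gt0 ep0 EE Edot).
  rewrite /wmetric -expr2.
  have [e0|e0] := eqVneq (et x u) 0.
    rewrite e0 expr0n /= add0r mulr_gt0 // dot_gt0 //.
    by rewrite /hor e0 scale0r subr0.
  by rewrite ltr_pwDl ?mulr_ge0 ?dot_ge0 // ?exprn_even_gt0 // ltW.
- move=> X Y /vector_fieldP[sX _] /vector_fieldP[sY _].
  by apply: smooth_funP; exact: smS_wmetric.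
Qed.

Lemma wconn_tangent X Y x : vector_field X -> vector_field Y -> S x ->
  tangent x (wconn X Y x).
Proof.
move=> vX vY Sx; have tX := vf_tangent vX Sx; have tY := vf_tangent vY Sx.
have H : dS (fun y => dot y (Y y)) x (X x) = 0.
  rewrite (@eq_dS _ _ _ _ (fun _ => 0 : R)) ?dS_cst // => y Sy.
  exact: (vf_tangent vY Sy).
rewrite (dS_dot _ (@smS_id R m) (vf_smS vY) Sx) (dS_id_tangent Sx tX) in H.
rewrite /tangent /= /wconn dotDr.
by rewrite (chr_x ep0 JJ Jdot EE EJ Edot Sx tX tY) addrC.
Qed.

Lemma wconn_vf X Y : vector_field X -> vector_field Y -> vector_field (wconn X Y).
Proof.
move=> vX vY; apply/vector_fieldP; split=> [|x Sx]; last exact: wconn_tangent.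
have sX := vf_smS vX; have sY := vf_smS vY.
exact: (smSD (smS_dS_rV sY sX) (smS_chr sX sY)).
Qed.

Lemma wconn_levi_civita : levi_civita g wconn.
Proof.
split.
- exact: wconn_vf.
- move=> X Y Z x vX vY vZ Sx; rewrite /wconn.
  rewrite -[X x]scale1r (dS_linear _ _ _ (vf_smS vZ) Sx) chr_lin !scale1r.
  by rewrite addrACA.
- move=> h X Y x sh vX vY Sx; rewrite /wconn.
  rewrite -[h x *: X x]addr0 (dS_linear _ _ _ (vf_smS vY) Sx) chr_lin.
  have -> : dS Y x 0 = 0.
    have /eqP := dS_linear 1 0 0 (vf_smS vY) Sx.
    by rewrite !scale1r addr0 -subr_eq subrr => /eqP.
  have -> : B x 0 (Y x) = 0.
    have /eqP := chr_lin x 1 0 0 (Y x).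
    by rewrite !scale1r addr0 -subr_eq subrr => /eqP.
  by move: (B _ _ _) => z; rewrite !addr0 scalerDr.
- move=> X Y Z x vX vY vZ Sx; rewrite /wconn.
  rewrite (dSD _ (vf_smS vY) (vf_smS vZ) Sx) chrC -[Y x]scale1r chr_lin !scale1r.
  by rewrite (chrC x (Y x)) (chrC x (Z x)) addrACA.
- move=> h X Y x /smooth_onP sh vX vY Sx; rewrite /wconn.
  rewrite (dSZ _ sh (vf_smS vY) Sx) chrC -[h x *: Y x]addr0 chr_lin.
  have -> : B x 0 (X x) = 0.
    have /eqP := chr_lin x 1 0 0 (X x).
    by rewrite !scale1r addr0 -subr_eq subrr => /eqP.
  by rewrite (chrC x (Y x)); move: (B _ _ _) => z; rewrite !addr0 scalerDr addrA.
- move=> X Y x vX vY Sx; rewrite /wconn /lie_bracket (chrC x (Y x)).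
  by rewrite opprD addrACA subrr addr0.
- move=> X Y Z x vX vY vZ Sx.
  have tX := vf_tangent vX Sx; have tY := vf_tangent vY Sx; have tZ := vf_tangent vZ Sx.
  have [_ ->] := ddS_wmetric J ep0 EE Edot Sx tX (vf_smS vY) (vf_smS vZ).
  rewrite (chr_metric ep0 JJ Jdot EE EJ Edot Sx tX tY tZ) /wconn.
  move: (dS Y x (X x)) (dS Z x (X x)) (B x (X x) (Y x)) (B x (X x) (Z x)) => a b p q.
  rewrite /wmetric -[a + p]scale1r -[b + q]scale1r.
  rewrite !(scalerDr 1) !scale1r -[a]scale1r -[b]scale1r !hor_lin !eta_lin !scale1r.
  move: (hr x a) (hr x b) (hr x p) (hr x q) (hr x (Y x)) (hr x (Z x)) => a1 a2 a3 a4 a5 a6.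
  by rewrite !(dotDl, dotDr); ring.
Qed.

Lemma reeb_vf : vector_field T.
Proof.
apply/vector_fieldP; split=> [|x Sx]; first exact: smS_reeb.
exact: (x_reeb ep0 Jdot EE EJ Edot x).
Qed.

Lemma wconn_reeb X x : vector_field X -> S x -> wconn X T x = J (hr x (X x)).
Proof.
move=> vX Sx; have tX := vf_tangent vX Sx.
rewrite /wconn (ddS_reeb J E ep Sx tX).2.
exact: (chr_reeb ep0 JJ Jdot EE EJ Edot Sx tX).
Qed.

Lemma eta_reeb x : S x -> et x (T x) = 1.
Proof.
move=> Sx; have := eta_dec ep0 JJ Jdot EE Edot Sx 1 (dot0r (J x)).
by rewrite add0r scale1r.
Qed.

Lemma hor_reeb x : S x -> hr x (T x) = 0.
Proof. by move=> Sx; rewrite /hor eta_reeb // scale1r subrr. Qed.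

Lemma wmetric_reeb x u : S x -> g x (T x) u = et x u.
Proof. by move=> Sx; rewrite /wmetric eta_reeb // hor_reeb // dot0l mulr0 addr0 mul1r. Qed.

Lemma wmetric_Jhor x u v : S x -> tangent x u ->
  g x (J (hr x u)) v = f x * dot (J (hr x u)) (hr x v).
Proof.
move=> Sx tu; have h : dot (J x) (J (hr x u)) = 0.
  by rewrite Jdot JJ dotNl opprK; exact: (hor_x ep0 Jdot EE EJ Edot tu).
rewrite /wmetric.
by rewrite (hor_id E ep h) (eta_hor0 E ep h) mul0r add0r.
Qed.

(** For a torsion-free metric connection the Lie derivative of g along T is g(D_X T, Y) + g(X, D_Y
    T), and D_X T = J (hor X) is skew. *)
Lemma reeb_killing : killing g T.
Proof.
split=> [|X Y x vX vY Sx]; first exact: reeb_vf.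
have lc := wconn_levi_civita; have vT := reeb_vf; have gm := wmetric_riemannian.
have tX := vf_tangent vX Sx; have tY := vf_tangent vY Sx.
rewrite (lc_metric lc vT vX vY Sx).
rewrite -(lc_torsion_free lc vT vX Sx) -(lc_torsion_free lc vT vY Sx).
have t1 := wconn_tangent vT vX Sx; have t2 := wconn_tangent vT vY Sx.
have t3 := wconn_tangent vX vT Sx; have t4 := wconn_tangent vY vT Sx.
have symE := Defs.metric_sym gm.
rewrite (metricBl gm Sx t1 t3 tY) (symE x (X x) _ Sx tX (tangentB t2 t4)).
rewrite (metricBl gm Sx t2 t4 tX) (symE x (X x) _ Sx tX t2).
rewrite (wconn_reeb vX Sx) (wconn_reeb vY Sx).
rewrite (wmetric_Jhor _ Sx tX) (wmetric_Jhor _ Sx tY) (dotJ_flip Jdot (hr x (X x))).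
by ring.
Qed.

Lemma reeb_sasakian : sasakian g T.
Proof.
split; first exact: reeb_killing.
  by move=> x Sx; rewrite wmetric_reeb // eta_reeb.
exists wconn; split; first exact: wconn_levi_civita.
move=> X Y x vX vY Sx; have tX := vf_tangent vX Sx; have tY := vf_tangent vY Sx.
have vD := wconn_vf vX vY; have lc := wconn_levi_civita.
rewrite (wconn_reeb vD Sx) (wmetric_reeb _ Sx).
have -> : wconn X (wconn Y T) x
   = dS (fun y => J (hr y (Y y))) x (X x) + B x (X x) (J (hr x (Y x))).
  rewrite [LHS]/wconn (wconn_reeb vY Sx); congr (_ + _).
  by apply: (eq_dS _ Sx) => y Sy; exact: wconn_reeb.
rewrite (ddS_lin Sx J (ddS_hor J ep0 EE Edot Sx tX (vf_smS vY))).2.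
rewrite -(chr_sasakian ep0 JJ Jdot EE EJ Edot Sx tX tY) /wconn.
rewrite -[dS Y x (X x)]scale1r hor_lin !scale1r.
move: (hr x (dS _ _ _)) (hr x (Y x)) (hr x (B _ _ _)) => p q r.
move: (B _ _ _) (dhor _ _ _ _ _ _) => r' z.
by rewrite !JD; apply/rowP => i; rewrite !mxE; ring.
Qed.

End WeightedConnection.

(** * The Ricci eigenvector c *)

Section WeightedCurvature.
Context {R : realType} {m : nat}.
Local Notation V := 'rV[R]_m.+1.
Local Notation S := (sphere R m).
Variables (J E : {linear V -> V}) (ep : R).
Hypothesis ep0 : 0 < ep.
Hypothesis JJ : forall x, J (J x) = - x.
Hypothesis Jdot : forall x y, dot x (J y) = - dot (J x) y.
Hypothesis EE : forall x, E (E x) = E x.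
Hypothesis EJ : forall x, E (J x) = J (E x).
Hypothesis Edot : forall x y, dot x (E y) = dot (E x) y.
Hypothesis rank1 : forall x y, dot (E x) x *: E y =
  dot (E x) y *: E x + dot (J (E x)) y *: J (E x).
Implicit Types (x y u v w : V) (X Y Z : V -> V).

Local Notation f := (wf E ep).
Local Notation c := (wc E ep).
Local Notation g := (wmetric J E ep).
Local Notation hr := (hor J E ep).
Local Notation et := (eta J E ep).
Local Notation B := (chr J E ep).
Local Notation D := (wconn J E ep).
Local Notation Q := (wQ J E ep).

Let ED y z : E (y + z) = E y + E z. Proof. exact: raddfD. Qed.
Let EZ a y : E (a *: y) = a *: E y. Proof. exact: linearZ. Qed.

Lemma wQ_lin x a u v : Q x (a *: u + v) = a *: Q x u + Q x v.
Proof.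
rewrite /wQ hor_lin eta_lin /Qh.
move: (hr x u) (hr x v) (et x u) (et x v) (c x) => p q r s d.
rewrite !(ED, EZ) !(dotDr, dotZr).
by apply/rowP => i; rewrite !mxE; ring.
Qed.

Lemma wc_vf : vector_field c.
Proof.
apply/vector_fieldP; split=> [|x Sx]; first exact: (smS_wc ep0 EE Edot).
by rewrite /tangent /= dotC; exact: (wc_x ep0 EE Edot Sx).
Qed.

Lemma wconn_wc X x : vector_field X -> S x -> D X c x = Q x (X x).
Proof.
move=> vX Sx; have tX := vf_tangent vX Sx.
rewrite /wconn (ddS_wc ep0 EE Edot Sx tX).2.
exact: (chr_wc ep0 Jdot EE EJ Edot Sx tX).
Qed.

Lemma wconn_wc2 X Y x : vector_field X -> vector_field Y -> S x ->
  D X (D Y c) x = dwQ J E ep x (X x) (Y x) + Q x (dS Y x (X x)) + B x (X x) (Q x (Y x)).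
Proof.
move=> vX vY Sx; have tX := vf_tangent vX Sx; have tY := vf_tangent vY Sx.
rewrite [LHS]/wconn (wconn_wc vY Sx); congr (_ + _).
rewrite -(ddS_wQ ep0 JJ Jdot EE EJ Edot Sx tX (vf_smS vY) tY).2.
by apply: (eq_dS _ Sx) => y Sy; exact: wconn_wc.
Qed.

Lemma curvature_wconn X Y x : vector_field X -> vector_field Y -> S x ->
  1 - f x != 0 -> curvature D X Y c x =
  curvh J E ep x (c x) (f x) (hr x (X x)) (et x (X x)) (hr x (Y x)) (et x (Y x)).
Proof.
move=> vX vY Sx f1; have tX := vf_tangent vX Sx; have tY := vf_tangent vY Sx.
have vL := lie_bracket_vf vX vY.
rewrite -(curvature_wc ep0 JJ Jdot EE EJ Edot Sx (rank1 x) f1 tX tY).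
rewrite /curvature (wconn_wc2 vX vY Sx) (wconn_wc2 vY vX Sx) (wconn_wc vL Sx).
(* The terms Q(dY(X)) and Q(dX(Y)) of the second derivatives cancel with the bracket term, which
   leaves a pointwise expression. *)
have -> : Q x (lie_bracket X Y x) = Q x (dS Y x (X x)) - Q x (dS X x (Y x)).
  by rewrite /lie_bracket addrC -scaleN1r wQ_lin scaleN1r addrC.
move: (Q x (dS Y x (X x))) (Q x (dS X x (Y x))) (B _ _ _) (B _ _ _) (dwQ _ _ _ _ _ _)
  (dwQ _ _ _ _ _ _) => a b p q r s.
by apply/rowP => i; rewrite !mxE; ring.
Qed.

Lemma weighted_ricci x : S x -> 1 - f x != 0 -> c x != 0 ->
  ricci_eigenvalue g D x (@curvature_slope R m ep (f x)).
Proof.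
move=> Sx f1 c0; exists (c x); split=> //; first exact: (vf_tangent wc_vf Sx).
move=> v tv; rewrite -(ltrace_curvature_wc ep0 JJ Jdot EE EJ Edot Sx (rank1 x) f1 tv).
apply: eq_ltrace => u.
have gm := wmetric_riemannian J ep0 EE Edot.
have lc := wconn_levi_civita ep0 JJ Jdot EE EJ Edot.
have vu := tangent_field_vf u; have vv := tangent_field_vf v.
have := curvature_tensorE gm lc vu vv wc_vf Sx.
rewrite (tangent_fieldE tv) => <-.
by rewrite (curvature_wconn vu vv Sx f1) (tangent_fieldE tv).
Qed.

End WeightedCurvature.

(** * Isometries and cohomogeneity *)

Section IsometryGroup.
Context {R : realType} {m : nat}.
Local Notation V := 'rV[R]_m.+1.
Local Notation S := (sphere R m).
Variable g : V -> V -> V -> R.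
Implicit Types (x y u v w : V) (phi psi : V -> V).

Lemma isometry_comp phi psi : Defs.isometry g phi -> Defs.isometry g psi ->
  Defs.isometry g (fun x => phi (psi x)).
Proof.
move=> [/smooth_onP_rV s1 S1 [p1 [/smooth_onP_rV t1 P1]] i1].
move=> [/smooth_onP_rV s2 S2 [p2 [/smooth_onP_rV t2 P2]] i2].
split.
- by apply/smooth_onP_rV; exact: smS_comp_rV.
- by move=> x Sx; exact: S1 (S2 _ Sx).
- exists (fun y => p2 (p1 y)); split.
    by apply/smooth_onP_rV; apply: smS_comp_rV => // y /P1[].
  move=> x Sx; have [a1 _ a3] := P1 x Sx; have [b1 _ b3] := P2 _ a1.
  have [_ c2 _] := P1 _ (S2 _ Sx); have [_ d2 _] := P2 _ Sx.
  by split; [exact: b1|rewrite c2|rewrite b3].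
- move=> x u v Sx tu tv.
  rewrite (dS_comp_rV u S2 s2 s1 Sx) (dS_comp_rV v S2 s2 s1 Sx).
  rewrite (i1 _ _ _ (S2 _ Sx) (dS_map_tangent u s2 S2 Sx) (dS_map_tangent v s2 S2 Sx)).
  exact: i2.
Qed.

Lemma isometry_inv phi : Defs.isometry g phi -> exists psi,
  Defs.isometry g psi /\ forall x, S x -> psi (phi x) = x.
Proof.
move=> [/smooth_onP_rV sphi Sphi [psi [/smooth_onP_rV spsi psiP]] iso].
have Spsi y : S y -> S (psi y) by move=> /psiP[].
have phiK y : S y -> psi (phi y) = y by move=> /psiP[].
have psiK y : S y -> phi (psi y) = y by move=> /psiP[].
exists psi; split=> //; split=> //.
- exact/smooth_onP_rV.
- exists phi; split; first exact/smooth_onP_rV.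
  by move=> x Sx; split; [exact: Sphi|exact: psiK|exact: phiK].
- move=> x u v Sx tu tv.
  rewrite -(iso _ _ _ (Spsi _ Sx) (dS_map_tangent u spsi Spsi Sx)
    (dS_map_tangent v spsi Spsi Sx)).
  rewrite (dS_phi_psi sphi spsi Spsi psiK u Sx) (dS_phi_psi sphi spsi Spsi psiK v Sx).
  by rewrite psiK // !tangent_projE.
Qed.

End IsometryGroup.

(** * Unitary maps commuting with E, and transitivity on levels *)

Section ComplexReflection.
Context {R : realType} {m : nat}.
Local Notation V := 'rV[R]_m.+1.
Local Notation S := (sphere R m).
Variables (J E : {linear V -> V}) (ep : R).
Hypothesis ep0 : 0 < ep.
Hypothesis JJ : forall x, J (J x) = - x.
Hypothesis Jdot : forall x y, dot x (J y) = - dot (J x) y.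
Hypothesis EE : forall x, E (E x) = E x.
Hypothesis EJ : forall x, E (J x) = J (E x).
Hypothesis Edot : forall x y, dot x (E y) = dot (E x) y.
Implicit Types (x y u v w a b : V).

Let JD y z : J (y + z) = J y + J z. Proof. exact: raddfD. Qed.
Let JN y : J (- y) = - J y. Proof. exact: raddfN. Qed.
Let JZ s y : J (s *: y) = s *: J y. Proof. exact: linearZ. Qed.
Let ED y z : E (y + z) = E y + E z. Proof. exact: raddfD. Qed.
Let EN y : E (- y) = - E y. Proof. exact: raddfN. Qed.
Let EZ s y : E (s *: y) = s *: E y. Proof. exact: linearZ. Qed.

Definition wunitary (L : {linear V -> V}) := [/\ forall v, L (J v) = J (L v),
  forall v, L (E v) = E (L v) & forall u v, dot (L u) (L v) = dot u v].

(** The metric is built from [dot], J and E, which L respects, and L is its own differential; [L']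
    supplies the smooth inverse. *)
Lemma wunitary_isometry (L L' : {linear V -> V}) : wunitary L ->
  (forall v, L' (L v) = v) -> (forall v, L (L' v) = v) ->
  Defs.isometry (wmetric J E ep) L.
Proof.
move=> [LJ LE Ldot] LK L'K; have LD := @raddfD _ _ L; have LN := @raddfN _ _ L.
have LZ s y : L (s *: y) = s *: L y by exact: linearZ.
have SL x : S x -> S (L x) by rewrite /sphere /= Ldot.
have smL (M : {linear V -> V}) : smS M by exact: (smS_map M (@smS_id R m)).
split=> //.
- exact/smooth_onP_rV.
- exists L'; split; first exact/smooth_onP_rV.
  by move=> x Sx; split=> //; rewrite /sphere /= -Ldot L'K.
- move=> x u v Sx tu tv.
  have dL w : tangent x w -> dS L x w = L w.
    by move=> tw; have [_ ] := ddS_lin Sx L (ddS_id Sx tw).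
  have fE : wf E ep (L x) = wf E ep x by rewrite /wf /wsigma -LE Ldot.
  have eE w : eta J E ep (L x) (L w) = eta J E ep x w by rewrite /eta fE -LJ Ldot.
  have hE w : hor J E ep (L x) (L w) = L (hor J E ep x w).
    by rewrite /hor eE /reeb -LE -!LJ -!LZ -LD -LZ -LN -LD.
  by rewrite (dL u tu) (dL v tv) /wmetric fE !eE !hE Ldot.
Qed.

(* With the hermitian product h, antilinear in its second argument and with
   real part [dot], this is v |-> v - (h v w / (al + i be)) w. *)
Definition crefl (w : V) (al be : R) (v : V) : V :=
  v - ((al * dot w v + be * dot (J w) v) / (al ^+ 2 + be ^+ 2)) *: w
    - ((al * dot (J w) v - be * dot w v) / (al ^+ 2 + be ^+ 2)) *: J w.

Lemma crefl_linear w al be : linear (crefl w al be).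
Proof.
move=> s u v; rewrite /crefl !(dotDr, dotZr).
by apply/rowP => i; rewrite !mxE; ring.
Qed.

HB.instance Definition _ w al be :=
  GRing.isLinear.Build R V V *:%R (crefl w al be) (crefl_linear w al be).

Section Reflection.
Variables (w : V) (al be : R).
Hypotheses (N0 : al ^+ 2 + be ^+ 2 != 0) (ww : dot w w = 2 * al).

Let Jww : dot (J w) w = 0. Proof. exact: Jskew. Qed.
Let wJw : dot w (J w) = 0. Proof. by rewrite dotC Jww. Qed.
Let JwJw : dot (J w) (J w) = 2 * al. Proof. by rewrite Jdot JJ dotNl opprK. Qed.

(** On w the map is multiplication by 1 - |w|^2 / (al + i be), which is unimodular when |w|^2 = 2
    al; conjugation, be |-> - be, inverts it. *)
Lemma crefl_K v : crefl w al (- be) (crefl w al be v) = v.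
Proof.
rewrite /crefl !(dotDr, dotNr, dotZr) Jww wJw JwJw ww sqrrN.
by apply/rowP => i; rewrite !mxE; field.
Qed.

Lemma crefl_unitary : E w = w \/ E w = 0 -> wunitary (crefl w al be).
Proof.
move=> Ew; split=> [v|v|u v] /=.
- rewrite /crefl !(JD, JN, JZ) !Jdot !JJ !dotNl.
  by apply/rowP => i; rewrite !mxE; ring.
- rewrite /crefl !(ED, EN, EZ) !Edot !EJ.
  case: Ew => -> //; rewrite (raddf0 J) !dot0l.
  by apply/rowP => i; rewrite !mxE; ring.
- rewrite /crefl !(dotDl, dotNl, dotZl, dotDr, dotNr, dotZr) Jww wJw JwJw ww.
  by rewrite (dotC u w) (dotC u (J w)); field.
Qed.

End Reflection.

Lemma crefl_swap a b : dot a a = dot b b -> dot (a - b) (a - b) = 2 * dot (a - b) a.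
Proof. by move=> ab; rewrite !(dotDl, dotNl, dotDr, dotNr) -ab (dotC b a); ring. Qed.

(** With w = a - b the denominator al + i be is h a w itself, so a goes to a - w = b. It is nonzero
    because |a| = |b| gives <w, a> = |w|^2 / 2 > 0. *)
Lemma crefl_map a b : a != b -> dot a a = dot b b ->
  dot (a - b) a ^+ 2 + dot (J (a - b)) a ^+ 2 != 0 /\
  crefl (a - b) (dot (a - b) a) (dot (J (a - b)) a) a = b.
Proof.
rewrite -subr_eq0 => ab nab; have := crefl_swap nab; move Ew : (a - b) => w ww.
have w0 : 0 < dot w a.
  have : 0 < dot w w by rewrite dot_gt0 // -Ew.
  by rewrite ww pmulr_rgt0.
have N0 : dot w a ^+ 2 + dot (J w) a ^+ 2 != 0.
  by rewrite gt_eqF // ltr_pwDl ?exprn_gt0 // sqr_ge0.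
split=> //; have -> : b = a - w by rewrite -Ew opprB addrC subrK.
rewrite /crefl -!expr2 divff // scale1r (mulrC (dot (J w) a)) subrr mul0r scale0r.
by rewrite subr0.
Qed.

Lemma wunitary_map a b : dot a a = dot b b ->
  (E a = a /\ E b = b) \/ (E a = 0 /\ E b = 0) ->
  exists L : {linear V -> V}, [/\ Defs.isometry (wmetric J E ep) L, L a = b
    & forall v, dot (a - b) v = 0 -> dot (J (a - b)) v = 0 -> L v = v].
Proof.
move=> nab Eab; have [<-|ab] := eqVneq a b.
  exists idfun; split=> //; apply: (wunitary_isometry (L' := idfun)) => //.
have [N0 Cab] := crefl_map ab nab; have ww := crefl_swap nab.
exists (crefl (a - b) (dot (a - b) a) (dot (J (a - b)) a)); split=> //.
  apply: (wunitary_isometry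
      (L' := crefl (a - b) (dot (a - b) a) (- dot (J (a - b)) a))).
  - apply: crefl_unitary => //; rewrite ED EN.
    by case: Eab => -[-> ->]; [left|right; rewrite subrr].
  - by move=> v; exact: crefl_K.
  - move=> v; rewrite /= -[X in crefl _ _ X]opprK; apply: crefl_K => //.
    by rewrite sqrrN.
by move=> v h1 h2 /=; rewrite /crefl h1 h2 !mulr0 addr0 subr0 !mul0r !scale0r !subr0.
Qed.

Definition level x := dot (E x) x.

(** One reflection in each factor: the first carries E x to E y, the second x - E x to y - E y, and
    each fixes the other factor, which is orthogonal to its w and J w. *)
Lemma level_transitive x y : S x -> S y -> level x = level y ->
  exists phi, Defs.isometry (wmetric J E ep) phi /\ phi x = y.
Proof.
move=> Sx Sy xy.
have n1 : dot (E x) (E x) = dot (E y) (E y) by rewrite !Edot !EE.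
have [L1 [i1 e1 k1]] := wunitary_map n1 (or_introl (conj (EE x) (EE y))).
have EK z : E (z - E z) = 0 by rewrite ED EN EE subrr.
have nK z : S z -> dot (z - E z) (z - E z) = 1 - level z.
  move=> Sz; rewrite -[X in _ = X - _](Sz : dot z z = 1) /level.
  by rewrite !(dotDl, dotNl, dotDr, dotNr) !Edot EE; ring.
have n2 : dot (x - E x) (x - E x) = dot (y - E y) (y - E y) by rewrite !nK ?xy.
have [L2 [i2 e2 k2]] := wunitary_map n2 (or_intror (conj (EK x) (EK y))).
exists (fun z => L2 (L1 z)); split; first exact: isometry_comp.
have -> : L1 x = E y + (x - E x).
  have -> : L1 x = L1 (E x) + L1 (x - E x) by rewrite -raddfD addrC subrK.
  rewrite e1; congr (_ + _); apply: k1.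
    by rewrite -EN -ED -Edot EK dot0r.
  by rewrite -EN -ED -EJ -Edot EK dot0r.
have -> : L2 (E y + (x - E x)) = L2 (E y) + L2 (x - E x) by exact: raddfD.
rewrite e2 k2; first by rewrite addrC subrK.
  by rewrite Edot !(ED, EN) !EE !subrr dot0l.
by rewrite Edot EJ !(ED, EN) !EE !subrr (raddf0 J) dot0l.
Qed.

End ComplexReflection.

Lemma interval_avoid (R : realFieldType) (s : seq R) (lo hi : R) : lo < hi ->
  exists r, [/\ lo < r, r < hi & r \notin s].
Proof.
elim: s lo hi => [|a s IH] lo hi lh.
  by exists ((lo + hi) / 2); split=> //; [exact: (midf_lt lh).1|exact: (midf_lt lh).2].
have [al|al] := leP a lo.
  have [r [r1 r2 r3]] := IH lo hi lh; exists r; split=> //.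
  by rewrite inE negb_or r3 gt_eqF // (le_lt_trans al).
have lm : lo < Num.min a hi by rewrite lt_min al.
have [r [r1 r2 r3]] := IH _ _ lm; move: r2; rewrite lt_min => /andP[ra rh].
by exists r; split=> //; rewrite inE negb_or r3 lt_eqF.
Qed.

(** * Orbits of the isometry group and levels of s *)

Section Levels.
Context {R : realType} {m : nat}.
Local Notation V := 'rV[R]_m.+1.
Local Notation S := (sphere R m).
Variables (J E : {linear V -> V}) (ep : R).
Hypothesis ep0 : 0 < ep.
Hypothesis JJ : forall x, J (J x) = - x.
Hypothesis Jdot : forall x y, dot x (J y) = - dot (J x) y.
Hypothesis EE : forall x, E (E x) = E x.
Hypothesis EJ : forall x, E (J x) = J (E x).
Hypothesis Edot : forall x y, dot x (E y) = dot (E x) y.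
Hypothesis rank1 : forall x y, dot (E x) x *: E y =
  dot (E x) y *: E x + dot (J (E x)) y *: J (E x).
Implicit Types (x y u v w a b : V).

Local Notation f := (wf E ep).
Local Notation c := (wc E ep).
Local Notation g := (wmetric J E ep).
Local Notation level := (level E).

Let ED y z : E (y + z) = E y + E z. Proof. exact: raddfD. Qed.
Let EN y : E (- y) = - E y. Proof. exact: raddfN. Qed.
Let EZ s y : E (s *: y) = s *: E y. Proof. exact: linearZ. Qed.

Lemma levelE x : level x = dot (E x) (E x).
Proof. by rewrite Edot EE. Qed.

Lemma level_ge0 x : 0 <= level x.
Proof. by rewrite levelE dot_ge0. Qed.

Lemma levelC x : S x -> dot (x - E x) (x - E x) = 1 - level x.
Proof.
move=> Sx; rewrite -[X in _ = X - _](Sx : dot x x = 1) /level.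
by rewrite !(dotDl, dotNl, dotDr, dotNr) !Edot EE; ring.
Qed.

Lemma level_le1 x : S x -> level x <= 1.
Proof. by move=> Sx; rewrite -subr_ge0 -levelC // dot_ge0. Qed.

(** The nonzero coefficient of t makes the Ricci eigenvalue of c determine f, and with it the
    level. *)
Lemma curvature_slope_affine : exists k0 k1 : R, k1 != 0 /\
  forall t, @curvature_slope R m ep t = k0 + k1 * t.
Proof.
pose N : R := m.+1%:R.
exists (N - 2 - (N + 2) * (3 + ep) / 2 - (N - 2) * (1 + ep) / 2 - 2),
  ((1 + ep) * (2 * N + 4)); split.
  by rewrite mulf_neq0 // gt_eqF // ltr_pwDr // ?mulr_ge0 // ltW.
by move=> t; rewrite /curvature_slope /nuh -/N; field.
Qed.

Lemma level_ricci x : S x -> 0 < level x -> level x < 1 ->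
  ricci_eigenvalue g (wconn J E ep) x (@curvature_slope R m ep (f x)).
Proof.
move=> Sx l0 l1; have s0 : 0 < 1 + ep * level x by rewrite ltr_pwDl // mulr_ge0 // ltW.
have F1 : 1 - f x != 0.
  rewrite subr_eq0 eq_sym invr_eq1 /wsigma -/(level x) -subr_eq0 addrC addKr.
  by rewrite mulf_neq0 // gt_eqF.
apply: (weighted_ricci ep0 JJ Jdot EE EJ Edot rank1 Sx F1).
suff : dot (c x) (c x) != 0 by apply: contra => /eqP ->; rewrite dot0l.
rewrite (wc_wc ep0 EE Edot Sx) mulf_neq0 //.
have -> : (1 + ep) * f x - 1 = ep * (1 - level x) / (1 + ep * level x).
  by rewrite /wf /wsigma -/(level x); field; rewrite gt_eqF.
by rewrite !mulf_neq0 ?invr_eq0 ?subr_eq0 ?(gt_eqF l1) // gt_eqF.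
Qed.

(** The point x may lie on any level, 0 and 1 included: the eigenvector is found at y and
    transported back to x. *)
Lemma orbit_levels_finite x : S x -> exists s : seq R, forall y,
  isometry_orbit g x y -> 0 < level y -> level y < 1 -> level y \in s.
Proof.
move=> Sx; have gm := wmetric_riemannian J ep0 EE Edot.
have lc := wconn_levi_civita ep0 JJ Jdot EE EJ Edot.
have [s Hs] := ricci_eigenvalues_finite gm (wconn J E ep) Sx.
have [k0 [k1 [k1n0 kE]]] := curvature_slope_affine.
(* The inverse of the function s |-> k0 + k1 / (1 + ep s). *)
exists [seq (((t - k0) / k1)^-1 - 1) / ep | t <- s].
move=> y [phi [iphi phix]] l0 l1.
have Sy : S y by rewrite -phix; case: iphi => _ Sphi _ _; exact: Sphi.
have [psi [ipsi psiK]] := isometry_inv iphi.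
have := isometry_ricci_eigenvalue gm lc ipsi Sy (level_ricci Sy l0 l1).
rewrite -{1}phix psiK // => /Hs sl.
apply/mapP; exists (@curvature_slope R m ep (f y)) => //.
rewrite kE (addrC k0) addrK (mulrC k1) mulfK // invrK /wsigma -/(level y).
by field; rewrite gt_eqF.
Qed.

Lemma orbit_sub x y : isometry_orbit g x y -> isometry_orbit g y `<=` isometry_orbit g x.
Proof.
move=> [phi [iphi <-]] z [psi [ipsi <-]].
by exists (fun x => psi (phi x)); split; first exact: isometry_comp.
Qed.

Lemma orbit_sym x y : S x -> isometry_orbit g x y -> isometry_orbit g y x.
Proof.
move=> Sx [phi [iphi <-]]; have [psi [ipsi psiK]] := isometry_inv iphi.
by exists psi; split=> //; exact: psiK.
Qed.

Lemma orbit_sphere x y : S x -> isometry_orbit g x y -> S y.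
Proof. by move=> Sx [phi [[_ Sphi _ _] <-]]; exact: Sphi. Qed.

Lemma level_orbit x y : S x -> S y -> level x = level y -> isometry_orbit g x y.
Proof. by move=> Sx Sy /(level_transitive ep JJ Jdot EE EJ Edot Sx Sy). Qed.

Lemma level_cont x : {for x, continuous level}.
Proof.
have I := @Ck_id R 0 V setT.
have C := Ck_dot openT (Ck_lin (lin1_mx E) openT I) I.
have -> : level = (fun y => dot (y *m lin1_mx E) y).
  by apply/funext => y; rewrite mul_rV_lin1.
exact: (C x Logic.I).
Qed.

Lemma open_level_avoid (s : seq R) : open [set x | level x \notin s].
Proof.
elim: s => [|t s IH].
  by rewrite (_ : mkset _ = setT) ?predeqE //; exact: openT.
rewrite (_ : mkset _ = (level @^-1` (~` [set t])) `&` [set x | level x \notin s]).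
  apply: openI => //; apply: open_comp => [x _|]; first exact: level_cont.
  by apply: closed_openC; exact: (@closed_eq R t).
apply/seteqP; split=> x /=; rewrite inE negb_or.
  by move=> /andP[/eqP].
by move=> [/eqP -> ->].
Qed.

Lemma smS_level : smS level.
Proof.
by apply: smS_dot; [apply: (smS_map E (X := id))|]; exact: smS_id.
Qed.

Lemma dS_level x v : S x -> tangent x v -> dS level x v = 2 * dot (E x) v.
Proof.
move=> Sx tv; have id' := ddS_id Sx tv.
have [_ ->] := ddS_dot Sx (ddS_lin Sx E id') id'.
by rewrite (dotC (E v)) Edot; ring.
Qed.

Variables (a b : V).
Hypotheses (Sa : S a) (Sb : S b) (Ea : E a = a) (Eb : E b = 0).

Lemma level_a : level a = 1. Proof. by rewrite /level Ea. Qed.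
Lemma level_b : level b = 0. Proof. by rewrite /level Eb dot0l. Qed.

Lemma level_dense (s : seq R) : S `<=` closure (S `&` [set x | level x \notin s]).
Proof.
move=> x Sx U Ux.
(* Unit vectors along E x and x - E x; [a] and [b] step in when one of these components vanishes. *)
pose y1 := if level x == 0 then a else (Num.sqrt (level x))^-1 *: E x.
pose y0 := if level x == 1 then b else (Num.sqrt (1 - level x))^-1 *: (x - E x).
have l0 := level_ge0 x; have l1 := level_le1 Sx.
have l1' : 0 <= 1 - level x by rewrite subr_ge0.
have [E1 n1 x1] : [/\ E y1 = y1, dot y1 y1 = 1 & Num.sqrt (level x) *: y1 = E x].
  rewrite /y1; case: eqVneq => [e|e].
    split=> //; rewrite e sqrtr0 scale0r; apply/esym/dot_eq0.
    by rewrite -levelE e.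
  have q0 : Num.sqrt (level x) != 0 by rewrite sqrtr_eq0 -ltNge lt_neqAle eq_sym e.
  split; first by rewrite EZ EE.
    by rewrite dotZl dotZr -levelE mulrA -expr2 exprVn sqr_sqrtr // mulVf.
  by rewrite scalerA divff // scale1r.
have [E0 n0 x0] : [/\ E y0 = 0, dot y0 y0 = 1 & Num.sqrt (1 - level x) *: y0 = x - E x].
  rewrite /y0; case: eqVneq => [e|e].
    split=> //; rewrite e subrr sqrtr0 scale0r; apply/esym/dot_eq0.
    by rewrite levelC // e subrr.
  have e' : 1 - level x != 0 by rewrite subr_eq0 eq_sym.
  have q0 : Num.sqrt (1 - level x) != 0 by rewrite sqrtr_eq0 -ltNge lt_neqAle eq_sym e'.
  split; first by rewrite EZ ED EN EE subrr scaler0.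
    by rewrite dotZl dotZr levelC // mulrA -expr2 exprVn sqr_sqrtr // mulVf.
  by rewrite scalerA divff // scale1r.
have y10 : dot y1 y0 = 0 by rewrite -E1 -Edot E0 dot0r.
(* A curve on the sphere through x, parametrized by its level, so that a parameter near [level x]
   outside [s] gives the required point. *)
pose p (r : R) : V := Num.sqrt r *: y1 + Num.sqrt (1 - r) *: y0.
have px : p (level x) = x by rewrite /p x1 x0 addrC subrK.
have pS r : 0 <= r -> r <= 1 -> S (p r) /\ level (p r) = r.
  move=> r0 r1; have r1' : 0 <= 1 - r by rewrite subr_ge0.
  have Ep : E (p r) = Num.sqrt r *: y1 by rewrite /p ED !EZ E1 E0 scaler0 addr0.
  split; last by rewrite levelE Ep dotZl dotZr n1 mulr1 -expr2 sqr_sqrtr.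
  rewrite /sphere /= /p !(dotDl, dotDr, dotZl, dotZr) n1 n0 (dotC y0) y10.
  by rewrite !mulr0 !mulr1 addr0 add0r -!expr2 !sqr_sqrtr // addrC subrK.
have cp : {for level x, continuous p}.
  apply: cvgD; apply: cvgZr_tmp; first exact: sqrt_continuous.
  apply: (@continuous_comp _ _ _ (fun r : R => 1 - r) Num.sqrt); last exact: sqrt_continuous.
  by apply: cvgB; [exact: cvg_cst|exact: cvg_id].
have : nbhs (level x) (p @^-1` U) by apply: cp; rewrite px.
move=> /nbhs_ballP[d /= d0 dU].
have lh : Num.max 0 (level x - d) < Num.min 1 (level x + d).
  rewrite lt_min !gt_max ltr01 /=; apply/and3P; split.
  - by rewrite ltrBlDr (le_lt_trans l1) // ltrDl.
  - by rewrite ltr_wpDl.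
  - by rewrite ltrD2l gt0_cp.
have [r []] := interval_avoid s lh.
rewrite gt_max lt_min => /andP[r0 r1] /andP[r2 r3] rs.
have [Sr lr] := pS r (ltW r0) (ltW r2).
exists (p r); split; first by split=> //=; rewrite lr.
by apply: dU; rewrite /ball /= distrC ltr_distl r1 r3.
Qed.

Lemma weighted_cohomogeneity : cohomogeneity g 1.
Proof.
have [sa Ha] := orbit_levels_finite Sa; have [sb Hb] := orbit_levels_finite Sb.
(* Levels 0 and 1 lie in the orbits of b and a. Removing the levels that these two orbits reach
   keeps the orbit of x away from 0 and 1. *)
pose s := [:: 0, 1 & sa ++ sb].
exists [set x | level x \notin s]; split; [exact: open_level_avoid|exact: level_dense|].
move=> x Sx /= xs.
have l01 z : S z -> level z != 0 -> level z != 1 -> 0 < level z /\ level z < 1.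
  by move=> Sz z0 z1; rewrite !lt_neqAle z1 level_le1 // eq_sym z0 level_ge0.
have [x0 x1] : 0 < level x /\ level x < 1.
  by apply: l01 => //; apply: contra xs => /eqP ->; rewrite !inE eqxx ?orbT.
have orb z : isometry_orbit g x z -> S z /\ (level z != 0) && (level z != 1).
  move=> xz; have Sz := orbit_sphere Sx xz; split=> //.
  apply/andP; split; apply: contra xs => /eqP lz.
    have bz : isometry_orbit g b z by apply: level_orbit => //; rewrite level_b.
    have := Hb x (orbit_sub bz (orbit_sym Sx xz)) x0 x1.
    by rewrite !inE mem_cat => ->; rewrite !orbT.
  have az : isometry_orbit g a z by apply: level_orbit => //; rewrite level_a.
  have := Ha x (orbit_sub az (orbit_sym Sx xz)) x0 x1.
  by rewrite !inE mem_cat => ->; rewrite !orbT.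
have [L HL] := orbit_levels_finite Sx.
split=> [z /orb[]//|p xp]; have [Sp /andP[p0 p1]] := orb p xp.
(* The levels other than that of p which the orbit may meet, together with 0 and 1, where the level
   function is critical. *)
pose F := [seq t <- [:: 0, 1 & L] | t != level p].
exists [set q | level q \notin F], (fun q => (level q - level p)%:M : 'rV[R]_1).
have F0 q : level q \notin F -> S q -> 0 < level q /\ level q < 1.
  rewrite /F => lF Sq; apply: l01 => //; apply: contra lF => /eqP ->.
    by rewrite mem_filter eq_sym p0 inE eqxx.
  by rewrite mem_filter eq_sym p1 !inE eqxx orbT.
have sf : smS (fun q => (level q - level p)%:M : 'rV[R]_1).
  apply: smS_rV => j; apply: eq_smS (smSD smS_level (smS_cst (- level p))) => q _.
  by rewrite ord1 mxE eqxx mulr1n.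
split.
- exact: open_level_avoid.
- by rewrite /= mem_filter eqxx.
- have /smooth_onP_rV H := sf => y [Sy _].
  have [U [G [oU Uy CG GE]]] := H y Sy.
  by exists U, G; split=> // z [Sz _]; exact: GE.
- move=> q Sq /F0 /(_ Sq) [q0 q1] w.
  (* Along E q - s q, with s = [level q], the level has derivative 2 s (1 - s). *)
  pose k := w 0 0 / (2 * (level q * (1 - level q))).
  have qq : dot q q = 1 := Sq.
  have tv : tangent q (k *: (E q - level q *: q)).
    by rewrite /tangent /= dotZr dotDr dotNr dotZr qq mulr1 Edot subrr mulr0.
  exists (k *: (E q - level q *: q)) => //.
  apply/rowP => j; rewrite (dS_coord _ _ sf Sq) ord1.
  rewrite (eq_dS (g := fun z => level z + - level p) _ Sq); last first.
    by move=> z _; rewrite mxE eqxx mulr1n.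
  rewrite (dSD _ smS_level (smS_cst (- level p)) Sq) dS_cst addr0 (dS_level Sq tv).
  rewrite dotZr dotDr dotNr dotZr -levelE -/(level q) /k; field.
  by rewrite subr_eq0 (gt_eqF q1) gt_eqF.
- apply/seteqP; split=> q /=.
    move=> [xq qF]; have [Sq /andP[q0 q1]] := orb q xq; split=> //.
    have [l0 l1] := l01 q Sq q0 q1; have := HL q xq l0 l1 => qL.
    apply/rowP => j; rewrite ord1 !mxE eqxx mulr1n; apply/eqP; rewrite subr_eq0.
    by apply: contraR qF => qp; rewrite mem_filter qp !inE qL !orbT.
  move=> [Sq qF /rowP/(_ 0)]; rewrite !mxE eqxx mulr1n => /eqP; rewrite subr_eq0 => /eqP qp.
  by split=> //; apply: (orbit_sub xp); exact: level_orbit.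
Qed.

End Levels.

(** * Irregularity *)

Section Trigonometry.
Context {R : realType}.
Implicit Types (t : R).

(** Once full turns are removed, [cos_inj] applies on [0, pi] to the remainder r itself or, beyond
    pi, to 2 pi - r. *)
Lemma cos_eq1_nat t : 0 <= t -> cos t = 1 -> exists k : nat, t = (pi *+ 2) *+ k.
Proof.
move=> t0 ct; have pp : 0 < (pi : R) *+ 2 by rewrite pmulrn_lgt0 // pi_gt0.
have /andP[k1 k2] := truncn_itv (divr_ge0 t0 (ltW pp)).
move: (Num.truncn _) k1 k2 => k; rewrite ler_pdivlMr // ltr_pdivrMr // => k1 k2.
exists k; pose r := t - (pi *+ 2) *+ k.
have r0 : 0 <= r by rewrite subr_ge0 -mulr_natl.
have r1 : r < pi *+ 2 by rewrite ltrBlDr -mulrS -[X in _ < X]mulr_natl.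
have cr : cos r = 1 by rewrite -ct -(periodicn (@cosD2pi R) k r) subrK.
suff : r = 0 by move/eqP; rewrite subr_eq0 => /eqP.
have c0 : (0 : R) \in `[0, pi] by rewrite in_itv /= lexx pi_ge0.
have [rp|rp] := leP r pi.
  by apply: cos_inj => //; rewrite ?in_itv /= ?r0 // cos0.
have : pi *+ 2 - r = 0.
  apply: cos_inj => //; rewrite ?in_itv /=.
    by rewrite subr_ge0 (ltW r1) /= lerBlDr mulr2n lerD2l ltW.
  by rewrite cos0 addrC (cosD2pi (- r)) cosN.
by move/eqP; rewrite subr_eq0 gt_eqF.
Qed.

Lemma cos_eq1 t : cos t = 1 -> exists k : int, t = k%:~R * (2 * pi).
Proof.
move=> ct; have [t0|t0] := leP 0 t.
  have [k ->] := cos_eq1_nat t0 ct; exists k%:Z.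
  by rewrite -pmulrn -(mulr_natl pi 2) [RHS]mulr_natl.
have [//||k tk] := @cos_eq1_nat (- t); rewrite ?cosN ?oppr_ge0 ?ltW //.
exists (- k%:Z); rewrite -[t]opprK tk mulrNz mulNr.
by rewrite -pmulrn -(mulr_natl pi 2) [X in _ = - X]mulr_natl.
Qed.

(** Multiplication of x + 2 k sqrt 2, where x = 2 l + 1, by the unit 3 + 2 sqrt 2, starting from x =
    3 and k = 1. *)
Lemma pell_sequence (N : nat) : exists k l : nat,
  (N < k)%N /\ ((2 * l + 1) ^ 2 = 8 * k ^ 2 + 1)%N.
Proof.
elim: N => [|N [k [l [Nk kl]]]]; first by exists 1%N, 1%N.
by exists (3 * k + 2 * l + 1)%N, (4 * k + 3 * l + 1)%N; split; nia.
Qed.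

End Trigonometry.

Section WeightedFlow.
Context {R : realType} {m : nat}.
Local Notation V := 'rV[R]_m.+1.
Local Notation S := (sphere R m).
Variables (J E : {linear V -> V}) (ep : R).
Hypothesis ep0 : 0 < ep.
Hypothesis JJ : forall x, J (J x) = - x.
Hypothesis Jdot : forall x y, dot x (J y) = - dot (J x) y.
Hypothesis EJ : forall x, E (J x) = J (E x).
Hypothesis Edot : forall x y, dot x (E y) = dot (E x) y.
Hypothesis ep2 : ep ^+ 2 = 2.
Variables (p q : V).
Hypotheses (Ep : E p = p) (Eq : E q = 0) (pp : dot p p = 2^-1) (qq : dot q q = 2^-1).

Let JD y z : J (y + z) = J y + J z. Proof. exact: raddfD. Qed.
Let JZ s y : J (s *: y) = s *: J y. Proof. exact: linearZ. Qed.
Let ED y z : E (y + z) = E y + E z. Proof. exact: raddfD. Qed.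
Let EZ s y : E (s *: y) = s *: E y. Proof. exact: linearZ. Qed.

Let w : R := 1 + ep.
Let c (t : R) : V := cos (w * t) *: p + sin (w * t) *: J p + (cos t *: q + sin t *: J q).

Let pJp : dot p (J p) = 0. Proof. by rewrite dotC (Jskew Jdot). Qed.
Let qJq : dot q (J q) = 0. Proof. by rewrite dotC (Jskew Jdot). Qed.
Let JpJp : dot (J p) (J p) = 2^-1. Proof. by rewrite Jdot JJ dotNl opprK. Qed.
Let JqJq : dot (J q) (J q) = 2^-1. Proof. by rewrite Jdot JJ dotNl opprK. Qed.
Let pq : dot p q = 0. Proof. by rewrite -Ep -Edot Eq dot0r. Qed.
Let pJq : dot p (J q) = 0. Proof. by rewrite -Ep -Edot EJ Eq (raddf0 J) dot0r. Qed.
Let Jpq : dot (J p) q = 0. Proof. by rewrite dotC Jdot dotC pJq oppr0. Qed.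
Let JpJq : dot (J p) (J q) = 0. Proof. by rewrite Jdot JJ dotNl pq !oppr0. Qed.

Let cp t : dot (c t) p = cos (w * t) / 2.
Proof.
rewrite /c !(dotDl, dotZl) pp (dotC (J p)) pJp (dotC q) pq (dotC (J q)) pJq.
by rewrite !mulr0 !addr0.
Qed.

Let cq t : dot (c t) q = cos t / 2.
Proof.
rewrite /c !(dotDl, dotZl) qq pq Jpq (dotC (J q)) qJq.
by rewrite !mulr0 !addr0 add0r.
Qed.

Let cS t : S (c t).
Proof.
rewrite /sphere /= /c !(dotDl, dotDr, dotZl, dotZr) pp qq JpJp JqJq pJp qJq pq pJq Jpq JpJq.
rewrite (dotC (J p) p) (dotC (J q) q) (dotC q p) (dotC (J q) p) (dotC q (J p)) (dotC (J q) (J p)).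
rewrite pJp qJq pq pJq Jpq JpJq.
have h1 := cos2Dsin2 (w * t); have h2 := cos2Dsin2 t; lra.
Qed.

Let dc (t : R) : is_derive t 1 c (reeb J E ep (c t)).
Proof.
have H i j : is_derive t 1 (fun s => c s i j) (reeb J E ep (c t) i j).
  have W : is_derive t (1 : R) (fun s => w * s) w.
    by apply: is_derive_eq; rewrite /GRing.scale /= mulr1.
  have C := is_derive1_comp (is_derive_cos (w * t)) W.
  have D := is_derive1_comp (is_derive_sin (w * t)) W.
  have C' := is_derive_cos t; have D' := is_derive_sin t.
  have K (s : R -> R) d k : is_derive t 1 s d -> is_derive t 1 (fun r => s r * k) (d * k).
    move=> ds; have -> : (fun r => s r * k) = k *: s.
      by apply/funext => r; rewrite mulrC.
    by rewrite mulrC; exact: (is_deriveZ k ds).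
  have HH := is_deriveD (is_deriveD (K _ _ (p i j) C) (K _ _ (J p i j) D))
    (is_deriveD (K _ _ (q i j) C') (K _ _ (J q i j) D')).
  have -> : (fun s => c s i j) = (fun r => cos (w * r) * p i j) + (fun r => sin (w * r) * J p i j)
      + ((fun r => cos r * q i j) + (fun r => sin r * J q i j)).
    by apply/funext => s; rewrite /c !mxE.
  apply: is_derive_eq.
  rewrite /reeb /c !(JD, ED, JZ, EZ) !EJ Ep Eq !(raddf0 J) !JJ !mxE /GRing.scale /= /w.
  by ring.
have dd : derivable c t 1 by apply/derivable_mxP => i j; case: (H i j).
split=> //; rewrite derive_mx //; apply/matrixP => i j; rewrite mxE.
by case: (H i j).
Qed.

(** Pairing with q and p forces t = 2 pi k and (1 + ep) t = pi + 2 pi l. Then 2 k ep is an odd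
    integer, and its square 8 k^2 would be odd. *)
Let c_range (t : R) : c t <> - p + q.
Proof.
move=> ct.
have c1 : cos t = 1.
  by have := cq t; rewrite ct dotDl dotNl pq oppr0 add0r qq; lra.
have c2 : cos (w * t - pi) = 1.
  have := cp t; rewrite ct dotDl dotNl (dotC q) pq addr0 pp => h.
  by rewrite cosB cospi sinpi mulr0 addr0; lra.
have [k tk] := cos_eq1 c1; have [l tl] := cos_eq1 c2.
have p0 : (pi : R) != 0 by rewrite gt_eqF // pi_gt0.
have e1 : 2 * k%:~R * ep = 2 * (l - k)%:~R + 1.
  apply: (mulIf p0); rewrite rmorphB /=.
  have : w * t = pi + l%:~R * (2 * pi) by rewrite -tl addrC subrK.
  by rewrite tk /w => h; lra.
move: (l - k) e1 => j e1.
have e2 : 8 * k ^+ 2 = (2 * j + 1) ^+ 2.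
  apply: (@intr_inj R); have -> : ((2 * j + 1) ^+ 2)%:~R = (2 * j%:~R + 1) ^+ 2 :> R by rewrite rmorphXn /= intrD intrM.
  rewrite -e1 intrM rmorphXn /=.
  have -> : (8%:~R * k%:~R ^+ 2 : R) = (2 * k%:~R) ^+ 2 * 2 by ring.
  by rewrite -ep2; ring.
by clear -e2; lia.
Qed.

(* If (2l+1)^2 = 8k^2 + 1 then ep * 2k is close to the odd number 2l+1, so that
   the flow carries p + q at time 2 pi k close to - p + q. *)
Let c_limit : closure (range c) (- p + q).
Proof.
(* Position at time 2 pi k as a function of the defect d = (2 l + 1) - 2 k ep; the target is at d =
   0. *)
pose G (d : R) : V := - cos (pi * d) *: p + sin (pi * d) *: J p + q.
have G0 : G 0 = - p + q.
  by rewrite /G mulr0 cos0 sin0 scaleN1r scale0r addr0.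
have ck k l : c (pi *+ 2 *+ k) = G ((2 * l + 1)%:R - ep * (2 * k)%:R).
  set d := (_ - _).
  have wt : w * (pi *+ 2 *+ k) = (pi - pi * d) + pi *+ 2 *+ (k + l).
    have hE i : pi *+ 2 *+ i = (2 * i)%:R * pi :> R by rewrite -mulrnA [RHS]mulr_natl.
    by rewrite !hE /w /d !(natrD, natrM); ring.
  have c0 : cos (pi *+ 2 *+ k) = 1 :> R.
    by rewrite -(add0r (_ *+ k)) (periodicn (@cosD2pi R)) cos0.
  have s0 : sin (pi *+ 2 *+ k) = 0 :> R.
    by rewrite -(add0r (_ *+ k)) (periodicn (@sinD2pi R)) sin0.
  rewrite /c wt c0 s0 (periodicn (@cosD2pi R)) (periodicn (@sinD2pi R)).
  have -> : cos (pi - pi * d) = - cos (pi * d) by rewrite cosB cospi sinpi; ring.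
  have -> : sin (pi - pi * d) = sin (pi * d) by rewrite sinB cospi sinpi; ring.
  by rewrite scale0r addr0 scale1r.
move=> U; rewrite -G0 => GU.
have mc : {for 0, continuous (fun d : R => pi * d)}.
  by apply: cvgM; [exact: cvg_cst|exact: cvg_id].
have cG : {for 0, continuous G}.
  apply: cvgD; last exact: cvg_cst.
  apply: cvgD; apply: cvgZr_tmp.
    by apply: cvgN; apply: (@continuous_comp _ _ _ (fun d : R => pi * d) cos) => //; exact: continuous_cos.
  by apply: (@continuous_comp _ _ _ (fun d : R => pi * d) sin) => //; exact: continuous_sin.
have /nbhs_ballP[e /= e0 eU] := cG U GU.
have [k [l [ek kl]]] := pell_sequence (Num.truncn e^-1).
exists (c (pi *+ 2 *+ k)); split; first by exists (pi *+ 2 *+ k).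
rewrite (ck k l); apply: eU; rewrite /ball /= sub0r normrN.
(* Pell's equation reads (x - y) (x + y) = 1, so the defect x - y is at most 1 / k, hence less than
   e. *)
set x := (2 * l + 1)%:R; set y := ep * _.
have xy : (x - y) * (x + y) = 1 :> R.
  have xx : x ^+ 2 = 8 * k%:R ^+ 2 + 1 by rewrite /x -natrX kl natrD natrM natrX.
  have yy : y ^+ 2 = 8 * k%:R ^+ 2.
    transitivity (ep ^+ 2 * (2 * k)%:R ^+ 2); first by rewrite /y; ring.
    by rewrite ep2 natrM; ring.
  by rewrite -subr_sqr xx yy addrAC subrr add0r.
have k0 : e^-1 < k%:R by rewrite (lt_le_trans (truncnS_gt _)) // ler_nat.
have ei : 0 < e^-1 by rewrite invr_gt0.
have x1 : k%:R <= x by rewrite /x ler_nat; nia.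
have y0 : 0 <= y by rewrite mulr_ge0 // ltW.
have S0 : 0 < x + y by lra.
have -> : x - y = (x + y)^-1.
  by apply: (mulIf (lt0r_neq0 S0)); rewrite xy mulVf ?lt0r_neq0.
rewrite gtr0_norm ?invr_gt0 // -[e]invrK ltf_pV2 ?posrE //; lra.
Qed.

Lemma reeb_irregular : irregular (reeb J E ep).
Proof.
exists c; split=> [t|cl]; first by split; [exact: cS|exact: dc].
by have [t _ ct] := cl _ c_limit; exact: (c_range ct).
Qed.

End WeightedFlow.

(** * The standard complex structure in real coordinates *)

Section StandardStructure.
Context {R : realType} {n : nat}.
Local Notation V := 'rV[R]_(2 * n + 1).+1.
Implicit Types (x y : V) (i : 'I_(2 * n + 1).+1).

(** Coordinates 2 j and 2 j + 1 are the real and imaginary part of one complex coordinate. As there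
    are 2 n + 2 of them, an even number, [inord] never falls back on its default. *)
Definition partner i : 'I_(2 * n + 1).+1 := inord (if odd i then i.-1 else i.+1).

Lemma val_partner i : partner i = (if odd i then i.-1 else i.+1) :> nat.
Proof.
rewrite /partner inordK //; have := ltn_ord i; move: (nat_of_ord i) => k.
by case: ifP; lia.
Qed.

Lemma odd_partner i : odd (partner i) = ~~ odd i.
Proof. by rewrite val_partner; case: ifP; lia. Qed.

Lemma partnerK : involutive partner.
Proof.
move=> i; apply: val_inj; rewrite /= val_partner odd_partner val_partner.
by case: (boolP (odd i)) => /= o; lia.
Qed.

Lemma partner_lt2 i : (partner i < 2)%N = (i < 2)%N.
Proof. by rewrite val_partner; case: ifP; lia. Qed.

Definition Jstd x : V := \row_i (if odd i then x 0 (partner i) else - x 0 (partner i)).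
Definition Estd x : V := \row_i (if (i < 2)%N then x 0 i else 0).

Lemma Jstd_linear : linear Jstd.
Proof.
by move=> a x y; apply/rowP => i; rewrite !mxE; case: ifP => _; ring.
Qed.

Lemma Estd_linear : linear Estd.
Proof.
by move=> a x y; apply/rowP => i; rewrite !mxE; case: ifP => _; ring.
Qed.

HB.instance Definition _ := GRing.isLinear.Build R V V *:%R Jstd Jstd_linear.
HB.instance Definition _ := GRing.isLinear.Build R V V *:%R Estd Estd_linear.

Lemma Jstd_sqr x : Jstd (Jstd x) = - x.
Proof.
apply/rowP => i; rewrite !mxE odd_partner partnerK.
by case: (odd i).
Qed.

Lemma Jstd_dot x y : dot x (Jstd y) = - dot (Jstd x) y.
Proof.
rewrite /dot (reindex_inj (inv_inj partnerK)) -sumrN; apply: eq_bigr => i _ /=.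
by rewrite !mxE odd_partner partnerK; case: (odd i) => /=; ring.
Qed.

Lemma Estd_idem x : Estd (Estd x) = Estd x.
Proof. by apply/rowP => i; rewrite !mxE; case: (i < 2)%N. Qed.

Lemma Estd_Jstd x : Estd (Jstd x) = Jstd (Estd x).
Proof.
apply/rowP => i; rewrite !mxE partner_lt2.
by case: (_ < _)%N; rewrite ?oppr0; case: (odd i).
Qed.

Lemma Estd_dot x y : dot x (Estd y) = dot (Estd x) y.
Proof.
by apply: eq_bigr => i _; rewrite !mxE; case: ifP; rewrite ?mulr0 ?mul0r.
Qed.

Let i0 : 'I_(2 * n + 1).+1 := inord 0.
Let i1 : 'I_(2 * n + 1).+1 := inord 1.
Let i0E : i0 = 0%N :> nat. Proof. by rewrite inordK. Qed.
Let i1E : i1 = 1%N :> nat. Proof. by rewrite inordK // addn1. Qed.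

Let sum2 (F : 'I_(2 * n + 1).+1 -> R) : (forall i, (2 <= i)%N -> F i = 0) ->
  \sum_i F i = F i0 + F i1.
Proof.
move=> F0; rewrite (bigD1 i0) //= (bigD1 i1) /=; last first.
  by rewrite -val_eqE /= i0E i1E.
rewrite big1 ?addr0 // => i /andP[]; rewrite -!val_eqE /= i0E i1E => h0 h1.
by apply: F0; lia.
Qed.

Let partner0 : partner i0 = i1.
Proof. by apply: val_inj; rewrite /= val_partner i0E i1E. Qed.
Let partner1 : partner i1 = i0.
Proof. by apply: val_inj; rewrite /= val_partner i0E i1E. Qed.

(** In C this reads |z|^2 w = Re(w z') z + Im(w z') i z, with z' the conjugate of z, for the first
    complex coordinates z of x and w of y. *)
Lemma Estd_rank1 x y : dot (Estd x) x *: Estd y =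
  dot (Estd x) y *: Estd x + dot (Jstd (Estd x)) y *: Jstd (Estd x).
Proof.
have d1 z : dot (Estd x) z = x 0 i0 * z 0 i0 + x 0 i1 * z 0 i1.
  rewrite [LHS]sum2 => [|i i2]; first by rewrite !mxE i0E i1E.
  by rewrite mxE ltnNge i2 mul0r.
have d2 : dot (Jstd (Estd x)) y = x 0 i0 * y 0 i1 - x 0 i1 * y 0 i0.
  rewrite -Estd_Jstd [LHS]sum2 => [|i i2]; last by rewrite mxE ltnNge i2 mul0r.
  by rewrite !mxE i0E i1E /= partner0 partner1; ring.
rewrite !d1 d2 -Estd_Jstd; apply/rowP => i; rewrite !mxE.
case: ltnP => i2; last by rewrite !mulr0 addr0.
have [->|->] : i = i0 \/ i = i1.
  have [e|e] := eqVneq (i : nat) 0%N; [left|right]; apply: val_inj => /=.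
    by rewrite e i0E.
  by rewrite i1E; lia.
  by rewrite i0E /= partner0; ring.
by rewrite i1E /= partner1; ring.
Qed.

Lemma dot_delta_self i : dot (delta_mx 0 i : V) (delta_mx 0 i) = 1.
Proof. by rewrite dot_delta mxE !eqxx. Qed.

Lemma Estd_delta i : Estd (delta_mx 0 i) = if (i < 2)%N then delta_mx 0 i else 0.
Proof.
apply/rowP => j; rewrite !mxE; have [->|ij] := eqVneq j i.
  by case: ifP; rewrite ?mxE ?eqxx.
by case: ifP; case: ifP; rewrite mxE ?(negbTE ij) ?andbF.
Qed.

End StandardStructure.

Theorem mainTheorem6 (R : realType) (n : nat) (hn : (1 <= n)%N) :
  exists (g : 'rV[R]_(2 * n + 1).+1 -> 'rV[R]_(2 * n + 1).+1 ->
              'rV[R]_(2 * n + 1).+1 -> R)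
         (T : 'rV[R]_(2 * n + 1).+1 -> 'rV[R]_(2 * n + 1).+1),
    riemannian_metric g /\ sasakian g T /\ irregular T /\ cohomogeneity g 1.
Proof.
pose J : {linear 'rV[R]_(2 * n + 1).+1 -> 'rV[R]_(2 * n + 1).+1} := @Jstd R n.
pose E : {linear 'rV[R]_(2 * n + 1).+1 -> 'rV[R]_(2 * n + 1).+1} := @Estd R n.
have JJ : forall x, J (J x) = - x := @Jstd_sqr R n.
have Jdot : forall x y, dot x (J y) = - dot (J x) y := @Jstd_dot R n.
have EE : forall x, E (E x) = E x := @Estd_idem R n.
have EJ : forall x, E (J x) = J (E x) := @Estd_Jstd R n.
have Edot : forall x y, dot x (E y) = dot (E x) y := @Estd_dot R n.
have rank1 : forall x y, dot (E x) x *: E y =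
  dot (E x) y *: E x + dot (J (E x)) y *: J (E x) := @Estd_rank1 R n.
pose ep : R := Num.sqrt 2.
have ep0 : 0 < ep by rewrite sqrtr_gt0.
have ep2 : ep ^+ 2 = 2 by rewrite sqr_sqrtr.
pose a : 'rV[R]_(2 * n + 1).+1 := delta_mx 0 (inord 0).
(* Index 2 is the first real coordinate of the second factor; it exists because n >= 1. *)
pose b : 'rV[R]_(2 * n + 1).+1 := delta_mx 0 (inord 2).
have Ea : E a = a by rewrite [LHS]Estd_delta inordK.
have Eb : E b = 0 by rewrite [LHS]Estd_delta inordK //; lia.
have Sa : sphere R (2 * n + 1) a by exact: dot_delta_self.
have Sb : sphere R (2 * n + 1) b by exact: dot_delta_self.
exists (wmetric J E ep), (reeb J E ep); split; first exact: wmetric_riemannian.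
split; first exact: reeb_sasakian.
split; last exact: (weighted_cohomogeneity ep0 JJ Jdot EE EJ Edot rank1 Sa Sb Ea Eb).
(* Each of the two components of the starting point contributes 1/2 to its squared norm. *)
pose r : R := Num.sqrt 2^-1.
have r2 : r * r = 2^-1 by rewrite -expr2 sqr_sqrtr // invr_ge0.
apply: (@reeb_irregular R _ J E ep ep0 JJ Jdot EJ Edot ep2 (r *: a) (r *: b)).
- by rewrite linearZ Ea.
- by rewrite linearZ Eb; exact: scaler0.
- by rewrite dotZl dotZr (Sa : dot a a = 1) mulr1.
- by rewrite dotZl dotZr (Sb : dot b b = 1) mulr1.
Qed.
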